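(* Let $\Gamma$ be a countable group. Then $\Gamma$ has property (T) if and only if it satisfies the following condition: for every measure-preserving action of $\Gamma$ on a measure space $(\Omega,\mathcal{B},\mu)$ and every set $S\in\mathcal{B}$ such that $\mu(S\,\triangle\, gS)<\infty$ for all $g\in\Gamma$, one has $$\sup_{g\in\Gamma}\mu(S\,\triangle\, gS)<\infty .$$
   Context: $\Gamma$ is regarded as a discrete group. It has (Kazhdan's) property (T) if the trivial representation is isolated in the unitary dual of $\Gamma$ (with the Fell topology). All measure spaces are positive (i.e. carry a measure with values in $[0,\infty]$) but not necessarily finite. A measure-preserving action of $\Gamma$ on $(\Omega,\mathcal{B},\mu)$ is a group action of $\Gamma$ on $\Omega$ such that for each $g\in\Gamma$ and $E\in\mathcal{B}$ one has $gE\in\mathcal{B}$ and $\mu(gE)=\mu(E)$. The symbol $\triangle$ denotes symmetric difference. *)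

(* Defs.v *)
From HB Require Import structures.
From mathcomp Require Import all_boot all_order all_algebra.
From mathcomp Require Import all_classical all_reals all_analysis.
From mathcomp Require Import complex.

Set Implicit Arguments.
Unset Strict Implicit.
Unset Printing Implicit Defensive.

Import Order.TTheory GRing.Theory Num.Theory numFieldNormedType.Exports.

Local Open Scope classical_set_scope.
Local Open Scope ring_scope.
Local Open Scope complex_scope.

(* The inner product is linear in its first argument and conjugate-linear in
   its second one. *)
Record hilbertSpace (R : realType) := HilbertSpace {
  hilbert_sort :> completeNormedModType R[i] ;
  inner : {dot hilbert_sort for (@Num.conj R[i])} ;
  inner_norm : forall x : hilbert_sort, `|x| ^+ 2 = inner x x }.

Arguments inner {R} h.

(* No continuity condition appears because the groups are discrete.
   Surjectivity of each [rep_fun g] follows from [rep1] and [repM]. *)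
Record unitaryRep (R : realType) (G : groupType) (H : hilbertSpace R) :=
  UnitaryRep {
  rep_fun :> G -> {linear H -> H} ;
  rep1 : forall x, rep_fun 1%g x = x ;
  repM : forall g h x, rep_fun (g * h)%g x = rep_fun g (rep_fun h x) ;
  rep_unitary : forall g x y,
    inner H (rep_fun g x) (rep_fun g y) = inner H x y }.

Definition closed_subspace (R : realType) (H : hilbertSpace R) (V : set H) :=
  [/\ V 0, forall (a : R[i]) x y, V x -> V y -> V (a *: x + y) & closed V].

Definition irreducible (R : realType) (G : groupType) (H : hilbertSpace R)
    (pi : unitaryRep G H) :=
  (exists x : H, x != 0) /\
  forall V : set H, closed_subspace V -> (forall g x, V x -> V (pi g x)) ->
    V = [set 0] \/ V = setT.

Record irrep (R : realType) (G : groupType) := Irrep {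
  irrep_space : hilbertSpace R ;
  irrep_rep :> unitaryRep G irrep_space ;
  irrep_irreducible : irreducible irrep_rep }.

Definition unitarily_equivalent (R : realType) (G : groupType)
    (p q : irrep R G) :=
  exists U : {linear irrep_space p -> irrep_space q},
    [/\ bijective U,
        forall x y, inner _ (U x) (U y) = inner _ x y &
        forall g x, U (p g x) = q g (U x)].

Section unitary_equivalence.
Variables (R : realType) (G : groupType).
Implicit Types p q r : irrep R G.

Lemma unitarily_equivalent_refl p : unitarily_equivalent p p.
Proof. by exists idfun; split=> //; exists idfun. Qed.

Lemma unitarily_equivalent_sym p q :
  unitarily_equivalent p q -> unitarily_equivalent q p.
Proof.
move=> [U [[V UK VK] Uinner UG]].
have Vlin : linear V.
  by move=> a x y; apply: (can_inj UK); rewrite linearP !VK.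
pose VL : {linear irrep_space q -> irrep_space p} :=
  HB.pack V (GRing.isLinear.Build _ _ _ _ V Vlin).
exists VL; split.
- by exists U.
- by move=> x y; rewrite -Uinner /= !VK.
- by move=> g x /=; apply: (can_inj UK); rewrite VK UG VK.
Qed.

Lemma unitarily_equivalent_trans p q r : unitarily_equivalent p q ->
  unitarily_equivalent q r -> unitarily_equivalent p r.
Proof.
move=> [U [Ubij Uinner UG]] [V [Vbij Vinner VG]].
exists (V \o U); split.
- exact: bij_comp.
- by move=> x y /=; rewrite Vinner Uinner.
- by move=> g x /=; rewrite UG VG.
Qed.

End unitary_equivalence.

Section unitary_dual.
Variables (R : realType) (G : groupType).

(* The points are the unitary equivalence classes of irreducible
   representations.  This type lives in a universe strictly above the one of
   the carriers of [set] and of all HB structures, hence the bare predicates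
   below and a topology given by its family of open sets. *)
Definition unitary_dual :=
  {C : irrep R G -> Prop | exists p, C = unitarily_equivalent p}.

Definition dual_class (p : irrep R G) : unitary_dual :=
  exist _ (unitarily_equivalent p) (ex_intro _ p erefl).

Lemma dual_classP (p q : irrep R G) :
  dual_class p = dual_class q <-> unitarily_equivalent p q.
Proof.
split=> [/(congr1 sval) /= ->|pq]; first exact: unitarily_equivalent_refl.
apply: eq_exist => /=; apply: functional_extensionality_dep => r.
apply/propext; split=> [|qr].
  by apply: unitarily_equivalent_trans; exact: unitarily_equivalent_sym.
exact: unitarily_equivalent_trans qr.
Qed.

(* The function of positive type g |-> <pi(g) x, x> associated with pi. *)
Definition coefficient (p : irrep R G) (x : irrep_space p) (g : G) : R[i] :=
  inner _ (p g x) x.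

(* The basic Fell neighbourhood of p given by finitely many functions of
   positive type associated with p, a finite (that is, compact) subset Q of G
   and e > 0: every one of these functions is, uniformly on Q, within e of a
   finite sum of functions of positive type associated with q. *)
Definition fell_basic (p : irrep R G) (xs : seq (irrep_space p)) (Q : set G)
    (e : R) (q : irrep R G) :=
  forall x, x \in xs -> exists ys : seq (irrep_space q),
    forall g, Q g ->
      `|coefficient x g - \sum_(y <- ys) coefficient y g| < e%:C.

Definition fell_open (A : unitary_dual -> Prop) :=
  forall p : irrep R G, A (dual_class p) ->
    exists (xs : seq (irrep_space p)) (Q : set G) (e : R),
      [/\ finite_set Q, 0 < e &
          forall q, fell_basic xs Q e q -> A (dual_class q)].

Lemma fell_openT : fell_open (fun=> True).
Proof. by move=> p _; exists [::], set0, 1; split. Qed.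

Lemma fell_openI (A B : unitary_dual -> Prop) :
  fell_open A -> fell_open B -> fell_open (fun c => A c /\ B c).
Proof.
move=> oA oB p [/oA[xs [Q [e [finQ e0 sA]]]] /oB[ys [P [f [finP f0 sB]]]]].
exists (xs ++ ys), (Q `|` P), (Num.min e f); split.
- by rewrite finite_setU.
- by rewrite lt_min e0.
move=> q near_q; split; [apply: sA|apply: sB] => x xin.
- have [|zs zsP] := near_q x; first by rewrite mem_cat xin.
  exists zs => g Qg; apply: (lt_le_trans (zsP _ _)); first by left.
  by rewrite lecR ge_min lexx.
- have [|zs zsP] := near_q x; first by rewrite mem_cat xin orbT.
  exists zs => g Qg; apply: (lt_le_trans (zsP _ _)); first by right.
  by rewrite lecR ge_min lexx orbT.
Qed.

Lemma fell_open_bigcup (I : Type) (F : I -> unitary_dual -> Prop) :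
  (forall i, fell_open (F i)) -> fell_open (fun c => exists i, F i c).
Proof.
move=> oF p [i /oF[xs [Q [e [finQ e0 sF]]]]].
by exists xs, Q, e; split=> // q /sF; exists i.
Qed.

End unitary_dual.

Section trivial_representation.
Variables (R : realType) (G : groupType).
Local Notation C := (R[i]^o).

Let gt0_complex (e : R[i]) : 0 < e -> 0 < complex.Re e /\ e = (complex.Re e)%:C.
Proof.
by case: e => a b; rewrite ltcE /= => /andP[/eqP-> ?].
Qed.

Let norm_le_ReIm (x : R[i]) : `|x| <= (`|complex.Re x| + `|complex.Im x|)%:C.
Proof.
rewrite {1}[x]complexE (le_trans (ler_normD _ _))// rmorphD /= lerD//.
  by rewrite normc_def /= expr0n addr0 sqrtr_sqr.
by rewrite normrM normc_def /= expr0n expr1n add0r sqrtr1 mul1r normc_def /=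
  expr0n addr0 sqrtr_sqr.
Qed.

Let norm_ge_Im (x : R[i]) : `|complex.Im x|%:C <= `|x|.
Proof.
have := normc_ge_Re (x * 'i%C); rewrite ReiNIm normrN normrM.
by rewrite [X in _ * X]normc_def /= expr0n expr1n add0r sqrtr1 mulr1.
Qed.

Lemma complex_complete (F : set_system C) :
  ProperFilter F -> cauchy F -> cvg F.
Proof.
move=> FF /cauchy_ballP Fc.
have cvg_part (f : C -> R) :
    (forall x y : C, `|f x - f y|%:C <= `|x - y|) -> cvg (f @ F).
  move=> f1; apply: cauchy_cvg; apply/cauchy_ballP => e e0.
  have e0' : 0 < e%:C :> R[i] by rewrite ltcR.
  have := Fc _ e0'.
  rewrite !near_simpl /= => -[[A B] /= [FA FB] AB].
  exists (f @` A, f @` B) => /=.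
    split; [apply: filterS FA|apply: filterS FB] => x ?; by exists x.
  move=> [_ _] /= [[x Ax <-] [y By <-]].
  have /= xy := AB (x, y) (conj Ax By).
  by rewrite /ball /= -ltcR (le_lt_trans (f1 _ _)).
have cRe : cvg ((fun x : C => complex.Re x) @ F).
  apply: cvg_part => x y.
  by have := normc_ge_Re (x - y); rewrite raddfB.
have cIm : cvg ((fun x : C => complex.Im x) @ F).
  apply: cvg_part => x y.
  by have := norm_ge_Im (x - y); rewrite raddfB.
apply/cvg_ex; exists (lim ((fun x : C => complex.Re x) @ F) +i*
  lim ((fun x : C => complex.Im x) @ F)) => /=.
apply/cvgrPdist_lt => e /gt0_complex[e0 ->].
have e20 : 0 < complex.Re e / 2 by rewrite divr_gt0.
move/cvgrPdist_lt : cRe => /(_ _ e20) nRe.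
move/cvgrPdist_lt : cIm => /(_ _ e20) nIm.
apply: filterS2 nRe nIm => -[u v] /= uRe vIm.
apply: (le_lt_trans (norm_le_ReIm _)).
by rewrite ltcR [ltRHS]splitr; apply: ltrD.
Qed.

Definition complex_plane : completeNormedModType R[i] :=
  HB.pack C (Uniform_isComplete.Build C complex_complete).

Definition complex_inner (x y : C) : R[i] := x * Num.conj y.

Let complex_inner_zmodl y : zmod_morphism (complex_inner^~ y).
Proof. by move=> u v; rewrite /complex_inner mulrBl. Qed.

Let complex_inner_zmodr x : zmod_morphism (complex_inner x).
Proof. by move=> u v; rewrite /complex_inner rmorphB mulrBr. Qed.

Let complex_inner_scalel y : scalable_for *%R (complex_inner^~ y).
Proof. by move=> a u; rewrite /complex_inner mulrA. Qed.

Let complex_inner_scaler x :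
  scalable_for (@Num.conj R[i] \; *%R) (complex_inner x).
Proof. by move=> a u; rewrite /complex_inner /= rmorphM mulrCA. Qed.

HB.instance Definition _ := isBilinear.Build R[i] C C R[i] *%R
  (@Num.conj R[i] \; *%R) complex_inner complex_inner_zmodl
  complex_inner_zmodr complex_inner_scalel complex_inner_scaler.

Let complex_inner_herm (x y : C) :
  complex_inner x y = (-1) ^+ false * Num.conj (complex_inner y x).
Proof. by rewrite expr0 mul1r /complex_inner rmorphM /= conjCK mulrC. Qed.

HB.instance Definition _ := isHermitianSesquilinear.Build R[i] C false
  (@Num.conj R[i]) complex_inner complex_inner_herm.

Let complex_inner_gt0 (x : C) : x != 0 -> 0 < complex_inner x x.
Proof. by move=> x0; rewrite /complex_inner -normCK exprn_gt0 ?normr_gt0. Qed.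

HB.instance Definition _ :=
  isDotProduct.Build R[i] C complex_inner complex_inner_gt0.

Let complex_inner_norm (x : C) : `|x| ^+ 2 = complex_inner x x.
Proof. exact: normCK. Qed.

Definition complex_hilbert : hilbertSpace R :=
  @HilbertSpace R complex_plane complex_inner complex_inner_norm.

Definition trivial_rep : unitaryRep G complex_hilbert :=
  @UnitaryRep R G complex_hilbert (fun=> idfun)
    (fun=> erefl) (fun _ _ _ => erefl) (fun _ _ _ => erefl).

Lemma trivial_rep_irreducible : irreducible trivial_rep.
Proof.
split; first by exists (1 : C); exact: oner_neq0.
move=> V [V0 Vlin _] _.
have [[x Vx x0]|VN] := pselect (exists2 x : C, V x & x != 0).
  right; apply/seteqP; split=> // y _.
  have := Vlin (y / x) x 0 Vx V0.
  by rewrite addr0 /GRing.scale /= divfK.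
left; apply/seteqP; split=> [x Vx|x ->//].
by apply: contrapT => /eqP x0; apply: VN; exists x.
Qed.

Definition trivial_irrep : irrep R G := Irrep trivial_rep_irreducible.

End trivial_representation.

(* A point of a topological space is isolated when its singleton is open. *)
Definition property_T (R : realType) (G : groupType) :=
  fell_open (fun c : unitary_dual R G => c = dual_class (trivial_irrep R G)).

Definition measure_preserving_action (R : realType) (G : groupType)
    (d : measure_display) (T : measurableType d)
    (mu : {measure set T -> \bar R}) (act : G -> T -> T) :=
  [/\ forall x, act 1%g x = x,
      forall g h x, act (g * h)%g x = act g (act h x) &
      forall g (E : set T), measurable E ->
        measurable (act g @` E) /\ mu (act g @` E) = mu E].

(* Main.v *)
(* If the trivial representation is isolated, some finite Q and delta > 0 are
   such that every extreme normalized positive definite function phi <> 1 has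
   1 - Re phi(g) >= delta for some g in Q: by the GNS construction phi is a
   coefficient of an irreducible representation.  Hence the affine inequality
   delta (1 - Re phi(h)) <= 2 sum_(g in Q) (1 - Re phi(g)) holds at the extreme
   points, so for every normalized positive definite function.  Applied to
   exp(- t mu(S + gS)), where S + gS is the symmetric difference, which is
   positive definite, with t small, it bounds mu(S + gS).

   Conversely, without property (T) there are unit vectors x in unitary
   representations that are almost fixed by a given finite Q and moved by at
   least 1 by some g0.  A Fejer-type formula turns the positive definite
   function exp(- |u|^2 / 2) on the representation space into a G-invariant
   probability measure on (Z/N)^G such that, identifying Z/N with the N-th roots
   of unity, the correlation of the coordinates at 1 and g is
   exp(- |x - g x|^2 / 2) up to 2 / N.  Cutting the circle by a suitable
   half-plane yields a G-invariant probability measure on {0,1}^G for which the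
   set S of those w with w(1) = 1 is displaced much less by Q than by g0.  An
   infinite sum of rescaled such measures displaces S unboundedly.  These
   measures on {0,1}^G are images of the Lebesgue measure of an interval. *)

Require Import Defs.
From HB Require Import structures.
From mathcomp Require Import all_boot all_order all_algebra.
From mathcomp Require Import all_classical all_reals all_analysis.
From mathcomp Require Import complex measurable_realfun ring lra.
From mathcomp Require cyclic separable cyclotomic.

Set Implicit Arguments.
Unset Strict Implicit.
Unset Printing Implicit Defensive.

Import Order.TTheory GRing.Theory Num.Theory numFieldNormedType.Exports.

Local Open Scope classical_set_scope.
Local Open Scope ring_scope.
Local Open Scope complex_scope.

(** The Hilbert space of a positive definite kernel is built without quotient or completion: its
    vectors are the functions whose Legendre transform against the Gram seminorm is bounded, and the
    supremum is the squared norm. As vectors are functions, cyclicity of the GNS vector is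
    immediate. No integral representation over extreme points is needed either: a finite real
    functional of a positive definite function attains its minimum at an extreme point, found as a
    lexicographic minimum along an enumeration of the group. In the converse direction the natural
    object would be a Gaussian process indexed by the orbit of x. Here each coordinate is instead
    rounded to N values by Fejer kernels, which act as commuting positive operators that sum to the
    identity but are not projections. Positivity and consistency of the finite laws become
    algebraic; the price is an error of order 1 / N, and laws that make sense only for distinct
    coordinates. *)

Lemma le_sum_mem (R : numDomainType) (I : eqType) (r : seq I) (F : I -> R) i :
  (forall j, 0 <= F j) -> i \in r -> F i <= \sum_(j <- r) F j.
Proof.
by move=> F0 ir; rewrite (big_rem i ir) /= lerDl; apply: sumr_ge0 => j _.
Qed.

(** * Squared modulus of complex numbers *)

Section ComplexFacts.
Variable R : realType.
Implicit Types (a b : R[i]) (t : R).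

Definition nsq a : R := complex.Re a ^+ 2 + complex.Im a ^+ 2.

Lemma nsq_ge0 a : 0 <= nsq a.
Proof. by rewrite addr_ge0// sqr_ge0. Qed.

Lemma normc_nsq a : `|a| = (Num.sqrt (nsq a))%:C.
Proof. by rewrite normc_def. Qed.

Lemma mulCconj a : a * Num.conj a = (nsq a)%:C.
Proof. by rewrite -normCK normc_nsq -rmorphXn/= sqr_sqrtr// nsq_ge0. Qed.

Lemma nsq_eq0 a : (nsq a == 0) = (a == 0).
Proof. by rewrite paddr_eq0 ?sqr_ge0// !sqrf_eq0 eq_complex. Qed.

Lemma conj_realC t : Num.conj t%:C = t%:C :> R[i].
Proof. by apply/eqP; rewrite eq_complex /= oppr0 !eqxx. Qed.

Lemma conjM_realC t a : Num.conj (t%:C * a) = t%:C * Num.conj a.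
Proof.
by case: a => u v; apply/eqP; rewrite eq_complex /=; apply/andP; split;
  apply/eqP; ring.
Qed.

Lemma nsqM a b : nsq (a * b) = nsq a * nsq b.
Proof. case: a => x y; case: b => z t; rewrite /nsq /=; ring. Qed.

Lemma nsqN a : nsq (- a) = nsq a.
Proof. by rewrite /nsq !raddfN /= !sqrrN. Qed.

Lemma nsqR t : nsq t%:C = t ^+ 2.
Proof. by rewrite /nsq /= expr0n addr0. Qed.

End ComplexFacts.

(** * Hilbert spaces from quadratic forms *)

Section JordanVonNeumann.
Variables (R : realType) (V : lmodType R[i]) (q : V -> R).
Hypothesis q_parallelogram :
  forall x y, q (x + y) + q (x - y) = 2 * q x + 2 * q y.
Hypothesis qZ : forall a x, q (a *: x) = nsq a * q x.
Hypothesis q_ge0 : forall x, 0 <= q x.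

Definition qform_re (x y : V) : R := (q (x + y) - q x - q y) / 2.
Local Notation B := qform_re.

Lemma qform0 : q 0 = 0.
Proof. by rewrite -[0 in LHS](scale0r 0) qZ /nsq /= expr0n addr0 mul0r. Qed.

Lemma qform_reC x y : B x y = B y x.
Proof. by rewrite /B [y + x]addrC; ring. Qed.

(** Jordan-von Neumann: four instances of the parallelogram law, linear in the values of [q], have
    additivity as a linear combination. *)
Lemma qform_reDl x y z : B (x + y) z = B x z + B y z.
Proof.
have P1 := q_parallelogram (x + z) y.
have P2 := q_parallelogram (y + z) x.
have P3 := q_parallelogram z (x - y).
have P4 := q_parallelogram x y.
have e1 : x + z + y = x + y + z by rewrite addrAC.
have e2 : y + z + x = x + y + z by rewrite addrC addrA.
have e3 : z + (x - y) = x + z - y by rewrite addrA (addrC z).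
have e4 : z - (x - y) = y + z - x by rewrite opprB addrA (addrC z).
rewrite e1 in P1; rewrite e2 in P2; rewrite e3 e4 in P3.
rewrite /B; lra.
Qed.

Lemma qform_reNl x y : B (- x) y = - B x y.
Proof.
have := qform_reDl x (- x) y.
rewrite subrr {1}/B add0r qform0; lra.
Qed.

Lemma qform_re_bound x y : `|B x y| <= (q x + q y) / 2.
Proof.
have P1 := q_parallelogram x y.
have h1 := q_ge0 (x + y); have h2 := q_ge0 (x - y).
by rewrite ler_norml /B; apply/andP; split; lra.
Qed.

(** The defect [D s] is additive in [s], vanishes on integers and is bounded by [M] on the unit
    interval. Hence [n * D t], the defect at the fractional part of [n * t], stays bounded for all
    [n], which forces [D t = 0]. *)
Lemma qform_reZl (t : R) x y : B (t%:C *: x) y = t * B x y.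
Proof.
pose D s := B (s%:C *: x) y - s * B x y.
have DD s r : D (s + r) = D s + D r.
  by rewrite /D rmorphD/= scalerDl qform_reDl; ring.
have DN s : D (- s) = - D s.
  by rewrite /D rmorphN/= scaleNr qform_reNl; ring.
have Dn (n : nat) s : D (s *+ n) = D s *+ n.
  elim: n => [|n IH]; last by rewrite !mulrS DD IH.
  by have := DD 0 0; rewrite addr0 !mulr0n; lra.
have D1 : D 1 = 0 by rewrite /D scale1r mul1r subrr.
have Dint (m : int) : D m%:~R = 0.
  case: m => n; first by rewrite -pmulrn Dn D1 mul0rn.
  by rewrite NegzE mulrNz DN -pmulrn Dn D1 mul0rn oppr0.
pose M := (q x + q y) / 2 + `|B x y|.
have Dbd s : 0 <= s -> s <= 1 -> `|D s| <= M.
  move=> s0 s1; rewrite /D (le_trans (ler_normB _ _))// lerD//.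
    rewrite (le_trans (qform_re_bound _ _))// qZ nsqR ler_pM2r ?invr_gt0//.
    by rewrite lerD2r ler_piMl// expr_le1.
  by rewrite normrM ler_piMl// ger0_norm.
suff : D t = 0 by rewrite /D => /eqP; rewrite subr_eq0 => /eqP.
apply/eqP; rewrite -normr_le0 leNgt; apply/negP => Dt0.
have nbd (n : nat) : `|D t| *+ n <= M.
  rewrite -normrMn -Dn -[t *+ n](subrK (Num.floor (t *+ n))%:~R) DD Dint addr0.
  apply: Dbd; first by rewrite subr_ge0 floor_le.
  by rewrite lerBlDl ltW// -intrD1 floorD1_gt.
have [n] : exists n : nat, M / `|D t| < n%:R.
  by exists (Num.truncn (M / `|D t|)).+1; rewrite truncnS_gt.
by rewrite ltr_pdivrMr// mulr_natl ltNge nbd.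
Qed.

Lemma qform_re_diag x : B x x = q x.
Proof.
rewrite /B -mulr2n -scaler_nat qZ -(rmorph_nat (real_complex R)) nsqR.
by field.
Qed.

Lemma qform_re_CS x y : B x y ^+ 2 <= q x * q y.
Proof.
have key (t : R) : 0 <= t ^+ 2 * q x + 2 * t * B x y + q y.
  have := q_ge0 (t%:C *: x + y).
  have : B (t%:C *: x) y = t * B x y by rewrite qform_reZl.
  by rewrite {1}/B qZ nsqR; lra.
have [x0|x0] := eqVneq (q x) 0.
  have [b0|b0] := eqVneq (B x y) 0; first by rewrite b0 x0 expr0n mul0r.
  (* When [q x = 0] the expression is affine in [t]; this [t] gives it the value -1. *)
  have := key (- (q y + 1) / (2 * B x y)).
  rewrite x0 mulr0 add0r.
  have -> : 2 * (- (q y + 1) / (2 * B x y)) * B x y = - (q y + 1) by field.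
  lra.
have x1 : 0 < q x by rewrite lt_neqAle eq_sym x0 q_ge0.
have := key (- B x y / q x).
have -> : (- B x y / q x) ^+ 2 * q x + 2 * (- B x y / q x) * B x y + q y =
  (q x * q y - B x y ^+ 2) / q x by field.
by rewrite pmulr_lge0 ?invr_gt0// subr_ge0.
Qed.

Definition qform_norm (x : V) : R[i] := (Num.sqrt (q x))%:C.

Lemma qform_norm_ler x y :
  qform_norm (x + y) <= qform_norm x + qform_norm y.
Proof.
rewrite /qform_norm -rmorphD/= lecR.
rewrite -(ler_pXn2r (n := 2)) ?nnegrE ?addr_ge0 ?sqrtr_ge0//.
rewrite sqrrD !sqr_sqrtr// -sqrtrM//.
have h : B x y <= Num.sqrt (q x * q y).
  by rewrite (le_trans (ler_norm _))// -sqrtr_sqr ler_wsqrtr// qform_re_CS.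
have : q (x + y) = q x + q y + 2 * B x y by rewrite /B; field.
by move=> ->; rewrite mulr2n; lra.
Qed.

Lemma qform_normZ a x : qform_norm (a *: x) = `|a| * qform_norm x.
Proof.
by rewrite /qform_norm qZ sqrtrM ?nsq_ge0// rmorphM/= normc_nsq.
Qed.

(** Conjugate-linearity in the second argument makes the real part of [<x, i y>] the imaginary part
    of [<x, y>]. *)
Definition qform_inner (x y : V) : R[i] :=
  (B x y)%:C + 'i%C * (B x ('i%C *: y))%:C.

Lemma nsq_i : nsq ('i%C : R[i]) = 1.
Proof. by rewrite /nsq /= expr0n add0r expr1n. Qed.

Lemma qform_re_ii x y : B ('i%C *: x) ('i%C *: y) = B x y.
Proof. by rewrite /B -scalerDr !qZ nsq_i !mul1r. Qed.

Lemma qform_re_ir x y : B x ('i%C *: y) = - B ('i%C *: x) y.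
Proof.
rewrite -qform_re_ii scalerA -expr2 sqr_i scaleN1r.
by rewrite qform_reC qform_reNl qform_reC.
Qed.

Lemma qform_innerDl x y z :
  qform_inner (x + y) z = qform_inner x z + qform_inner y z.
Proof. by rewrite /qform_inner !qform_reDl !rmorphD/=; ring. Qed.

Lemma qform_innerZl a x y : qform_inner (a *: x) y = a * qform_inner x y.
Proof.
have innerR (t : R) z : qform_inner (t%:C *: z) y = t%:C * qform_inner z y.
  by rewrite /qform_inner !qform_reZl !rmorphM/=; ring.
have inneri z : qform_inner ('i%C *: z) y = 'i%C * qform_inner z y.
  rewrite /qform_inner qform_re_ii qform_re_ir.
  by apply/eqP; rewrite eq_complex /=; apply/andP; split; apply/eqP; ring.
rewrite {1}[a]complexE scalerDl qform_innerDl innerR.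
by rewrite -scalerA inneri innerR {3}[a]complexE; ring.
Qed.

Lemma qform_inner_conj x y :
  qform_inner x y = Num.conj (qform_inner y x).
Proof.
rewrite /qform_inner qform_re_ir [B ('i%C *: x) y]qform_reC (qform_reC x y).
by apply/eqP; rewrite eq_complex /=; apply/andP; split; apply/eqP; ring.
Qed.

Lemma qform_inner_diag x : qform_inner x x = (q x)%:C.
Proof.
rewrite /qform_inner qform_re_diag.
have : B x ('i%C *: x) = 0.
  have := qform_re_ir x x; rewrite [B ('i%C *: x) x]qform_reC; lra.
by move=> ->; rewrite mulr0 addr0.
Qed.

End JordanVonNeumann.

Section QuadraticHilbert.
Variables (R : realType) (V : lmodType R[i]) (q : V -> R).
Hypothesis q_parallelogram :
  forall x y, q (x + y) + q (x - y) = 2 * q x + 2 * q y.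
Hypothesis qZ : forall a x, q (a *: x) = nsq a * q x.
Hypothesis q_ge0 : forall x, 0 <= q x.
Hypothesis q_eq0 : forall x, q x = 0 -> x = 0.
Hypothesis q_complete : forall F : set_system V, ProperFilter F ->
  (forall e, 0 < e -> exists2 A, F A &
     forall x y, A x -> A y -> q (x - y) <= e) ->
  exists l, forall e, 0 < e -> F [set x | q (x - l) <= e].

Lemma qform_norm_eq0 x : qform_norm q x = 0 -> x = 0.
Proof.
move/(congr1 (@complex.Re R)) => /= /eqP; rewrite sqrtr_eq0 => q0.
by apply: q_eq0; apply/eqP; rewrite eq_le q0 q_ge0.
Qed.

Definition qform_normed : normedModType R[i] := HB.pack V
  (Lmodule_isNormed.Build R[i] V (qform_norm_ler q_parallelogram qZ q_ge0)
     (qform_normZ qZ) qform_norm_eq0).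

Lemma qform_normedE (x : qform_normed) : `|x| = (Num.sqrt (q x))%:C.
Proof. by []. Qed.

Lemma gt0_realC (e : R[i]) : 0 < e -> exists2 r : R, 0 < r & e = r%:C.
Proof. by case: e => a b; rewrite ltcE /= => /andP[/eqP-> ?]; exists a. Qed.

Lemma qform_normed_complete (F : set_system qform_normed) :
  ProperFilter F -> cauchy F -> cvg F.
Proof.
move=> FF /cauchy_ballP Fc.
have [|l lP] := @q_complete F FF.
  move=> e e0; have se0 : 0 < (Num.sqrt e)%:C :> R[i].
    by rewrite ltcR sqrtr_gt0.
  have := Fc _ se0; rewrite near_simpl /= => -[[A B] /= [FA FB] AB].
  exists (A `&` B); first exact: filterI.
  move=> x y [Ax _] [_ By]; have := AB (x, y) (conj Ax By).
  rewrite /= -ball_normE /= (qform_normedE (x - y)) ltcR => h.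
  by rewrite -ler_sqrt ?ltW.
apply/cvg_ex; exists l; apply/cvgrPdist_lt => e /gt0_realC[r r0 ->].
have r20 : 0 < (r / 2) ^+ 2 by rewrite exprn_gt0// divr_gt0.
apply: filterS (lP _ r20) => x /= xl; rewrite distrC.
rewrite (qform_normedE (x - l)) ltcR (@le_lt_trans _ _ (r / 2))//; last lra.
have -> : r / 2 = Num.sqrt ((r / 2) ^+ 2).
  by rewrite sqrtr_sqr ger0_norm// divr_ge0// ltW.
exact: ler_wsqrtr.
Qed.

Definition qform_completed : completeNormedModType R[i] :=
  HB.pack qform_normed
    (Uniform_isComplete.Build qform_normed qform_normed_complete).

Lemma qform_inner_zmodl y : zmod_morphism ((qform_inner q)^~ y).
Proof.
move=> u v /=; rewrite -scaleN1r qform_innerDl// qform_innerZl//.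
by rewrite mulN1r.
Qed.

Lemma qform_inner_zmodr x : zmod_morphism (qform_inner q x).
Proof.
move=> u v /=; rewrite qform_inner_conj// qform_inner_zmodl rmorphB/=.
by rewrite -!qform_inner_conj.
Qed.

Lemma qform_inner_scalel y : scalable_for *%R ((qform_inner q)^~ y).
Proof. by move=> a u /=; rewrite qform_innerZl. Qed.

Lemma qform_inner_scaler x :
  scalable_for (@Num.conj R[i] \; *%R) (qform_inner q x).
Proof.
move=> a u /=; rewrite qform_inner_conj// qform_innerZl// rmorphM/=.
by rewrite -qform_inner_conj.
Qed.

Lemma qform_inner_herm (x y : V) :
  qform_inner q x y = (-1) ^+ false * Num.conj (qform_inner q y x).
Proof. by rewrite expr0 mul1r -qform_inner_conj. Qed.

Lemma qform_inner_gt0 (x : V) : x != 0 -> 0 < qform_inner q x x.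
Proof.
move=> x0; rewrite qform_inner_diag// ltcR lt_neqAle q_ge0 andbT eq_sym.
by apply: contra_neq x0; exact: q_eq0.
Qed.

Definition qform_dot : {dot qform_completed for (@Num.conj R[i])} :=
  HB.pack (qform_inner q : qform_completed -> qform_completed -> R[i])
    (@isBilinear.Build R[i] qform_completed qform_completed R[i] *%R
      (@Num.conj R[i] \; *%R) (qform_inner q) qform_inner_zmodl
      qform_inner_zmodr qform_inner_scalel qform_inner_scaler)
    (@isHermitianSesquilinear.Build R[i] qform_completed false
      (@Num.conj R[i]) (qform_inner q) qform_inner_herm)
    (@isDotProduct.Build R[i] qform_completed (qform_inner q)
      qform_inner_gt0).

Lemma qform_inner_norm (x : qform_completed) : `|x| ^+ 2 = qform_dot x x.
Proof.
have -> : qform_dot x x = qform_inner q x x by [].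
rewrite (qform_normedE x) qform_inner_diag//.
by rewrite -rmorphXn/= sqr_sqrtr.
Qed.

Definition qform_hilbert : hilbertSpace R :=
  @HilbertSpace R qform_completed qform_dot qform_inner_norm.

Lemma qform_hilbert_inner (x y : qform_hilbert) :
  inner _ x y = qform_inner q x y.
Proof. by []. Qed.

End QuadraticHilbert.

(** * Reproducing kernel Hilbert spaces *)

Section Gram.
Variables (R : realType) (A : Type).
Implicit Types (s t : seq (R[i] * A)) (f h : A -> R[i]) (a : R[i]).

(** A list of pairs stands for a finite formal combination of points. Repetitions are allowed, so
    that addition is concatenation. *)
Definition gram (K : A -> A -> R[i]) s t : R[i] :=
  \sum_(p <- s) \sum_(r <- t) p.1 * Num.conj r.1 * K p.2 r.2.

Definition posdef (K : A -> A -> R[i]) := forall s, 0 <= gram K s s.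

Definition seq_scale a s := [seq (a * p.1, p.2) | p <- s].

Definition pairing f s : R[i] := \sum_(p <- s) Num.conj p.1 * f p.2.

Variable K : A -> A -> R[i].

Lemma gram_catl s s' t : gram K (s ++ s') t = gram K s t + gram K s' t.
Proof. by rewrite /gram big_cat. Qed.

Lemma gram_catr s t t' : gram K s (t ++ t') = gram K s t + gram K s t'.
Proof.
by rewrite /gram -big_split /=; apply: eq_bigr => p _; rewrite big_cat.
Qed.

Lemma gram_scalel a s t : gram K (seq_scale a s) t = a * gram K s t.
Proof.
rewrite /gram big_map mulr_sumr; apply: eq_bigr => p _.
by rewrite mulr_sumr; apply: eq_bigr => r _ /=; rewrite !mulrA.
Qed.

Lemma gram_scaler a s t :
  gram K s (seq_scale a t) = Num.conj a * gram K s t.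
Proof.
rewrite /gram mulr_sumr; apply: eq_bigr => p _.
rewrite big_map mulr_sumr; apply: eq_bigr => r _ /=.
by rewrite rmorphM /=; ring.
Qed.

Lemma pairing_cat f s t : pairing f (s ++ t) = pairing f s + pairing f t.
Proof. by rewrite /pairing big_cat. Qed.

Lemma pairing_scale f a s :
  pairing f (seq_scale a s) = Num.conj a * pairing f s.
Proof.
rewrite /pairing big_map mulr_sumr; apply: eq_bigr => p _ /=.
by rewrite rmorphM mulrA.
Qed.

Lemma pairingD f h s : pairing (f + h) s = pairing f s + pairing h s.
Proof.
by rewrite /pairing -big_split; apply: eq_bigr => p _; exact: mulrDr.
Qed.

Lemma pairingZ a f s : pairing (a *: f) s = a * pairing f s.
Proof.
rewrite /pairing mulr_sumr; apply: eq_bigr => p _.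
exact: mulrCA.
Qed.

Lemma pairingB f h s : pairing (f - h) s = pairing f s - pairing h s.
Proof.
rewrite /pairing -sumrB; apply: eq_bigr => p _; exact: mulrBr.
Qed.

Lemma pairing_seq1 f a x : pairing f [:: (a, x)] = Num.conj a * f x.
Proof. by rewrite /pairing big_seq1. Qed.

Lemma gram_seq1 a b x y :
  gram K [:: (a, x)] [:: (b, y)] = a * Num.conj b * K x y.
Proof. by rewrite /gram !big_seq1. Qed.

Lemma pairing_kernel x s : pairing (K x) s = gram K [:: (1, x)] s.
Proof.
by rewrite /gram big_seq1; apply: eq_bigr => p _; rewrite mul1r.
Qed.

Hypothesis Kpos : posdef K.

Lemma posdef_diag x : 0 <= K x x.
Proof. by have := Kpos [:: (1, x)]; rewrite gram_seq1 rmorph1 !mul1r. Qed.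

(** Nonnegativity includes being real: the form is real at [x + y] and at [x + i y], and this gives
    Hermitian symmetry. *)
Lemma posdef_conj x y : K y x = Num.conj (K x y).
Proof.
have h1 := Kpos ([:: (1, x)] ++ [:: (1, y)]).
have h2 := Kpos ([:: (1, x)] ++ [:: ('i%C, y)]).
rewrite gram_catl !gram_catr !gram_seq1 in h1.
rewrite gram_catl !gram_catr !gram_seq1 in h2.
have := posdef_diag x; have := posdef_diag y; move: h1 h2.
case: (K x x) => x1 x2; case: (K y y) => y1 y2.
case: (K x y) => u1 u2; case: (K y x) => v1 v2.
rewrite !lecE /= => /andP[/eqP h1 _] /andP[/eqP h2 _].
move=> /andP[/eqP y0 _] /andP[/eqP x0 _].
apply/eqP; rewrite eq_complex /=; apply/andP; split; apply/eqP; lra.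
Qed.

Lemma gram_conj s t : gram K s t = Num.conj (gram K t s).
Proof.
rewrite /gram rmorph_sum exchange_big; apply: eq_bigr => p _.
rewrite rmorph_sum; apply: eq_bigr => r _.
by rewrite !rmorphM /= conjCK posdef_conj; ring.
Qed.

End Gram.

Record posdef_kernel (R : realType) (A : Type) := PosdefKernel {
  kernel_fun :> A -> A -> R[i] ;
  kernel_posdef : posdef kernel_fun }.

Section Legendre.
Variables (R : realType) (A : Type) (K : posdef_kernel R A).
Implicit Types (s t : seq (R[i] * A)) (f h : A -> R[i]) (a : R[i]).

Let Kpos := kernel_posdef K.

Definition gramn s : R := complex.Re (gram K s s).

(* The squared norm in the reproducing kernel Hilbert space is the Legendre
   transform of the seminorm [gramn]. *)
Definition legendre f s : R := 2 * complex.Re (pairing f s) - gramn s.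

Lemma gramnE s : gram K s s = (gramn s)%:C.
Proof.
have := Kpos s; rewrite /gramn; case: (gram K s s) => x y.
by rewrite lecE /= => /andP[/eqP -> _].
Qed.

Lemma gramn_ge0 s : 0 <= gramn s.
Proof. by have := Kpos s; rewrite gramnE lecR. Qed.

Lemma gramn_scale a s : gramn (seq_scale a s) = nsq a * gramn s.
Proof.
by rewrite {1}/gramn gram_scalel gram_scaler mulrA mulCconj gramnE -rmorphM.
Qed.

Lemma gramn_cat s t :
  gramn (s ++ t) = gramn s + gramn t + 2 * complex.Re (gram K s t).
Proof.
rewrite /gramn gram_catl !gram_catr (gram_conj Kpos t s).
by rewrite !raddfD/=; case: (gram K s t) => x y /=; ring.
Qed.

(** A parallelogram identity before taking suprema: [u] and [w] are the half sum and the half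
    difference of the test combinations [s] and [t]. *)
Lemma legendreE f h s t (u := seq_scale 2^-1 (s ++ t))
    (w := seq_scale 2^-1 (s ++ seq_scale (- 1) t)) :
  legendre (f + h) s + legendre (f - h) t =
  2 * legendre f u + 2 * legendre h w.
Proof.
have c2 : Num.conj (2^-1 : R[i]) = 2^-1 by rewrite fmorphV /= rmorph_nat.
have n2 : nsq (2^-1 : R[i]) = 4^-1.
  have -> : 2^-1 = (2^-1)%:C :> R[i] by rewrite fmorphV/= rmorph_nat.
  by rewrite nsqR; field.
have n1 : nsq (-1 : R[i]) = 1.
  by rewrite nsqN /nsq /= expr1n expr0n addr0.
have re2 (z : R[i]) : complex.Re (2^-1 * z) = 2^-1 * complex.Re z.
  have -> : 2^-1 = (2^-1)%:C :> R[i] by rewrite fmorphV/= rmorph_nat.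
  by case: z => x y /=; rewrite mul0r subr0.
rewrite /legendre /u /w !pairing_scale c2 !re2 !gramn_scale n2.
rewrite !pairing_cat !gramn_cat !gramn_scale n1 !pairing_scale gram_scaler.
rewrite rmorphN rmorph1 !mulN1r !pairingB !pairingD !raddfD !raddfN /=.
by field.
Qed.

Definition legendre_bounded f := exists M, forall s, legendre f s <= M.

Lemma legendre0 s : legendre 0 s <= 0.
Proof.
rewrite /legendre /pairing big1 ?mulr0 ?sub0r ?oppr_le0 ?gramn_ge0//.
by move=> p _; rewrite mulr0.
Qed.

Lemma legendre_nil f : legendre f [::] = 0.
Proof. by rewrite /legendre /gramn /gram /pairing !big_nil /= mulr0 subrr. Qed.

Lemma legendreD f h s (u := seq_scale 2^-1 s) :
  legendre (f + h) s = 2 * legendre f u + 2 * legendre h u.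
Proof.
have := legendreE f h s [::].
by rewrite legendre_nil addr0 /= !cats0.
Qed.

Lemma legendreZ a f s : legendre (a *: f) (seq_scale a s) =
  nsq a * legendre f s.
Proof.
rewrite /legendre pairing_scale pairingZ gramn_scale mulrA.
by rewrite [_ * a]mulrC mulCconj; case: (pairing f s) => x y /=; ring.
Qed.

Lemma seq_scaleK a s : a != 0 -> seq_scale a (seq_scale a^-1 s) = s.
Proof.
move=> a0; rewrite /seq_scale -map_comp -[RHS]map_id.
apply: eq_map => -[c x] /=.
by rewrite mulVKf.
Qed.

Lemma legendre_bounded_submod :
  submod_closed [pred f | `[< legendre_bounded f >] ].
Proof.
split=> [|a f h]; rewrite !inE.
  by exists 0; exact: legendre0.
move=> [M fM] [N hN].
have [P afP] : legendre_bounded (a *: f).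
  have [->|a0] := eqVneq a 0.
    by exists 0; rewrite scale0r; exact: legendre0.
  exists (nsq a * M) => s; rewrite -(seq_scaleK s a0) legendreZ.
  by rewrite ler_wpM2l ?nsq_ge0.
by exists (2 * P + 2 * N) => s; rewrite legendreD lerD// ler_wpM2l.
Qed.

(** Test with the point [x] weighted by [f x / (k + 1)]; the summand 1 keeps the weight meaningful
    when [K x x = 0]. *)
Lemma point_bound f M x : (forall s, legendre f s <= M) ->
  nsq (f x) <= (complex.Re (K x x) + 1) * M.
Proof.
move=> fM; have k0 : 0 <= complex.Re (K x x).
  by have := posdef_diag Kpos x; rewrite lecE => /andP[].
set k := complex.Re (K x x) in k0 *.
have gk : gramn [:: (1, x)] = k by rewrite /gramn gram_seq1 rmorph1 !mul1r.
have k1 : 0 < k + 1 by rewrite ltr_wpDl.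
have := fM (seq_scale ((k + 1)^-1%:C * f x) [:: (1, x)]).
rewrite /legendre gramn_scale gk pairing_scale pairing_seq1 rmorph1 mul1r.
rewrite nsqM nsqR; have -> : Num.conj ((k + 1)^-1%:C * f x) * f x =
    ((k + 1)^-1 * nsq (f x))%:C.
  case: (f x) => u v; apply/eqP; rewrite eq_complex /nsq /=.
  by apply/andP; split; apply/eqP; ring.
move=> /= h.
suff : (k + 1)^-1 * nsq (f x) <= M by rewrite mulrC ler_pdivrMr// mulrC.
apply: le_trans h; have n0 := nsq_ge0 (f x).
rewrite -subr_ge0; have -> : 2 * ((k + 1)^-1 * nsq (f x)) -
  (k + 1)^-1 ^+ 2 * nsq (f x) * k - (k + 1)^-1 * nsq (f x) =
  nsq (f x) * (k + 1)^-1 ^+ 2 by field; rewrite gt_eqF.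
by rewrite mulr_ge0// sqr_ge0.
Qed.

End Legendre.

Definition legendre_pred (R : realType) (A : Type) (K : posdef_kernel R A) :
    {pred A -> R[i]} :=
  [pred f | `[< legendre_bounded K f >] ].

HB.instance Definition _ (R : realType) (A : Type) (K : posdef_kernel R A) :=
  GRing.isSubmodClosed.Build R[i] (A -> R[i]) (legendre_pred K)
    (legendre_bounded_submod K).

Record rkhs (R : realType) (A : Type) (K : posdef_kernel R A) := Rkhs {
  rkhs_fun :> A -> R[i] ;
  rkhs_funP : rkhs_fun \in legendre_pred K }.

HB.instance Definition _ (R : realType) (A : Type) (K : posdef_kernel R A) :=
  [isSub of rkhs K for @rkhs_fun R A K].
HB.instance Definition _ (R : realType) (A : Type) (K : posdef_kernel R A) :=
  [Choice of rkhs K by <:].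
HB.instance Definition _ (R : realType) (A : Type) (K : posdef_kernel R A) :=
  [SubChoice_isSubLmodule of rkhs K by <:].

Section RKHS.
Variables (R : realType) (A : Type) (K : posdef_kernel R A).
Implicit Types (f h : rkhs K) (s : seq (R[i] * A)) (a : R[i]).

Lemma rkhs_funD f h : rkhs_fun (f + h) = (f : A -> R[i]) + h.
Proof. by []. Qed.

Lemma rkhs_funZ a f : rkhs_fun (a *: f) = a *: (f : A -> R[i]).
Proof. by []. Qed.

Lemma rkhs_funB f h : rkhs_fun (f - h) = (f : A -> R[i]) - h.
Proof. by []. Qed.

Definition rkhs_q f : R := sup (range (legendre K f)).

Lemma rkhs_bounded f : legendre_bounded K f.
Proof. by case: f => f /= /asboolP. Qed.

Lemma legendre_has_sup f : has_sup (range (legendre K f)).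
Proof.
split; first by exists (legendre K f [::]), [::].
by have [M fM] := rkhs_bounded f; exists M => _ [s _ <-].
Qed.

Lemma legendre_le f s : legendre K f s <= rkhs_q f.
Proof. by apply: ub_le_sup; [have [] := legendre_has_sup f|exists s]. Qed.

Lemma rkhs_q_le f M : (forall s, legendre K f s <= M) -> rkhs_q f <= M.
Proof.
move=> fM; apply: ge_sup; first by have [] := legendre_has_sup f.
by move=> _ [s _ <-].
Qed.

Lemma rkhs_q_ge0 f : 0 <= rkhs_q f.
Proof. by have := legendre_le f [::]; rewrite legendre_nil. Qed.

Lemma rkhs_q0 : rkhs_q (0 : rkhs K) = 0.
Proof.
apply/eqP; rewrite eq_le rkhs_q_ge0 andbT; apply: rkhs_q_le => s.
exact: legendre0.
Qed.

Lemma rkhs_qZ a f : rkhs_q (a *: f) = nsq a * rkhs_q f.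
Proof.
have [->|a0] := eqVneq a 0.
  by rewrite scale0r rkhs_q0 /nsq /= expr0n addr0 mul0r.
have le b h : b != 0 -> rkhs_q (b *: h) <= nsq b * rkhs_q h.
  move=> b0; apply: rkhs_q_le => s; rewrite rkhs_funZ.
  rewrite -(seq_scaleK s b0) legendreZ.
  by rewrite ler_wpM2l ?nsq_ge0// legendre_le.
have nsqV : nsq a * nsq a^-1 = 1.
  by rewrite -nsqM divff// /nsq /= expr1n expr0n addr0.
apply/eqP; rewrite eq_le le//=.
have := @le a^-1 (a *: f); rewrite scalerA mulVf// scale1r invr_eq0 a0.
move=> /(_ isT) h.
have := ler_wpM2l (nsq_ge0 a) h.
by rewrite mulrA nsqV mul1r.
Qed.

(** Suprema over [s] and [t] in [legendreE] give one inequality; its instance at [f + h] and [f - h]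
    is the reverse one. *)
Lemma rkhs_q_parallelogram f h :
  rkhs_q (f + h) + rkhs_q (f - h) = 2 * rkhs_q f + 2 * rkhs_q h.
Proof.
have le f' h' : rkhs_q (f' + h') + rkhs_q (f' - h') <=
    2 * rkhs_q f' + 2 * rkhs_q h'.
  rewrite -lerBrDr; apply: rkhs_q_le => s.
  rewrite lerBrDr addrC -lerBrDr; apply: rkhs_q_le => t.
  rewrite lerBrDr addrC rkhs_funD rkhs_funB legendreE.
  by rewrite lerD// ler_wpM2l// legendre_le.
apply/eqP; rewrite eq_le le /=.
have := le (f + h) (f - h).
have -> : f + h + (f - h) = 2 *: f.
  by rewrite scaler_nat mulr2n addrACA (subrr h) addr0.
have -> : f + h - (f - h) = 2 *: h.
  by rewrite scaler_nat mulr2n opprB [f + h]addrC addrACA (subrr f) addr0.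
have -> : 2 = 2%:C :> R[i] by rewrite rmorph_nat.
by rewrite !rkhs_qZ nsqR; lra.
Qed.

Lemma rkhs_point_bound f x :
  nsq (f x) <= (complex.Re (K x x) + 1) * rkhs_q f.
Proof. by apply: point_bound => s; exact: legendre_le. Qed.

Lemma rkhs_q_eq0 f : rkhs_q f = 0 -> f = 0.
Proof.
move=> f0; apply/val_inj/funext => x /=.
have := rkhs_point_bound f x; rewrite f0 mulr0 => h.
by apply/eqP; rewrite -nsq_eq0 eq_le h nsq_ge0.
Qed.

(** Evaluations are bounded, so a Cauchy filter converges pointwise to some [l]. For fixed [s] the
    Legendre expression is continuous for pointwise convergence; the bound on differences thus
    passes to [f - l] for each [s], hence to the supremum. *)
Lemma rkhs_complete (F : set_system (rkhs K)) : ProperFilter F ->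
  (forall e, 0 < e -> exists2 B, F B &
     forall x y, B x -> B y -> rkhs_q (x - y) <= e) ->
  exists l, forall e, 0 < e -> F [set x | rkhs_q (x - l) <= e].
Proof.
move=> FF Fc.
have cvg_pt x : cvg ((fun f : rkhs K => f x : complex_plane R) @ F).
  apply: cauchy_cvg; apply/cauchy_ballP => _ /gt0_realC[e e0 ->].
  pose k := complex.Re (K x x) + 1.
  have k0 : 0 < k.
    have : 0 <= K x x by exact: posdef_diag (kernel_posdef K) x.
    by rewrite lecE => /andP[_ /=]; rewrite /k; lra.
  have e1 : 0 < e ^+ 2 / 2 / k by rewrite !divr_gt0// exprn_gt0.
  have [B FB BP] := Fc _ e1.
  exists ((fun f : rkhs K => f x : complex_plane R) @` B,
          (fun f : rkhs K => f x : complex_plane R) @` B) => /=.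
    by split; apply: (@filterS _ F _ B) => // f Bf; exists f.
  move=> [_ _] /= [[f Bf <-] [h Bh <-]].
  rewrite -ball_normE /=.
  have := rkhs_point_bound (f - h) x; have := BP _ _ Bf Bh.
  rewrite rkhs_funB -[(_ - _) x]/(f x - h x).
  rewrite -(ler_pM2l k0) [k * (_ / k)]mulrC divfK ?gt_eqF// => h1 h2.
  rewrite (normc_nsq (f x - h x)) ltcR.
  rewrite -[ltRHS]ger0_norm ?(ltW e0)// -sqrtr_sqr ltr_sqrt ?exprn_gt0//.
  rewrite (le_lt_trans h2)// (le_lt_trans h1)//.
  by rewrite ltr_pdivrMr// ltr_pMr ?exprn_gt0// ltr1n.
pose l x : R[i] := lim ((fun f : rkhs K => f x : complex_plane R) @ F).
have cvg_pairing s :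
    (fun f : rkhs K => pairing f s : complex_plane R) @ F -->
      (pairing l s : complex_plane R).
  rewrite /pairing; apply: cvg_big => [|p _]; first exact: add_continuous.
  exact: cvgMl_tmp (cvg_pt p.2).
have close e B f s : F B ->
    (forall x y, B x -> B y -> rkhs_q (x - y) <= e) -> B f ->
    legendre K ((f : A -> R[i]) - l) s <= e.
  move=> FB BP Bf; apply/ler_addgt0Pr => d d0.
  have d20 : 0 < (d / 2)%:C :> R[i] by rewrite ltcR divr_gt0.
  have /cvgrPdist_lt /(_ _ d20) near_l := cvg_pairing s.
  have [h [Bh]] := filter_ex (filterI FB near_l).
  rewrite /= distrC => hl.
  have := le_trans (legendre_le (f - h) s) (BP _ _ Bf Bh).
  have re_le : complex.Re (pairing h s - pairing l s) <= d / 2.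
    rewrite (le_trans (ler_norm _))// -lecR (le_trans _ (ltW hl))//.
    exact: normc_ge_Re.
  rewrite rkhs_funB /legendre.
  have -> : pairing (rkhs_fun f - l) s =
      pairing (rkhs_fun f - h) s + (pairing h s - pairing l s).
    by rewrite !pairingB; ring.
  by rewrite raddfD /=; lra.
have lfin : legendre_bounded K l.
  have [B FB BP] := Fc 1 ltr01; have [f Bf] := filter_ex FB.
  have -> : l = (f : A -> R[i]) + (- 1) *: ((f : A -> R[i]) - l).
    by rewrite scaleN1r opprB addrCA subrr addr0.
  have [_ sub] := legendre_bounded_submod K.
  have fl : legendre_bounded K ((f : A -> R[i]) - l).
    by exists 1 => s; exact: close FB BP Bf.
  have := sub (- 1) _ (f : A -> R[i]).
  rewrite addrC => /(_ ((f : A -> R[i]) - l)); rewrite !inE; apply => //.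
  exact: rkhs_bounded.
have lP : l \in legendre_pred K by rewrite inE.
exists (Rkhs lP) => e e0; have [B FB BP] := Fc e e0.
apply: (@filterS _ F _ B) => // f Bf /=; apply: rkhs_q_le => s.
rewrite rkhs_funB /=.
exact: close FB BP Bf.
Qed.

Definition rkhs_hilbert : hilbertSpace R :=
  qform_hilbert rkhs_q_parallelogram rkhs_qZ rkhs_q_ge0 rkhs_q_eq0
    rkhs_complete.

(** Completing the square: adding [K x] to the function amounts to subtracting the point [x] from
    the test combination. *)
Lemma legendre_kernel (f : A -> R[i]) x s :
  legendre K (f + K x) s = legendre K f (s ++ [:: (-1, x)]) +
    2 * complex.Re (f x) + complex.Re (K x x).
Proof.
rewrite /legendre pairingD pairing_cat gramn_cat pairing_kernel !pairing_seq1.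
have -> : gramn K [:: (-1, x)] = complex.Re (K x x).
  by rewrite /gramn gram_seq1 rmorphN rmorph1 mulrNN !mul1r.
rewrite rmorphN rmorph1 mulN1r.
have -> : gram K s [:: (-1, x)] = - Num.conj (gram K [:: (1, x)] s).
  rewrite -(gram_conj (kernel_posdef K)).
  have -> : [:: (-1 : R[i], x)] = seq_scale (-1) [:: (1, x)].
    by rewrite /seq_scale /= mulN1r.
  by rewrite gram_scaler rmorphN rmorph1 mulN1r.
by rewrite !raddfD !raddfN /=; case: (gram K _ s) => u v /=; ring.
Qed.

Lemma kernel_bounded x : K x \in legendre_pred K.
Proof.
rewrite inE; exists (complex.Re (K x x)) => s.
rewrite -[X in legendre K X]add0r legendre_kernel.
have -> : complex.Re ((0 : A -> R[i]) x) = 0 by [].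
have := legendre0 K (s ++ [:: (-1, x)]); lra.
Qed.

Definition kernel_vector x : rkhs K := Rkhs (kernel_bounded x).

(** After polarization, this is the real part of the reproducing property [<f, K x> = f x]. *)
Lemma rkhs_q_kernel f x : rkhs_q (f + kernel_vector x) =
  rkhs_q f + 2 * complex.Re (f x) + complex.Re (K x x).
Proof.
apply/eqP; rewrite eq_le; apply/andP; split.
  apply: rkhs_q_le => s; rewrite rkhs_funD /= legendre_kernel.
  by rewrite !lerD2r legendre_le.
rewrite -addrA -lerBrDr; apply: rkhs_q_le => s.
rewrite lerBrDr; apply: le_trans (legendre_le _ (s ++ [:: (1, x)])).
rewrite rkhs_funD /= legendre_kernel -catA /legendre.
rewrite !pairing_cat !pairing_seq1 !gramn_cat !gram_catr.
rewrite rmorph1 rmorphN rmorph1 mul1r mulN1r subrr addr0 addrA.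
have sc : [:: (-1 : R[i], x)] = seq_scale (-1) [:: (1, x)].
  by rewrite /seq_scale /= mulN1r.
rewrite sc !gram_scaler gramn_scale rmorphN rmorph1 !mulN1r subrr raddf0.
have -> : nsq (-1 : R[i]) = 1 by rewrite nsqN nsqR expr1n.
have -> : complex.Re (- gram K [:: (1, x)] [:: (1, x)]) =
    - gramn K [:: (1, x)] by rewrite raddfN.
lra.
Qed.

Lemma rkhs_inner_kernel (f : rkhs_hilbert) x :
  inner rkhs_hilbert f (kernel_vector x) = (f : rkhs K) x.
Proof.
rewrite qform_hilbert_inner /qform_inner.
have re (h : rkhs K) :
    qform_re (@rkhs_q) h (kernel_vector x) = complex.Re (h x).
  rewrite /qform_re rkhs_q_kernel.
  have -> : rkhs_q (kernel_vector x) = complex.Re (K x x).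
    by rewrite -[kernel_vector x]add0r rkhs_q_kernel rkhs_q0 add0r mulr0 add0r.
  by field.
rewrite (qform_re_ir rkhs_q_parallelogram rkhs_qZ) !re rkhs_funZ.
rewrite -[('i%C *: _) x]/('i%C * (f : rkhs K) x).
by case: ((f : rkhs K) x) => u v; apply/eqP; rewrite eq_complex /=;
  apply/andP; split; apply/eqP; ring.
Qed.

End RKHS.

(** * Geometry of Hilbert spaces *)

Section HilbertBasics.
Variables (R : realType) (H : hilbertSpace R).
Implicit Types (x y z : H) (a : R[i]).
Local Notation "''[' x , y ]" := (inner H x y).

Lemma innerDl x y z : '[x + y, z] = '[x, z] + '[y, z].
Proof. exact: linearDl. Qed.

Lemma innerDr x y z : '[x, y + z] = '[x, y] + '[x, z].
Proof. exact: linearDr. Qed.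

Lemma innerZl a x y : '[a *: x, y] = a * '[x, y].
Proof. exact: linearZl_LR. Qed.

Lemma innerZr a x y : '[x, a *: y] = Num.conj a * '[x, y].
Proof. exact: linearZr_LR. Qed.

Lemma innerNl x y : '[- x, y] = - '[x, y].
Proof. by rewrite -scaleN1r innerZl mulN1r. Qed.

Lemma innerNr x y : '[x, - y] = - '[x, y].
Proof. exact: linearNr. Qed.

Lemma inner0l x : '[0, x] = 0.
Proof. by rewrite -(scale0r 0) innerZl mul0r. Qed.

Lemma inner0r x : '[x, 0] = 0.
Proof. by rewrite -(scale0r 0) innerZr rmorph0 mul0r. Qed.

Lemma innerBl x y z : '[x - y, z] = '[x, z] - '[y, z].
Proof. by rewrite innerDl innerNl. Qed.

Lemma inner_suml I (r : seq I) (F : I -> H) y :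
  '[\sum_(i <- r) F i, y] = \sum_(i <- r) '[F i, y].
Proof.
by apply: (big_morph (fun x => '[x, y])) => [u v|];
  [exact: innerDl|exact: inner0l].
Qed.

Lemma inner_sumr I (r : seq I) (F : I -> H) x :
  '[x, \sum_(i <- r) F i] = \sum_(i <- r) '[x, F i].
Proof. by apply: big_morph => [u v|]; [exact: innerDr|exact: inner0r]. Qed.

Lemma inner_conj x y : '[x, y] = Num.conj '[y, x].
Proof. by have := hermC (inner H) x y; rewrite expr0 mul1r. Qed.

Definition hnorm2 x : R := complex.Re '[x, x].

Lemma hnorm2E x : '[x, x] = (hnorm2 x)%:C.
Proof.
have : 0 <= '[x, x] by rewrite -inner_norm exprn_ge0.
by rewrite /hnorm2; case: '[x, x] => u v; rewrite lecE => /andP[/= /eqP -> _].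
Qed.

Lemma hnorm2_ge0 x : 0 <= hnorm2 x.
Proof. by rewrite -lecR -hnorm2E -inner_norm exprn_ge0. Qed.

Lemma normE x : `|x| = (Num.sqrt (hnorm2 x))%:C.
Proof.
apply/eqP; rewrite -(@eqrXn2 _ 2)//; last by rewrite lecR sqrtr_ge0.
by rewrite inner_norm hnorm2E -rmorphXn/= sqr_sqrtr// hnorm2_ge0.
Qed.

Lemma hnorm2_eq0 x : (hnorm2 x == 0) = (x == 0).
Proof.
rewrite -[RHS]normr_eq0 normE; apply/eqP/eqP => [->|]; first by rewrite sqrtr0.
move=> /(congr1 (@complex.Re R)) /= /eqP; rewrite sqrtr_eq0 => h.
by apply/eqP; rewrite eq_le h hnorm2_ge0.
Qed.

Lemma hnorm2_0 : hnorm2 0 = 0.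
Proof. by apply/eqP; rewrite hnorm2_eq0. Qed.

Lemma hnorm2Z a x : hnorm2 (a *: x) = nsq a * hnorm2 x.
Proof.
by rewrite {1}/hnorm2 innerZl innerZr mulrA mulCconj hnorm2E -rmorphM.
Qed.

Lemma hnorm2N x : hnorm2 (- x) = hnorm2 x.
Proof. by rewrite /hnorm2 innerNl innerNr opprK. Qed.

Lemma hnorm2D x y :
  hnorm2 (x + y) = hnorm2 x + hnorm2 y + 2 * complex.Re '[x, y].
Proof.
rewrite /hnorm2 innerDl !innerDr (inner_conj y x) !raddfD /=.
by case: '[x, y] => u v /=; ring.
Qed.

Lemma hnorm2B x y :
  hnorm2 (x - y) = hnorm2 x + hnorm2 y - 2 * complex.Re '[x, y].
Proof. by rewrite hnorm2D hnorm2N innerNr raddfN /=; ring. Qed.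

Lemma hnorm2C x y : hnorm2 (x - y) = hnorm2 (y - x).
Proof. by rewrite -hnorm2N opprB. Qed.

Lemma hnorm2_parallelogram x y :
  hnorm2 (x + y) + hnorm2 (x - y) = 2 * hnorm2 x + 2 * hnorm2 y.
Proof. by rewrite hnorm2D hnorm2B; ring. Qed.

Lemma hnorm2D_le x y : hnorm2 (x + y) <= 2 * hnorm2 x + 2 * hnorm2 y.
Proof.
have := hnorm2_parallelogram x y; have := hnorm2_ge0 (x - y); lra.
Qed.

Lemma re_inner_CS x y : complex.Re '[x, y] ^+ 2 <= hnorm2 x * hnorm2 y.
Proof.
have := qform_re_CS hnorm2_parallelogram hnorm2Z hnorm2_ge0 x y.
by rewrite /qform_re hnorm2D (_ : (_ - _ - _) / 2 = complex.Re '[x, y]);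
  last by field.
Qed.

Lemma inner_CS x y : nsq '[x, y] <= hnorm2 x * hnorm2 y.
Proof.
set w := '[x, y]; have [n0|n0] := eqVneq (nsq w) 0.
  by rewrite n0 mulr_ge0 ?hnorm2_ge0.
have n1 : 0 < nsq w by rewrite lt_neqAle eq_sym n0 nsq_ge0.
have := re_inner_CS x (w *: y).
rewrite innerZr -/w mulrC mulCconj hnorm2Z /= => h.
by rewrite -(ler_pM2l n1) -expr2 (le_trans h)// mulrCA.
Qed.

Lemma closed_approx (V : set H) x : closed V ->
  (forall e, 0 < e -> exists2 v, V v & hnorm2 (x - v) <= e) -> V x.
Proof.
move=> clV app; apply: clV => B /nbhs_ballP[_ /= /gt0_realC[e e0 ->] eB].
have e1 : 0 < (e / 2) ^+ 2 by rewrite exprn_gt0// divr_gt0.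
have [v Vv xv] := app _ e1.
exists v; split=> //; apply: eB; rewrite -ball_normE /= normE ltcR.
rewrite (@le_lt_trans _ _ (e / 2))//; last lra.
have -> : e / 2 = Num.sqrt ((e / 2) ^+ 2).
  by rewrite sqrtr_sqr ger0_norm// divr_ge0// ltW.
exact: ler_wsqrtr.
Qed.

Lemma approx_closed (V : set H) :
  (forall x, (forall e, 0 < e -> exists2 v, V v & hnorm2 (x - v) <= e) -> V x)
  -> closed V.
Proof.
move=> app x clx; apply: app => e e0.
have se0 : 0 < (Num.sqrt e)%:C :> R[i] by rewrite ltcR sqrtr_gt0.
have [v [Vv]] := clx _ (nbhsx_ballx x _ se0).
rewrite -ball_normE /= normE ltcR => h; exists v => //.
by rewrite -ler_sqrt ?ltW.
Qed.

Lemma hilbert_cauchy (u : nat -> H) :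
  (forall e, 0 < e -> exists N, forall n m, (N <= n)%N -> (N <= m)%N ->
     hnorm2 (u n - u m) <= e) ->
  exists l, forall e, 0 < e -> exists N, forall n, (N <= n)%N ->
     hnorm2 (u n - l) <= e.
Proof.
move=> uc; have : cvg (u @ \oo).
  apply: cauchy_cvg; apply/cauchy_ballP => _ /gt0_realC[e e0 ->].
  have e1 : 0 < (e / 2) ^+ 2 by rewrite exprn_gt0// divr_gt0.
  have [N NP] := uc _ e1.
  exists ([set u n | n in [set n | (N <= n)%N]],
          [set u n | n in [set n | (N <= n)%N]]) => /=.
    by split; exists N => // n Nn; exists n.
  move=> [_ _] /= [[n Nn <-] [m Nm <-]].
  rewrite -ball_normE /= normE ltcR (@le_lt_trans _ _ (e / 2))//; last lra.
  have -> : e / 2 = Num.sqrt ((e / 2) ^+ 2).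
    by rewrite sqrtr_sqr ger0_norm// divr_ge0// ltW.
  by rewrite ler_wsqrtr// NP.
move=> /cvg_ex[l /cvgrPdist_lt ul]; exists l => e e0.
have se0 : 0 < (Num.sqrt e)%:C :> R[i] by rewrite ltcR sqrtr_gt0.
have [N _ NP] := ul _ se0; exists N => n /NP /=.
by rewrite normE ltcR hnorm2C => h; rewrite -ler_sqrt ?ltW.
Qed.

Definition midconvex (C : set H) :=
  forall x y, C x -> C y -> C ((2^-1)%:C *: (x + y)).

(** The midpoint has squared norm at least [d], so the parallelogram law brings near-minimizers
    close to each other: minimizing sequences are Cauchy. *)
Lemma midpoint_bound (C : set H) d x y : midconvex C ->
  (forall z, C z -> d <= hnorm2 z) -> C x -> C y ->
  hnorm2 (x - y) <= 2 * (hnorm2 x - d) + 2 * (hnorm2 y - d).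
Proof.
move=> mC dC Cx Cy; have := dC _ (mC _ _ Cx Cy).
rewrite hnorm2Z nsqR; have := hnorm2_parallelogram x y; lra.
Qed.

Lemma min_norm_exists (C : set H) : midconvex C -> closed C -> C !=set0 ->
  exists2 x, C x & forall z, C z -> hnorm2 x <= hnorm2 z.
Proof.
move=> mC clC [c0 Cc0].
pose S := hnorm2 @` C; pose d := inf S.
have S0 : S !=set0 by exists (hnorm2 c0), c0.
have lS : has_lbound S by exists 0 => _ [z _ <-]; exact: hnorm2_ge0.
have dC z : C z -> d <= hnorm2 z by move=> Cz; apply: ge_inf => //; exists z.
have ex (n : nat) : exists x, C x /\ hnorm2 x < d + n.+1%:R^-1.
  have n0 : 0 < (n.+1%:R^-1 : R) by rewrite invr_gt0.
  by have [_ [x Cx <-] ?] := inf_adherent n0 (conj S0 lS); exists x.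
have [u uP] := choice ex.
have un n : C (u n) by have [] := uP n.
have und (e : R) : 0 < e -> exists N, forall n, (N <= n)%N ->
    hnorm2 (u n) < d + e.
  move=> e0; exists (Num.truncn e^-1) => n Nn.
  have [_ h] := uP n; rewrite (lt_le_trans h)// lerD2l.
  rewrite -[leRHS]invrK lef_pV2 ?posrE ?invr_gt0//.
  by rewrite (le_trans (ltW (truncnS_gt _)))// ler_nat ltnS.
have [|l lP] := @hilbert_cauchy u.
  move=> e e0; have e4 : 0 < e / 4 by rewrite divr_gt0.
  have [N NP] := und _ e4; exists N => n m Nn Nm.
  have := midpoint_bound mC dC (un n) (un m).
  have h3 := NP _ Nn; have h4 := NP _ Nm; lra.
have Cl : C l.
  apply: closed_approx => // e /lP[N NP]; exists (u N) => //.
  by rewrite hnorm2C NP.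
exists l => // z Cz; rewrite (le_trans _ (dC z Cz))//.
apply/ler_addgt0Pr => e e0.
(* [M] bounds every [hnorm2 (u n)], and [M >= 1] makes [M * t] a bound for the inner product of
   [u n] and [l - u n]. With this [t] the errors add up to at most [e]. *)
pose M := d + 1 + 1.
have dge0 : 0 <= d by apply: lb_le_inf => // _ [y _ <-]; exact: hnorm2_ge0.
pose t := Num.min 1 (e / (4 * M)).
have M0 : 0 < M by rewrite /M; lra.
have t0 : 0 < t by rewrite lt_min ltr01 divr_gt0// mulr_gt0.
have [N NP] := lP _ (exprn_gt0 2 t0).
have e2 : 0 < e / 4 by rewrite divr_gt0.
have [N' NP'] := und _ e2; pose n := maxn N N'.
have h1 := NP n (leq_maxl _ _); have h2 := NP' n (leq_maxr _ _).
have -> : l = u n + (l - u n) by rewrite addrC subrK.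
rewrite hnorm2D hnorm2C.
have hM : hnorm2 (u n) <= M.
  have [_ /ltW h3] := uP n; rewrite (le_trans h3)// /M -addrA lerD2l.
  by rewrite (@le_trans _ _ 1)// ?invf_le1 ?ler1n// lerDr.
have cs := re_inner_CS (u n) (l - u n).
have cs2 : complex.Re '[u n, l - u n] <= M * t.
  have Mt0 : 0 <= M * t by rewrite mulr_ge0 ?ltW.
  rewrite (le_trans (ler_norm _))// -(@ler_pXn2r _ 2)// ?nnegrE//.
  rewrite real_normK ?num_real// (le_trans cs)// exprMn ler_pM ?hnorm2_ge0//.
    rewrite (le_trans hM)// expr2 ler_peMl ?ltW//.
    by rewrite /M; lra.
  by rewrite hnorm2C.
have t1 : t <= 1 by rewrite /t ge_min lexx.
have t2 : M * t <= e / 4.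
  have : t <= e / (4 * M) by rewrite /t ge_min lexx orbT.
  rewrite ler_pdivlMr ?mulr_gt0//; lra.
have t3 : t ^+ 2 <= M * t.
  by rewrite expr2 ler_wpM2r ?ltW// (le_lt_trans t1)// /M; lra.
lra.
Qed.

End HilbertBasics.

Section Projection.
Variables (R : realType) (H : hilbertSpace R).
Implicit Types (V : set H) (x : H).

Lemma projection_exists V x : closed_subspace V ->
  exists2 y, V y & forall v, V v -> inner H (x - y) v = 0.
Proof.
move=> [V0 Vlin clV].
pose C := [set z | V (x - z)].
have VZ a v : V v -> V (a *: v).
  by move=> Vv; rewrite -[_ *: _]addr0; exact: Vlin.
have VD v w : V v -> V w -> V (v + w).
  by move=> Vv Vw; rewrite -[v]scale1r; exact: Vlin.
have mC : midconvex C.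
  move=> y z Cy Cz; rewrite /C /=.
  have -> : x - (2^-1)%:C *: (y + z) = (2^-1)%:C *: ((x - y) + (x - z)).
    rewrite addrACA -opprD scalerBr; congr (_ - _).
    rewrite -{2 3}[x]scale1r -scalerDl scalerA.
    suff -> : (2^-1)%:C * (1 + 1) = 1 :> R[i] by rewrite scale1r.
    by apply/eqP; rewrite eq_complex /=; apply/andP; split; apply/eqP; field.
  exact/VZ/VD.
have clC : closed C.
  apply: approx_closed => y app; apply: (@closed_approx _ _ V) => // e e0.
  have [z Cz yz] := app e e0.
  exists (x - z) => //.
  by rewrite opprB addrC addrA subrK hnorm2C.
have C0 : C !=set0 by exists x; rewrite /C /= subrr.
have [y Cy yP] := min_norm_exists mC clC C0.
exists (x - y) => // v Vv; rewrite opprB addrC subrK.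
(* Moving [y] by [- t * w] times [v] lowers its squared norm by at least [t * nsq w], so minimality
   forces [w = 0]. The summand 1 allows [v = 0]. *)
set w := inner H y v; pose t := (hnorm2 v + 1)^-1.
have n0 := hnorm2_ge0 v; have n1 : 0 < hnorm2 v + 1 by rewrite ltr_wpDl.
have := yP (y + (- (t%:C * w)) *: v).
have Cz : C (y + (- (t%:C * w)) *: v).
  rewrite /C /= opprD addrA -scaleNr opprK; exact/VD/VZ.
move=> /(_ Cz); rewrite hnorm2D innerZr -/w hnorm2Z nsqN nsqM nsqR.
have -> : complex.Re (Num.conj (- (t%:C * w)) * w) = - (t * nsq w).
  by clear; case: w => u1 u2; rewrite /nsq /=; ring.
move=> h.
have w0 := nsq_ge0 w.
have t0 : 0 < t by rewrite invr_gt0.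
have h2 : t ^+ 2 * nsq w * hnorm2 v <= t * nsq w.
  have -> : t ^+ 2 * nsq w * hnorm2 v = t * nsq w * (t * hnorm2 v) by ring.
  rewrite ler_piMr// ?mulr_ge0// ?ltW//.
  by rewrite /t mulrC ltr_pdivrMr//; lra.
have h3 : t * nsq w <= 0 by lra.
by apply/eqP; rewrite -nsq_eq0 eq_le w0 andbT -(pmulr_rle0 _ t0).
Qed.

End Projection.

(** * Positive definite functions and the GNS construction *)

Section PositiveDefinite.
Variables (R : realType) (G : groupType).
Implicit Types (phi : G -> R[i]).

(** With this order of the factors, the kernel is [<pi a x, pi b x>] when [phi] is the coefficient
    of [x]. *)
Definition group_kernel phi (a b : G) : R[i] := phi (b^-1 * a)%g.

Definition posdef_fun phi := posdef (group_kernel phi).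

Definition pd1 phi := posdef_fun phi /\ phi 1%g = 1.

Definition extreme_pd1 phi := pd1 phi /\
  forall phi1 phi2 (t : R), 0 < t -> t < 1 -> pd1 phi1 -> pd1 phi2 ->
    (forall g, phi g = t%:C * phi1 g + (1 - t)%:C * phi2 g) ->
    forall g, phi1 g = phi g.

Lemma rep_inner_adj (H : hilbertSpace R) (pi : unitaryRep G H) g x y :
  inner H (pi g x) y = inner H x (pi g^-1%g y).
Proof. by rewrite -(rep_unitary pi g^-1%g) -repM mulVg rep1. Qed.

Lemma coefficient_posdef (H : hilbertSpace R) (pi : unitaryRep G H) x :
  posdef_fun (fun g => inner H (pi g x) x).
Proof.
move=> s; pose v := \sum_(p <- s) p.1 *: pi p.2 x.
rewrite (_ : gram _ _ _ = inner H v v).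
  by rewrite hnorm2E lecR hnorm2_ge0.
rewrite /gram /v inner_suml; apply: eq_bigr => p _.
rewrite inner_sumr; apply: eq_bigr => r _.
rewrite innerZl innerZr mulrA; congr (_ * _).
by rewrite /group_kernel repM rep_inner_adj invgK.
Qed.

End PositiveDefinite.

Section GNS.
Variables (R : realType) (G : groupType) (phi : G -> R[i]).
Hypothesis phi_pos : posdef_fun phi.

Definition gns_kernel : posdef_kernel R G := PosdefKernel phi_pos.

Local Notation K := gns_kernel.
Local Notation H := (rkhs_hilbert K).

Definition seq_shift (g : G) (s : seq (R[i] * G)) :=
  [seq (p.1, (g * p.2)%g) | p <- s].

Lemma gramn_shift g s : gramn K (seq_shift g s) = gramn K s.
Proof.
rewrite /gramn /gram; congr complex.Re; rewrite big_map.
apply: eq_bigr => p _; rewrite big_map; apply: eq_bigr => r _ /=.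
by rewrite /group_kernel invgM -mulgA mulKg.
Qed.

Definition translate (g : G) (f : G -> R[i]) (a : G) : R[i] := f (g^-1 * a)%g.

Lemma legendre_translate g f s :
  legendre K (translate g f) s = legendre K f (seq_shift g^-1%g s).
Proof. by rewrite /legendre gramn_shift /pairing big_map. Qed.

Lemma translate_bounded g (f : rkhs K) : translate g f \in legendre_pred K.
Proof.
have [M fM] := rkhs_bounded f.
by rewrite inE; exists M => s; rewrite legendre_translate.
Qed.

Definition gns_fun g (f : rkhs K) : rkhs K := Rkhs (translate_bounded g f).

Lemma gns_fun_linear g : linear (gns_fun g).
Proof. by move=> a f h; apply/val_inj. Qed.

Definition gns_linear g : {linear H -> H} :=
  HB.pack (gns_fun g : H -> H)
    (GRing.isLinear.Build R[i] H H *:%R (gns_fun g) (gns_fun_linear g)).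

Lemma gns1 x : gns_linear 1%g x = x.
Proof.
apply/val_inj/funext => a /=.
by rewrite /translate invg1 mul1g.
Qed.

Lemma gnsM g h x : gns_linear (g * h)%g x = gns_linear g (gns_linear h x).
Proof.
apply/val_inj/funext => a /=.
by rewrite /translate /= /translate invgM mulgA.
Qed.

Lemma rkhs_q_gns g f : rkhs_q (gns_fun g f) = rkhs_q f.
Proof.
have le k h : rkhs_q (gns_fun k h) <= rkhs_q h.
  by apply: rkhs_q_le => s /=; rewrite legendre_translate legendre_le.
apply/eqP; rewrite eq_le le /=.
have {1}-> : f = gns_fun g^-1%g (gns_fun g f).
  by have := gnsM g^-1%g g f; rewrite mulVg gns1.
exact: le.
Qed.

Lemma gns_unitary g (x y : H) :
  inner H (gns_linear g x) (gns_linear g y) = inner H x y.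
Proof.
rewrite !qform_hilbert_inner /qform_inner /qform_re.
have D (u v : rkhs K) : gns_fun g (u + v) = gns_fun g u + gns_fun g v.
  exact/val_inj.
have Z a (u : rkhs K) : gns_fun g (a *: u) = a *: gns_fun g u.
  exact/val_inj.
by rewrite -!Z -!D !rkhs_q_gns.
Qed.

Definition gns_rep : unitaryRep G H := UnitaryRep gns1 gnsM gns_unitary.

Definition gns_vector : H := kernel_vector K 1%g.

Lemma gns_orbit g : gns_rep g gns_vector = kernel_vector K g.
Proof.
apply/val_inj/funext => a /=.
by rewrite /translate /group_kernel mulg1 invgM invgK.
Qed.

(** A vector, seen as a function on [G], is the family of its own inner products with the orbit of
    [gns_vector]; totality of the orbit follows at once. *)
Lemma gns_eval (f : H) g :
  inner H f (gns_rep g gns_vector) = (f : rkhs K) g.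
Proof. by rewrite gns_orbit; exact: rkhs_inner_kernel. Qed.

Lemma gns_coefficient g : inner H (gns_rep g gns_vector) gns_vector = phi g.
Proof.
rewrite gns_orbit -[X in inner _ _ X](rep1 gns_rep) gns_eval /=.
by rewrite /group_kernel invg1 mul1g.
Qed.

Lemma gns_total (f : H) :
  (forall g, inner H f (gns_rep g gns_vector) = 0) -> f = 0.
Proof.
by move=> f0; apply/val_inj/funext => g /=; rewrite -gns_eval f0.
Qed.

End GNS.

Section ExtremeIrreducible.
Variables (R : realType) (G : groupType) (phi : G -> R[i]).
Hypothesis phi_ext : extreme_pd1 phi.

Let phi_pos : posdef_fun phi. Proof. by case: phi_ext => -[]. Qed.
Let H := rkhs_hilbert (gns_kernel phi_pos).
Let pi : unitaryRep G H := gns_rep phi_pos.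
Let xi : H := gns_vector phi_pos.

Lemma hnorm2_gns_vector : hnorm2 xi = 1.
Proof.
rewrite /hnorm2 -[X in inner _ X _](rep1 pi) gns_coefficient.
by case: phi_ext => -[_ ->].
Qed.

(** Projecting [xi] on [V] splits [phi] into a convex combination of the normalized coefficients of
    [eta] and [w], the cross terms vanishing by invariance. Extremality makes the coefficient of
    [eta] equal to [l * phi], so [eta - l *: xi] is orthogonal to the orbit and vanishes. Hence the
    cyclic vector [xi] lies in [V]. *)
Lemma gns_irreducible : irreducible pi.
Proof.
split.
  by exists xi; rewrite -hnorm2_eq0 hnorm2_gns_vector oner_eq0.
move=> V Vsub Vinv; have [V0 Vlin clV] := Vsub.
have full : V xi -> V = setT.
  move=> Vxi; apply/seteqP; split=> // x _.
  have [y Vy yP] := projection_exists x Vsub.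
  suff -> : x = y by [].
  apply/eqP; rewrite -subr_eq0; apply/eqP; apply: gns_total => g.
  by apply: yP; exact: Vinv.
have [eta Veta etaP] := projection_exists xi Vsub.
have orthV v w g : V v -> (forall v', V v' -> inner H w v' = 0) ->
    inner H v (pi g w) = 0.
  move=> Vv wP; rewrite inner_conj rep_inner_adj wP ?rmorph0//.
  exact: Vinv.
have [eta0|eta0] := eqVneq eta 0.
  left; apply/seteqP; split=> [v Vv|v ->//] /=.
  apply: (gns_total (phi_pos := phi_pos)) => g; apply: orthV => // v' Vv'.
  by have := etaP _ Vv'; rewrite eta0 subr0.
right; apply: full; pose l := hnorm2 eta; pose w := xi - eta.
have l0 : 0 < l by rewrite lt_neqAle eq_sym hnorm2_eq0 eta0 hnorm2_ge0.
have xiE : xi = eta + w by rewrite /w addrC subrK.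
rewrite -/w in etaP; clearbody w.
have hw : l + hnorm2 w = 1.
  rewrite -hnorm2_gns_vector xiE hnorm2D inner_conj etaP// rmorph0 mulr0.
  by rewrite addr0.
have [w0|w0] := eqVneq w 0; first by rewrite xiE w0 addr0.
have w1 : 0 < hnorm2 w by rewrite lt_neqAle eq_sym hnorm2_eq0 w0 hnorm2_ge0.
have pd_of (x : H) : 0 < hnorm2 x ->
    pd1 (fun g => (hnorm2 x)^-1%:C * inner H (pi g x) x).
  move=> x0; split; last first.
    by rewrite rep1 hnorm2E -rmorphM/= mulVf// gt_eqF.
  move=> s; have := coefficient_posdef pi x s.
  rewrite /gram => h; rewrite (_ : \sum_(p <- s) _ = (hnorm2 x)^-1%:C *
    gram (group_kernel (fun g => inner H (pi g x) x)) s s).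
    by rewrite mulr_ge0// lecR invr_ge0 hnorm2_ge0.
  rewrite /gram mulr_sumr; apply: eq_bigr => p _; rewrite mulr_sumr.
  by apply: eq_bigr => r _; rewrite /group_kernel; ring.
have cross g : inner H (pi g xi) xi =
    inner H (pi g eta) eta + inner H (pi g w) w.
  have piD : pi g (eta + w) = pi g eta + pi g w by exact: linearD.
  rewrite xiE piD innerDl !innerDr.
  rewrite [inner H (pi g w) eta]rep_inner_adj (etaP (pi _ eta));
    last exact: Vinv.
  rewrite [inner H (pi g eta) w]inner_conj etaP ?rmorph0 ?addr0 ?add0r//.
  exact: Vinv.
have [_ ext] := phi_ext.
have etaE g : inner H (pi g eta) eta = l%:C * inner H (pi g xi) xi.
  have l1 : l < 1 by rewrite -hw ltrDl.
  rewrite [inner H (pi g xi) xi]gns_coefficient.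
  have := ext _ _ l l0 l1 (pd_of _ l0) (pd_of _ w1).
  have -> : 1 - l = hnorm2 w by rewrite -hw addrC addKr.
  move=> /(_ _ g) <-.
    by rewrite mulrA -rmorphM/= divff ?gt_eqF// mul1r.
  move=> k; rewrite !mulrA -!rmorphM/= !divff ?gt_eqF// !mul1r -cross.
  by rewrite gns_coefficient.
have etaxi : eta = l%:C *: xi.
  apply/eqP; rewrite -subr_eq0; apply/eqP.
  apply: (gns_total (phi_pos := phi_pos)) => g.
  rewrite innerBl innerZl.
  have -> : inner H eta (pi g xi) = inner H eta (pi g eta).
    have piD : pi g (eta + w) = pi g eta + pi g w by exact: linearD.
    by rewrite {1}xiE piD innerDr [X in _ + X]orthV ?addr0.
  rewrite inner_conj etaE [inner H xi (pi g xi)]inner_conj conjM_realC.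
  by rewrite subrr.
have -> : xi = l^-1%:C *: eta.
  by rewrite etaxi scalerA -rmorphM/= mulVf ?gt_eqF// scale1r.
by rewrite -[_ *: _]addr0; exact: Vlin.
Qed.

Lemma extreme_irrep : exists (q : irrep R G) (x : irrep_space q),
  forall g, inner _ (q g x) x = phi g.
Proof.
by exists (Irrep gns_irreducible), xi => g; exact: gns_coefficient.
Qed.

End ExtremeIrreducible.

(** * Minimization at an extreme point *)

Section LexicographicMinimum.
Variables (R : realType) (P : set (nat -> R)) (B : nat -> R).
Hypothesis P0 : P !=set0.
Hypothesis PB : forall x i, P x -> `|x i| <= B i.
Hypothesis Pclosed : forall a : nat -> R,
  (forall k e, 0 < e ->
     exists2 x, P x & forall i, (i < k)%N -> `|x i - a i| <= e) -> P a.

Let near_prefix (a : nat -> R) k e : set (nat -> R) :=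
  [set x | P x /\ forall i, (i < k)%N -> `|x i - a i| <= e].

Let inf_prefix a k e : R := inf [set x k | x in near_prefix a k e].

(* The next coordinate is the limit, as e tends to 0, of its infimum over the
   points that are e-close to a in the previous coordinates; this replaces the
   compactness of P. *)
Let lex_next (a : nat -> R) k : R :=
  sup [set inf_prefix a k e | e in [set e : R | 0 < e]].

Let Fixpoint lex_prefix k : seq R :=
  if k is j.+1 then rcons (lex_prefix j) (lex_next (nth 0 (lex_prefix j)) j)
  else [::].

Let lex_min k : R := nth 0 (lex_prefix k.+1) k.

Let size_lex_prefix k : size (lex_prefix k) = k.
Proof. by elim: k => //= k IH; rewrite size_rcons IH. Qed.

Let nth_lex_prefix k i : (i < k)%N -> nth 0 (lex_prefix k) i = lex_min i.
Proof.
elim: k => // k IH; rewrite ltnS leq_eqVlt => /orP[/eqP->//|ik].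
by rewrite /= nth_rcons size_lex_prefix ik IH.
Qed.

Let lex_minE k : lex_min k = lex_next lex_min k.
Proof.
rewrite {1}/lex_min /= nth_rcons size_lex_prefix ltnn eqxx.
rewrite /lex_next /inf_prefix; congr sup; apply: eq_imagel => e _.
congr inf; congr image; apply/seteqP; split=> x [Px h]; split=> // i ik;
  have := h i ik; by rewrite nth_lex_prefix.
Qed.

Let inf_lbound k e : has_lbound [set x k | x in near_prefix lex_min k e].
Proof.
exists (- B k) => _ [x [Px _] <-].
by have := PB k Px; rewrite ler_norml => /andP[].
Qed.

(** The infima defining [lex_min k] grow as the radius shrinks. At the radius [e'] the infimum is at
    most [lex_min k] and within [e] of it, so a point nearly attaining it is close in coordinate [k]
    as well. *)
Let lex_approx k e : 0 < e -> near_prefix lex_min k e !=set0.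
Proof.
elim: k e => [e e0|k IH e e0]; first by have [x Px] := P0; exists x.
have inf_ub e' : 0 < e' -> inf_prefix lex_min k e' <= B k.
  move=> /IH[x [Px xe]]; apply: (@le_trans _ _ (x k)).
    by apply: ge_inf; [exact: inf_lbound|exists x].
  by rewrite (le_trans (ler_norm _)) ?PB.
have hs : has_sup [set inf_prefix lex_min k e | e in [set e : R | 0 < e]].
  split; first by exists (inf_prefix lex_min k 1), 1 => //=.
  by exists (B k) => _ [e' e'0 <-]; exact: inf_ub.
have [_ [d d0 <-] dk] := sup_adherent e0 hs.
rewrite -/(lex_next lex_min k) -lex_minE in dk.
pose e' := Num.min d e.
have e'0 : 0 < e' by rewrite lt_min d0 e0.
have mono : inf_prefix lex_min k d <= inf_prefix lex_min k e'.
  apply: lb_le_inf.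
    by have [x xP] := IH _ e'0; exists (x k), x.
  move=> _ [x [Px xe] <-]; apply: ge_inf; first exact: inf_lbound.
  exists x => //; split=> // i /xe h; apply: (le_trans h).
  by rewrite ge_min lexx.
have hi : has_inf [set x k | x in near_prefix lex_min k e'].
  split; last exact: inf_lbound.
  by have [x xP] := IH _ e'0; exists (x k), x.
have [_ [x [Px xe] <-] xk] := inf_adherent e0 hi.
exists x; split=> // i; rewrite ltnS leq_eqVlt => /orP[/eqP->|/xe h].
  have h1 : inf_prefix lex_min k e' <= x k.
    by apply: ge_inf; [exact: inf_lbound|exists x].
  have h2 : inf_prefix lex_min k e' <= lex_min k.
    rewrite lex_minE; apply: ub_le_sup; last by exists e'.
    by have [] := hs.
  rewrite -/(inf_prefix lex_min k e') in xk.
  by rewrite ler_norml; apply/andP; split; lra.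
by rewrite (le_trans h)// ge_min lexx orbT.
Qed.

Lemma lexicographic_minimum : exists2 a, P a & forall x k, P x ->
  (forall i, (i < k)%N -> x i = a i) -> a k <= x k.
Proof.
exists lex_min.
  by apply: Pclosed => k e /(lex_approx k)[x [Px xe]]; exists x.
move=> x k Px xa; rewrite lex_minE; apply: ge_sup.
  by exists (inf_prefix lex_min k 1), 1 => //=.
move=> _ [e e0 <-]; apply: ge_inf; first exact: inf_lbound.
exists x => //; split=> // i ik; rewrite xa// subrr normr0.
exact: ltW.
Qed.

End LexicographicMinimum.

Section ExtremeMinimum.
Variables (R : realType) (G : groupType).
Implicit Types (phi psi : G -> R[i]).

(** The value is a coefficient of a unit vector of the GNS space, so Cauchy-Schwarz applies. *)
Lemma pd1_le1 phi g : pd1 phi -> nsq (phi g) <= 1.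
Proof.
move=> [phi_pos phi1]; have xi1 : hnorm2 (gns_vector phi_pos) = 1.
  by rewrite /hnorm2 -[X in inner _ X _](rep1 (gns_rep phi_pos))
    gns_coefficient phi1.
have := inner_CS (gns_rep phi_pos g (gns_vector phi_pos)) (gns_vector phi_pos).
by rewrite gns_coefficient {1}/hnorm2 rep_unitary -/(hnorm2 _) xi1 mulr1.
Qed.

Lemma re_le_nsq (a : R[i]) : nsq a <= 1 -> `|complex.Re a| <= 1.
Proof.
rewrite /nsq => h; rewrite -(@expr_le1 _ 2)// real_normK ?num_real//.
by rewrite (le_trans _ h)// lerDl sqr_ge0.
Qed.

Lemma im_le_nsq (a : R[i]) : nsq a <= 1 -> `|complex.Im a| <= 1.
Proof.
rewrite /nsq => h; rewrite -(@expr_le1 _ 2)// real_normK ?num_real//.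
by rewrite (le_trans _ h)// lerDr sqr_ge0.
Qed.

Lemma pd1_one : pd1 (fun _ : G => 1 : R[i]).
Proof.
split=> // s; rewrite (_ : gram _ s s =
    (\sum_(p <- s) p.1) * Num.conj (\sum_(p <- s) p.1)).
  by rewrite mulCconj lecR nsq_ge0.
rewrite /gram rmorph_sum mulr_suml; apply: eq_bigr => p _.
by rewrite mulr_sumr; apply: eq_bigr => r _; rewrite mulr1.
Qed.

Lemma complex_ReM (a b : R[i]) : complex.Re (a * b) =
  complex.Re a * complex.Re b - complex.Im a * complex.Im b.
Proof. by case: a => ? ?; case: b. Qed.

Lemma complex_ImM (a b : R[i]) : complex.Im (a * b) =
  complex.Re a * complex.Im b + complex.Im a * complex.Re b.
Proof. by case: a => ? ?; case: b => ? ? /=; rewrite addrC. Qed.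

Lemma cvg_sumr I (r : seq I) (f : nat -> I -> R) (l : I -> R) :
  (forall i, f n i @[n --> \oo] --> l i) ->
  \sum_(i <- r) f n i @[n --> \oo] --> \sum_(i <- r) l i.
Proof.
by move=> fl; apply: cvg_big => [|i _]; [exact: add_continuous|exact: fl].
Qed.

Lemma eq_cvg_seq (u v : nat -> R) (l : R) :
  u =1 v -> v @ \oo --> l -> u @ \oo --> l.
Proof. by move=> /funext ->. Qed.

Lemma cvgr_unique (u : nat -> R) (l l' : R) :
  u @ \oo --> l -> u @ \oo --> l' -> l = l'.
Proof. by move=> ul ul'; exact: (cvg_unique _ ul ul'). Qed.

Lemma pd1_pointwise_limit (psi : nat -> G -> R[i]) phi :
  (forall n, pd1 (psi n)) ->
  (forall g, complex.Re (psi n g) @[n --> \oo] --> complex.Re (phi g)) ->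
  (forall g, complex.Im (psi n g) @[n --> \oo] --> complex.Im (phi g)) ->
  pd1 phi.
Proof.
move=> psi1 cre cim; split; last first.
  apply/eqP; rewrite eq_complex; apply/andP; split; apply/eqP.
    apply: cvgr_unique (cre 1%g) _.
    apply: (@eq_cvg_seq _ (fun=> 1)) (cvg_cst _).
    by move=> n; rewrite (psi1 n).2.
  apply: cvgr_unique (cim 1%g) _; apply: (@eq_cvg_seq _ (fun=> 0)) (cvg_cst _).
  by move=> n; rewrite (psi1 n).2.
move=> s.
have gramE (f : R[i] -> R) psi' : f =1 @complex.Re R \/ f =1 @complex.Im R ->
    f (gram (group_kernel psi') s s) = \sum_(p <- s) \sum_(r <- s)
      f (p.1 * Num.conj r.1 * group_kernel psi' p.2 r.2).
  move=> fE; rewrite /gram.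
  have fD a b : f (a + b) = f a + f b by case: fE => fE; rewrite !fE raddfD.
  have f0 : f 0 = 0 by case: fE => fE; rewrite !fE raddf0.
  rewrite (big_morph f fD f0); apply: eq_bigr => p _.
  by rewrite (big_morph f fD f0).
have cRe : complex.Re (gram (group_kernel (psi n)) s s) @[n --> \oo] -->
    complex.Re (gram (group_kernel phi) s s).
  rewrite gramE; last by left.
  apply: eq_cvg_seq => [n|]; first by apply: gramE; left.
  apply: cvg_sumr => p; apply: cvg_sumr => q; rewrite complex_ReM.
  apply: eq_cvg_seq => [n|]; first exact: complex_ReM.
  by apply: cvgB; apply: cvgMl_tmp; [exact: cre|exact: cim].
have cIm : complex.Im (gram (group_kernel (psi n)) s s) @[n --> \oo] -->
    complex.Im (gram (group_kernel phi) s s).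
  rewrite gramE; last by right.
  apply: eq_cvg_seq => [n|]; first by apply: gramE; right.
  apply: cvg_sumr => p; apply: cvg_sumr => q; rewrite complex_ImM.
  apply: eq_cvg_seq => [n|]; first exact: complex_ImM.
  by apply: cvgD; apply: cvgMl_tmp; [exact: cim|exact: cre].
have pos n : complex.Im (gram (group_kernel (psi n)) s s) = 0 /\
    0 <= complex.Re (gram (group_kernel (psi n)) s s).
  by have := (psi1 n).1 s; rewrite lecE => /andP[/eqP -> ->].
rewrite lecE; apply/andP; split.
  apply/eqP; apply: (@cvgr_unique _ _ 0 cIm).
  by apply: (@eq_cvg_seq _ (fun=> 0)) (cvg_cst _) => n; have [] := pos n.
rewrite -(cvg_lim _ cRe)//; apply: limr_ge; first exact: cvgP cRe.
by apply: nearW => n; have [] := pos n.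
Qed.

Variable enumG : nat -> G.
Hypothesis enumG_surj : forall g, exists n, enumG n = g.

Variable ws : seq (R * G).

Definition pd_functional phi : R :=
  \sum_(p <- ws) p.1 * complex.Re (phi p.2).

(** The functional comes first, so that a lexicographic minimum minimizes it; real and imaginary
    parts then alternate along the enumeration. *)
Let coord phi i : R :=
  if i is j.+1 then
    (if odd j then @complex.Im R else @complex.Re R) (phi (enumG j./2))
  else pd_functional phi.

(** This is the passage from extreme points to all of [pd1]: an affine inequality need only be
    checked at a minimizer, and an extreme one exists. *)
Lemma extreme_minimum : exists2 phi, extreme_pd1 phi &
  forall psi, pd1 psi -> pd_functional phi <= pd_functional psi.
Proof.
pose P := [set x : nat -> R |
  exists2 phi, pd1 phi & forall i, x i = coord phi i].
pose B i : R := if i is j.+1 then 1 else \sum_(p <- ws) `|p.1|.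
have P0 : P !=set0.
  by exists (coord (fun=> 1)), (fun=> 1) => //; exact: pd1_one.
have PB x i : P x -> `|x i| <= B i.
  move=> [phi phi1 ->]; case: i => [|i] /=; last first.
    by case: odd; [apply: im_le_nsq|apply: re_le_nsq]; exact: pd1_le1.
  rewrite (le_trans (ler_norm_sum _ _ _))//; apply: ler_sum => p _.
  by rewrite normrM ler_piMr//; apply: re_le_nsq; exact: pd1_le1.
have Pclosed (a : nat -> R) : (forall k e, 0 < e ->
     exists2 x, P x & forall i, (i < k)%N -> `|x i - a i| <= e) -> P a.
  move=> app.
  have ex (n : nat) : exists psi : G -> R[i], pd1 psi /\
      forall i, (i < n)%N -> `|coord psi i - a i| <= n.+1%:R^-1.
    have n0 : 0 < (n.+1%:R^-1 : R) by rewrite invr_gt0.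
    have [x [phi phi1 xE] xP] := app n _ n0.
    by exists phi; split=> // i ni; rewrite -xE xP.
  have [psi psiP] := choice ex.
  have ccvg i : coord (psi n) i @[n --> \oo] --> a i.
    apply/cvgrPdist_le => e e0.
    exists (maxn i.+1 (Num.truncn e^-1)) => // n /=.
    rewrite geq_max => /andP[ni en]; rewrite distrC.
    have [_ /(_ i ni) h] := psiP n; rewrite (le_trans h)//.
    rewrite -[leRHS]invrK lef_pV2 ?posrE ?invr_gt0//.
    by rewrite (le_trans (ltW (truncnS_gt _)))// ler_nat ltnS.
  have [idx idxP] := choice enumG_surj.
  pose phi g := a (idx g).*2.+1 +i* a (idx g).*2.+2.
  have cre g : complex.Re (psi n g) @[n --> \oo] --> complex.Re (phi g).
    have := ccvg (idx g).*2.+1; rewrite /coord odd_double doubleK idxP.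
    exact.
  have cim g : complex.Im (psi n g) @[n --> \oo] --> complex.Im (phi g).
    have := ccvg (idx g).*2.+2.
    rewrite /coord /= odd_double /= uphalf_double idxP.
    exact.
  exists phi.
    by apply: pd1_pointwise_limit cre cim => n; have [] := psiP n.
  move=> i; apply: (cvgr_unique (ccvg i)); case: i => [|i].
    apply: (@cvg_sumr _ ws (fun n p => p.1 * complex.Re (psi n p.2))
      (fun p => p.1 * complex.Re (phi p.2))) => p.
    by apply: cvgMl_tmp; exact: cre.
  by rewrite /coord; case: odd; [exact: cim|exact: cre].
(* The coordinates separate points, so a lexicographic minimum is extreme. *)
have [a [phi phi1 aE] amin] := lexicographic_minimum P0 PB Pclosed.
exists phi; last first.
  move=> psi psi1.
  have := amin (coord psi) 0%N; rewrite aE /=; apply => //.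
  by exists psi.
split=> // phi1' phi2 t t0 t1 p1 p2 phiE g.
have coordE i : coord phi i = t * coord phi1' i + (1 - t) * coord phi2 i.
  case: i => [|i] /=.
    rewrite /pd_functional !mulr_sumr -big_split /=; apply: eq_bigr => p _.
    by rewrite phiE raddfD /= !complex_ReM /=; ring.
  rewrite phiE.
  by case: odd; rewrite raddfD /= ?complex_ReM ?complex_ImM /=; ring.
(* Once the earlier coordinates agree with [a], minimality makes both coordinates at index [i] at
   least [a i], while a proper convex combination of them equals [a i]. *)
have eqs i : forall j, (j < i)%N -> coord phi1' j = a j /\ coord phi2 j = a j.
  elim: i => // i IH j; rewrite ltnS leq_eqVlt => /orP[/eqP->|]; last exact: IH.
  have h1 : a i <= coord phi1' i.
    by apply: amin; [exists phi1'|move=> k /IH[]].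
  have h2 : a i <= coord phi2 i.
    by apply: amin; [exists phi2|move=> k /IH[]].
  have := coordE i; rewrite -aE => h.
  have s1 : 0 <= t * (coord phi1' i - a i) by rewrite mulr_ge0 ?subr_ge0// ltW.
  have s2 : 0 <= (1 - t) * (coord phi2 i - a i).
    by rewrite mulr_ge0 ?subr_ge0// ltW.
  have z1 : t * (coord phi1' i - a i) = 0 by lra.
  have z2 : (1 - t) * (coord phi2 i - a i) = 0 by lra.
  split.
    by move/eqP: z1; rewrite mulf_eq0 gt_eqF//= subr_eq0 => /eqP.
  by move/eqP: z2; rewrite mulf_eq0 gt_eqF ?subr_gt0//= subr_eq0 => /eqP.
have [n nE] := enumG_surj g.
apply/eqP; rewrite eq_complex; apply/andP; split; apply/eqP.
  have [] := eqs n.*2.+2 n.*2.+1 (ltnSn _).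
  by rewrite aE /= odd_double doubleK nE.
have [] := eqs n.*2.+3 n.*2.+2 (ltnSn _).
by rewrite aE /= odd_double /= uphalf_double nE.
Qed.

End ExtremeMinimum.

(** * Schur products and exponentials of kernels *)

Section RealPosdef.
Variables (R : realType) (A : eqType).
Implicit Types (K L : A -> A -> R) (s t : seq (R * A)) (x y : A).

Definition rform K s t : R :=
  \sum_(p <- s) \sum_(r <- t) p.1 * r.1 * K p.2 r.2.

(** Real coefficients do not detect the antisymmetric part of a kernel, so symmetry is imposed. *)
Definition rposdef K :=
  (forall x y, K x y = K y x) /\ forall s, 0 <= rform K s s.

Lemma rformC K s t : rposdef K -> rform K s t = rform K t s.
Proof.
move=> [Ksym _]; rewrite /rform exchange_big; apply: eq_bigr => p _.
by apply: eq_bigr => r _; rewrite Ksym [_ * p.1]mulrC.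
Qed.

Lemma rform_catl K s s' t : rform K (s ++ s') t = rform K s t + rform K s' t.
Proof. by rewrite /rform big_cat. Qed.

Lemma rform_catr K s t t' : rform K s (t ++ t') = rform K s t + rform K s t'.
Proof.
by rewrite /rform -big_split /=; apply: eq_bigr => p _; rewrite big_cat.
Qed.

Lemma rform_seq1r K s c x :
  rform K s [:: (c, x)] = c * \sum_(p <- s) p.1 * K p.2 x.
Proof.
rewrite /rform mulr_sumr; apply: eq_bigr => p _; rewrite big_seq1 /=; ring.
Qed.

Lemma rform_seq1 K c d x y : rform K [:: (c, x)] [:: (d, y)] = c * d * K x y.
Proof. by rewrite rform_seq1r big_seq1 /=; ring. Qed.

Lemma rposdef_diag K x : rposdef K -> 0 <= K x x.
Proof.
by move=> [_ /(_ [:: (1, x)])]; rewrite rform_seq1 !mul1r.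
Qed.

Lemma rposdef_CS K x y : rposdef K -> K x y ^+ 2 <= K x x * K y y.
Proof.
move=> Kpos; have [Ksym Kge0] := Kpos.
have key (u v : R) : 0 <= u ^+ 2 * K x x + 2 * u * v * K x y + v ^+ 2 * K y y.
  have := Kge0 ([:: (u, x)] ++ [:: (v, y)]).
  rewrite rform_catl !rform_catr !rform_seq1 (Ksym y x); lra.
have := rposdef_diag x Kpos; rewrite le_eqVlt => /orP[/eqP x0|x0].
  have [->|xy0] := eqVneq (K x y) 0; first by rewrite -x0 mul0r expr0n.
  have := key (- (K y y + 1) / (2 * K x y)) 1.
  rewrite -x0 mulr0 add0r mulr1.
  have -> : 2 * (- (K y y + 1) / (2 * K x y)) * K x y = - (K y y + 1) by field.
  lra.
have := key (- K x y / K x x) 1.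
rewrite mulr1 expr1n mul1r.
have -> : (- K x y / K x x) ^+ 2 * K x x + 2 * (- K x y / K x x) * K x y + K y y
  = (K x x * K y y - K x y ^+ 2) / K x x by field; rewrite gt_eqF.
by rewrite pmulr_lge0 ?invr_gt0// subr_ge0.
Qed.

(** Completing the square: the form of the complement at [s] is the form of [K] at [s] enlarged by
    the point [x] with weight [- u / K x x]. *)
Lemma rposdef_schur_complement K x : rposdef K -> 0 < K x x ->
  rposdef (fun y z => K y z - K y x * K x z / K x x).
Proof.
move=> [Ksym Kge0] x0; split=> [y z|s].
  by rewrite (Ksym z y) (Ksym z x) (Ksym x y); ring.
pose u := \sum_(p <- s) p.1 * K p.2 x.
have -> : rform (fun y z => K y z - K y x * K x z / K x x) s s =
    rform K s s - u ^+ 2 / K x x.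
  rewrite /rform expr2 /u !mulr_suml -sumrB; apply: eq_bigr => p _.
  rewrite mulr_sumr mulr_suml -sumrB; apply: eq_bigr => r _.
  by rewrite (Ksym x r.2); ring.
have := Kge0 (s ++ [:: (- u / K x x, x)]).
rewrite rform_catl !rform_catr rform_seq1 (@rformC K [:: _] s)//.
rewrite rform_seq1r -/u.
have -> : rform K s s + - u / K x x * u + (- u / K x x * u +
    - u / K x x * (- u / K x x) * K x x) = rform K s s - u ^+ 2 / K x x.
  by field; rewrite gt_eqF.
exact.
Qed.

(* Cholesky decomposition; the points of [zs] are those already eliminated. *)
Lemma rposdef_decomposition K (xs zs : seq A) : rposdef K ->
  (forall z, z \in zs -> K z z = 0) ->
  exists bs : seq (A -> R), forall x y, x \in xs ++ zs -> y \in xs ++ zs ->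
    K x y = \sum_(b <- bs) b x * b y.
Proof.
elim: xs zs K => [|x xs IH] zs K Kpos Kz.
  exists [::] => y z /Kz y0 _; rewrite big_nil.
  by have := rposdef_CS y z Kpos; rewrite y0 mul0r => h;
    apply/eqP; rewrite -sqrf_eq0 eq_le h sqr_ge0.
have mem y : (y \in (x :: xs) ++ zs) = (y \in xs ++ x :: zs).
  by rewrite !mem_cat !inE -orbA orbCA.
have := rposdef_diag x Kpos; rewrite le_eqVlt => /orP[/eqP x0|x0].
  have [|bs bsP] := IH (x :: zs) K Kpos.
    by move=> z; rewrite inE => /orP[/eqP->|/Kz].
  by exists bs => y z; rewrite !mem; exact: bsP.
have K'pos := rposdef_schur_complement Kpos x0.
have [|bs bsP] := IH (x :: zs) _ K'pos.
  move=> z; rewrite inE => /orP[/eqP->|/Kz z0].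
    by rewrite mulfK ?gt_eqF// subrr.
  have : K z x ^+ 2 <= 0 by have := rposdef_CS z x Kpos; rewrite z0 mul0r.
  move=> h; have : K z x == 0 by rewrite -sqrf_eq0 eq_le h sqr_ge0.
  by move=> /eqP ->; rewrite z0 !mul0r subrr.
exists ((fun y => K y x / Num.sqrt (K x x)) :: bs) => y z.
rewrite !mem => ym zm; rewrite big_cons -bsP//.
have := sqr_sqrtr (ltW x0); set r := Num.sqrt _ => rE.
have r0 : r != 0 by rewrite gt_eqF// sqrtr_gt0.
rewrite (Kpos.1 z x) -rE; field.
by rewrite r0.
Qed.

(** Schur product: on finitely many points [K] is a sum of products [b x * b y], and each of them
    turns the form of [L] into the form of [L] at rescaled coefficients. *)
Lemma rposdefM K L : rposdef K -> rposdef L ->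
  rposdef (fun x y => K x y * L x y).
Proof.
move=> Kpos [Lsym Lge0]; split=> [x y|s].
  by rewrite Lsym (Kpos.1 x).
have [|bs bsP] := @rposdef_decomposition K (map snd s) [::] Kpos.
  by move=> z.
rewrite cats0 in bsP.
have -> : rform (fun x y => K x y * L x y) s s = \sum_(b <- bs)
    rform L [seq (p.1 * b p.2, p.2) | p <- s] [seq (p.1 * b p.2, p.2) | p <- s].
  rewrite /rform; under [RHS]eq_bigr do rewrite big_map.
  rewrite [RHS]exchange_big /= big_seq [RHS]big_seq; apply: eq_bigr => p ps.
  under [RHS]eq_bigr do rewrite big_map.
  rewrite [RHS]exchange_big /= big_seq [RHS]big_seq; apply: eq_bigr => r rs.
  rewrite bsP ?map_f// mulr_suml mulr_sumr; apply: eq_bigr => b _; ring.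
by apply: sumr_ge0 => b _.
Qed.

Lemma rposdefD K L : rposdef K -> rposdef L ->
  rposdef (fun x y => K x y + L x y).
Proof.
move=> [Ksym Kge0] [Lsym Lge0]; split=> [x y|s]; first by rewrite Ksym Lsym.
have -> : rform (fun x y => K x y + L x y) s s = rform K s s + rform L s s.
  rewrite /rform -big_split; apply: eq_bigr => p _.
  by rewrite -big_split; apply: eq_bigr => r _; exact: mulrDr.
by rewrite addr_ge0.
Qed.

Lemma rposdef_congr K (f : A -> R) : rposdef K ->
  rposdef (fun x y => f x * f y * K x y).
Proof.
move=> [Ksym Kge0]; split=> [x y|s]; first by rewrite Ksym [f x * _]mulrC.
have := Kge0 [seq (p.1 * f p.2, p.2) | p <- s].
congr (0 <= _); rewrite /rform big_map; apply: eq_bigr => p _.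
by rewrite big_map; apply: eq_bigr => r _ /=; ring.
Qed.

Lemma rposdef_cst c : 0 <= c -> rposdef (fun _ _ => c).
Proof.
move=> c0; split=> // s.
rewrite (_ : rform _ s s = c * (\sum_(p <- s) p.1) ^+ 2).
  by rewrite mulr_ge0// sqr_ge0.
rewrite /rform expr2 mulr_suml mulr_sumr; apply: eq_bigr => p _.
by rewrite !mulr_sumr; apply: eq_bigr => r _; ring.
Qed.

Lemma rposdefZ c K : 0 <= c -> rposdef K -> rposdef (fun x y => c * K x y).
Proof. by move=> c0; apply: rposdefM; exact: rposdef_cst. Qed.

Lemma rposdefX K n : rposdef K -> rposdef (fun x y => K x y ^+ n).
Proof.
move=> Kpos; elim: n => [|n IH]; first exact: rposdef_cst.
have -> : (fun x y => K x y ^+ n.+1) = (fun x y => K x y * K x y ^+ n).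
  by apply/funext => x; apply/funext => y; rewrite exprS.
exact: rposdefM.
Qed.

Lemma rposdef_lim (K : nat -> A -> A -> R) L : (forall n, rposdef (K n)) ->
  (forall x y, (fun n => K n x y) @ \oo --> L x y) -> rposdef L.
Proof.
move=> Kpos KL; split=> [x y|s].
  apply: cvgr_unique (KL x y) _.
  by apply: eq_cvg_seq (KL y x) => n; exact: (Kpos n).1.
have cv : rform (K n) s s @[n --> \oo] --> rform L s s.
  by apply: cvg_sumr => p; apply: cvg_sumr => r; apply: cvgMl_tmp; exact: KL.
rewrite -(cvg_lim _ cv)//; apply: limr_ge; first exact: cvgP cv.
by apply: nearW => n; have [_] := Kpos n; apply.
Qed.

(** Partial sums of the exponential series are combinations of powers with nonnegative coefficients,
    and positivity survives limits. *)
Lemma rposdef_exp K : rposdef K -> rposdef (fun x y => expR (K x y)).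
Proof.
move=> Kpos; apply: (@rposdef_lim (fun n x y => series (exp_coeff (K x y)) n)).
  elim=> [|n IH].
    have -> : (fun x y => series (exp_coeff (K x y)) 0) = (fun _ _ => 0).
      by apply/funext => x; apply/funext => y; rewrite /series /= big_geq.
    exact: rposdef_cst.
  have -> : (fun x y => series (exp_coeff (K x y)) n.+1) =
      (fun x y => series (exp_coeff (K x y)) n + n`!%:R^-1 * K x y ^+ n).
    apply/funext => x; apply/funext => y.
    by rewrite /series /= big_nat_recr//= [_^-1 * _]mulrC.
  apply: rposdefD => //; apply: rposdefZ; first by rewrite invr_ge0.
  exact: rposdefX.
by move=> x y; exact: is_cvg_series_exp_coeff.
Qed.

(** Real and imaginary parts of the coefficients contribute separately, the cross terms cancelling
    by symmetry. *)
Lemma rposdef_complex K : rposdef K -> posdef (fun x y => (K x y)%:C).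
Proof.
move=> Kpos s; pose a := [seq (complex.Re p.1, p.2) | p <- s].
pose b := [seq (complex.Im p.1, p.2) | p <- s].
rewrite (_ : gram _ s s = (rform K a a + rform K b b)%:C +
    'i%C * (rform K b a - rform K a b)%:C).
  by rewrite (rformC b a)// subrr mulr0 addr0 lecR addr_ge0//; apply Kpos.2.
rewrite /gram /rform !big_map -sumrB -big_split /= !rmorph_sum mulr_sumr.
rewrite -big_split; apply: eq_bigr => p _ /=.
rewrite !big_map -sumrB -big_split /= !rmorph_sum mulr_sumr.
rewrite -big_split; apply: eq_bigr => r _ /=.
case: p => -[p1 p2] p3; case: r => -[r1 r2] r3 /=.
by apply/eqP; rewrite eq_complex /=; apply/andP; split; apply/eqP; ring.
Qed.

End RealPosdef.

(** * Property (T) bounds the displacement *)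

Section MeasureKernels.
Variables (R : realType) (d : measure_display) (T : measurableType d).
Variable mu : {measure set T -> \bar R}.

Lemma integrable_indic_fin (A : set T) : measurable A -> (mu A < +oo)%E ->
  mu.-integrable setT (fun x => (\1_A x)%:E).
Proof.
move=> mA Aoo; apply/integrableP; split; first exact/measurable_EFinP.
rewrite (eq_integral (fun x => (\1_A x)%:E)); last first.
  by move=> t _; rewrite gee0_abs// lee_fin.
by rewrite integral_indic// setIT.
Qed.

Lemma measure_fineK (A : set T) : (mu A < +oo)%E -> (fine (mu A))%:E = mu A.
Proof. by move=> Aoo; rewrite fineK// ge0_fin_numE. Qed.

(** The form is the integral of the square of a combination of the indicators of the sets [B i]. *)
Lemma measureI_rposdef (I : eqType) (B : I -> set T) :
  (forall i, measurable (B i)) -> (forall i, mu (B i) < +oo)%E ->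
  rposdef (fun i j => fine (mu (B i `&` B j))).
Proof.
move=> mB Boo; split=> [i j|s]; first by rewrite setIC.
have mBI i j : measurable (B i `&` B j) by exact: measurableI.
have BIoo i j : (mu (B i `&` B j) < +oo)%E.
  by rewrite (le_lt_trans _ (Boo i))// le_measure// ?inE//; exact: subIsetl.
pose ix := [seq (p, r) | p <- s, r <- s].
pose c (i : (R * I) * (R * I)) := i.1.1 * i.2.1.
pose A (i : (R * I) * (R * I)) := B i.1.2 `&` B i.2.2.
have intA i : mu.-integrable setT (fun x => (c i)%:E * (\1_(A i) x)%:E)%E.
  apply: integrableZl => //.
  by apply: integrable_indic_fin; [exact: mBI|exact: BIoo].
rewrite -lee_fin.
have -> : (rform (fun i j => fine (mu (B i `&` B j))) s s)%:E =
    (\int[mu]_x (\sum_(i <- ix) (c i)%:E * (\1_(A i) x)%:E))%E.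
  rewrite integral_sum//; under [RHS]eq_bigr => i _.
    rewrite integralZl//; last first.
      by apply: integrable_indic_fin; [exact: mBI|exact: BIoo].
    rewrite integral_indic//; last exact: mBI.
    rewrite setIT -measure_fineK; last exact: BIoo.
    rewrite -EFinM.
    over.
  by rewrite sumEFin /ix big_allpairs.
apply: integral_ge0 => x _.
under eq_bigr do rewrite -EFinM.
rewrite sumEFin lee_fin /ix big_allpairs /=.
rewrite (_ : \sum_(i <- s) _ = (\sum_(p <- s) p.1 * \1_(B p.2) x) ^+ 2).
  exact: sqr_ge0.
rewrite expr2 mulr_suml; apply: eq_bigr => p _.
rewrite mulr_sumr; apply: eq_bigr => r _.
by rewrite /c /A /= indicI /=; ring.
Qed.

Lemma measureY_fin (A B : set T) : measurable A -> measurable B ->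
  (mu A < +oo)%E -> (mu B < +oo)%E ->
  fine (mu (A `+` B)) =
  fine (mu A) + fine (mu B) - 2 * fine (mu (A `&` B)).
Proof.
move=> mA mB Aoo Boo.
have le (C D : set T) : measurable C -> measurable D -> C `<=` D ->
    (mu D < +oo)%E -> (mu C < +oo)%E.
  by move=> mC mD CD; apply: le_lt_trans; rewrite le_measure// inE.
have D1 : (mu (A `\` B) < +oo)%E.
  by apply: (le _ A) => //; exact: measurableD.
have D2 : (mu (B `\` A) < +oo)%E.
  by apply: (le _ B) => //; exact: measurableD.
have I1 : (mu (A `&` B) < +oo)%E.
  by apply: (le _ A) => //; exact: measurableI.
have e1 : fine (mu A) = fine (mu (A `\` B)) + fine (mu (A `&` B)).
  by rewrite -fineD ?ge0_fin_numE// -measureDI.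
have e2 : fine (mu B) = fine (mu (B `\` A)) + fine (mu (A `&` B)).
  by rewrite setIC -fineD ?ge0_fin_numE// -?measureDI// setIC.
have e3 : fine (mu (A `+` B)) = fine (mu (A `\` B)) + fine (mu (B `\` A)).
  rewrite -fineD ?ge0_fin_numE// setY_def measureU//; try exact: measurableD.
  by apply/seteqP; split=> x //= -[[_ nBx] [Bx _]].
by rewrite e3 e1 e2; ring.
Qed.

End MeasureKernels.

Section ActionCocycle.
Variables (R : realType) (G : groupType) (d : measure_display).
Variables (T : measurableType d) (mu : {measure set T -> \bar R}).
Variables (act : G -> T -> T) (S : set T).
Hypothesis actP : measure_preserving_action mu act.
Hypothesis mS : measurable S.
Hypothesis Soo : forall g, (mu (S `+` (act g @` S)) < +oo)%E.

Let act1 x : act 1%g x = x. Proof. by case: actP. Qed.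
Let actM g h x : act (g * h)%g x = act g (act h x). Proof. by case: actP. Qed.

Let actVK g x : act g^-1%g (act g x) = x.
Proof. by rewrite -actM mulVg. Qed.

Let actKV g x : act g (act g^-1%g x) = x.
Proof. by rewrite -actM mulgV. Qed.

Let image_act g (A : set T) : act g @` A = act g^-1%g @^-1` A.
Proof.
apply/seteqP; split=> [_ [x Ax <-]|x Ax] /=; first by rewrite actVK.
by exists (act g^-1%g x).
Qed.

Let m_act g (A : set T) : measurable A -> measurable (act g @` A).
Proof. by move=> mA; case: actP => _ _ /(_ g _ mA)[]. Qed.

Definition displacement g : R := fine (mu (S `+` (act g @` S))).

Lemma displacement_ge0 g : 0 <= displacement g.
Proof. exact: fine_ge0. Qed.

Lemma displacement1 : displacement 1%g = 0.
Proof.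
rewrite /displacement image_act invg1 (_ : act 1%g @^-1` S = S).
  by rewrite setYK measure0.
by apply/seteqP; split=> x /=; rewrite act1.
Qed.

(** [S] may have infinite measure, so the distance between two translates is expressed through their
    symmetric differences with [S], whose measures are finite. Translation by [h] brings the
    left-hand side to this form. *)
Lemma displacementM g h : displacement (h^-1 * g)%g =
  fine (mu ((S `+` (act g @` S)) `+` (S `+` (act h @` S)))).
Proof.
have [_ _ /(_ h (S `+` act (h^-1 * g)%g @` S)) mp] := actP.
have mD : measurable (S `+` act (h^-1 * g)%g @` S).
  by rewrite setY_def; apply: measurableU; apply: measurableD => //;
    exact: m_act.
rewrite /displacement -(mp mD).2; congr (fine (mu _)).
rewrite [S `+` act g @` S]setYC -setYA [S `+` (S `+` _)]setYA setYK.
rewrite [set0 `+` _]setYC setY0 setYC !image_act !setY_def preimage_setU.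
by congr (_ `|` _); apply/seteqP; split=> x /=; rewrite invgM invgK actM actKV.
Qed.

(** The displacement at [h^-1 * g] is the sum of those at [g] and [h] minus twice the measure of the
    intersection of [B g] and [B h]. The exponential is thus a rank one factor times the exponential
    of a positive definite kernel. *)
Lemma exp_displacement_pd1 (t : R) : 0 <= t ->
  pd1 (fun g => (expR (- (t * displacement g)))%:C).
Proof.
move=> t0; split; last by rewrite displacement1 mulr0 oppr0 expR0.
pose B g := S `+` (act g @` S).
have mB g : measurable (B g).
  by rewrite /B setY_def; apply: measurableU; apply: measurableD => //;
    exact: m_act.
have := measureI_rposdef mB Soo => /(@rposdefZ R _ (2 * t)) Kpos.
have t20 : 0 <= 2 * t by rewrite mulr_ge0.
pose K g h := expR (- (t * displacement g)) * expR (- (t * displacement h)) *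
  expR (2 * t * fine (mu (B g `&` B h))).
have K'pos : rposdef K by exact/rposdef_congr/rposdef_exp/Kpos.
rewrite /posdef_fun (_ : group_kernel _ = fun g h => (K g h)%:C).
  exact: rposdef_complex.
apply/funext => g; apply/funext => h; rewrite /group_kernel.
apply: (congr1 (real_complex R)).
rewrite /K -!expRD displacementM.
rewrite (measureY_fin (mB g) (mB h) (Soo g) (Soo h)); congr (expR _).
by rewrite -/(displacement g) -/(displacement h) /B; ring.
Qed.

End ActionCocycle.

Section PropertyTConsequence.
Variables (R : realType) (G : groupType).
Hypothesis countableG : countable [set: G].
Hypothesis TG : property_T R G.

Lemma enumeration : exists e : nat -> G, forall g, exists n, e n = g.
Proof.
have /countable_injP[f finj] := countableG.
have ex n : exists g, (exists h, f h = n) -> f g = n.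
  have [[h hn]|nh] := pselect (exists h, f h = n); first by exists h.
  by exists 1%g.
have [e eP] := choice ex; exists e => g; exists (f g).
by apply: finj; rewrite ?inE//; apply: eP; exists g.
Qed.

Lemma extreme_isolated : exists (Q : seq G) (delta : R), 0 < delta /\
  forall phi : G -> R[i], extreme_pd1 phi ->
    (forall g, g \in Q -> 1 - complex.Re (phi g) < delta) ->
    forall g, phi g = 1.
Proof.
have [xs [Q [e [finQ e0 QP]]]] := TG (p := trivial_irrep R G) erefl.
have /finite_seqP[Qs QsE] := finQ.
pose M := 1 + \sum_(x <- xs) nsq (x : R[i]).
have M0 : 0 < M by rewrite ltr_wpDr// sumr_ge0// => x _; exact: nsq_ge0.
have xM x : x \in xs -> nsq (x : R[i]) <= M.
  move=> xxs; apply: (@le_trans _ _ (\sum_(y <- xs) nsq (y : R[i]))).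
    apply: (@le_sum_mem _ _ _ (fun y => nsq (y : R[i]))) => // y.
    exact: nsq_ge0.
  by rewrite lerDr.
(* [M] bounds the [nsq x], and [nsq (1 - phi h) <= 2 * (1 - Re (phi h))] because [phi] is bounded by
   1; with this constant each coefficient is within [e / 2]. *)
exists Qs, ((e / (2 * M)) ^+ 2 / 2); split.
  by rewrite divr_gt0// exprn_gt0// divr_gt0// mulr_gt0.
move=> phi ext near_phi g.
have [q [xi phiE]] := extreme_irrep ext.
have : fell_basic xs Q e q.
  (* Coefficients of the trivial representation are constants [nsq x], here compared with
     [nsq x * phi], the coefficient of [x *: xi]. *)
  move=> x xxs; exists [:: (x : R[i]) *: xi] => h Qh.
  rewrite big_seq1.
  have -> : coefficient x h = (nsq (x : R[i]))%:C by rewrite -mulCconj.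
  have -> : coefficient ((x : R[i]) *: xi) h =
      (nsq (x : R[i]))%:C * phi h.
    rewrite /coefficient (_ : q h (_ *: _) = (x : R[i]) *: q h xi).
      by rewrite innerZl innerZr phiE mulrA mulCconj.
    exact: linearZ.
  rewrite -[X in X - _]mulr1 -mulrBr normrM !normc_nsq -rmorphM/= ltcR.
  rewrite nsqR sqrtr_sqr ger0_norm ?nsq_ge0//.
  have hQ : h \in Qs by move: Qh; rewrite QsE.
  have n1 : nsq (1 - phi h) <= 2 * (1 - complex.Re (phi h)).
    have := pd1_le1 h ext.1; rewrite /nsq raddfB raddfB /=.
    by case: (phi h) => u v /=; nra.
  have n2 : nsq (1 - phi h) < (e / (2 * M)) ^+ 2.
    by have := near_phi h hQ; lra.
  have n3 : Num.sqrt (nsq (1 - phi h)) <= e / (2 * M).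
    rewrite -[leRHS]ger0_norm; last by rewrite divr_ge0 ?ltW// mulr_gt0.
    by rewrite -sqrtr_sqr ler_wsqrtr// ltW.
  rewrite (@le_lt_trans _ _ (M * (e / (2 * M))))//.
    by rewrite ler_pM ?nsq_ge0 ?sqrtr_ge0 ?xM.
  have -> : M * (e / (2 * M)) = e / 2 by field; rewrite gt_eqF.
  lra.
move=> /QP /dual_classP[U [Ubij Uinner UG]].
rewrite -phiE -Uinner UG /= Uinner.
by rewrite -[X in inner _ X _](rep1 q) phiE; have [[]] := ext.
Qed.

Lemma pd1_uniform : exists (Q : seq G) (delta : R), 0 < delta /\
  forall psi : G -> R[i], pd1 psi -> forall h,
    delta * (1 - complex.Re (psi h)) <=
      2 * \sum_(g <- Q) (1 - complex.Re (psi g)).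
Proof.
have [Q [delta [delta0 QP]]] := extreme_isolated.
have [e eP] := enumeration.
exists Q, delta; split=> // psi psi1 h.
(* The functional is the right-hand side minus the left-hand side; the terms at [1%g] supply the
   constants, as [phi 1%g = 1]. *)
pose ws : seq (R * G) := flatten [seq [:: (2, 1%g); (- 2, g)] | g <- Q] ++
  [:: (- delta, 1%g); (delta, h)].
have wsE phi : pd1 phi -> pd_functional ws phi =
    2 * \sum_(g <- Q) (1 - complex.Re (phi g)) -
    delta * (1 - complex.Re (phi h)).
  move=> [_ phi1]; rewrite /pd_functional /ws big_cat big_flatten big_map /=.
  rewrite !big_cons big_nil /= phi1 mulr_sumr; congr (_ + _);
    last by rewrite /=; ring.
  by apply: eq_bigr => g _; rewrite !big_cons big_nil /= phi1 /=; ring.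
have [phi ext phi_min] := extreme_minimum eP ws.
have re1 (x : R[i]) : nsq x <= 1 -> complex.Re x <= 1 /\ -1 <= complex.Re x.
  by move=> /re_le_nsq; rewrite ler_norml => /andP[].
have := phi_min psi psi1; rewrite !wsE//; last exact: ext.1.
suff : 0 <= 2 * \sum_(g <- Q) (1 - complex.Re (phi g)) -
    delta * (1 - complex.Re (phi h)) by lra.
have pos g : 0 <= 1 - complex.Re (phi g).
  by have [] := re1 _ (pd1_le1 g ext.1); lra.
(* Either the minimizer is close to 1 on [Q], hence constant, and the functional is 0; or some [g]
   in [Q] contributes [delta], which suffices because [1 - Re (phi h) <= 2]. *)
have [small|/existsNP[g /not_implyP[gQ]]] :=
    pselect (forall g, g \in Q -> 1 - complex.Re (phi g) < delta).
  have phi1 := QP _ ext small.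
  by rewrite phi1 /= subrr mulr0 subr0 mulr_ge0// sumr_ge0.
move=> /negP; rewrite -leNgt => big_g.
have : delta <= \sum_(g <- Q) (1 - complex.Re (phi g)).
  by apply: (le_trans big_g);
    apply: (@le_sum_mem _ _ _ (fun g => 1 - complex.Re (phi g))).
have [_ h2] := re1 _ (pd1_le1 h ext.1).
have : delta * (1 - complex.Re (phi h)) <= delta * 2.
  by rewrite ler_pM2l//; lra.
lra.
Qed.

Lemma property_T_bounded (d : measure_display) (T : measurableType d)
    (mu : {measure set T -> \bar R}) (act : G -> T -> T) (S : set T) :
  measure_preserving_action mu act -> measurable S ->
  (forall g : G, mu (S `+` (act g @` S)) < +oo)%E ->
  (ereal_sup [set mu (S `+` (act g @` S)) | g in [set: G]] < +oo)%E.
Proof.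
move=> actP mS Soo; have [Q [delta [delta0 QP]]] := pd1_uniform.
pose D := displacement mu act S.
have D0 g : 0 <= D g by exact: displacement_ge0.
pose m := \sum_(g <- Q) D g.
have m0 : 0 <= m by rewrite sumr_ge0.
(* Then [2 * t * m <= delta / 2], so [expR (- (t * D g)) >= 1 / 2] and
   [1 + t * D g <= expR (t * D g) <= 2]. The summand 1 allows [m = 0]. *)
pose t := delta / (4 * (m + 1)).
have t0 : 0 < t by rewrite divr_gt0// mulr_gt0// ltr_wpDl.
have bound g : D g <= t^-1.
  have := QP _ (exp_displacement_pd1 actP mS Soo (ltW t0)) g.
  rewrite /= -/D => h.
  have h1 : \sum_(g <- Q) (1 - expR (- (t * D g))) <= t * m.
    rewrite /m mulr_sumr; apply: ler_sum => k _.
    by have := expR_ge1Dx (- (t * D k)); lra.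
  have h2 : t * m <= delta / 4.
    rewrite /t mulrAC ler_pdivrMr ?mulr_gt0 ?ltr_wpDl//.
    have -> : delta / 4 * (4 * (m + 1)) = delta * (m + 1) by field.
    by rewrite ler_pM2l//; lra.
  have h3 : delta * (1 - expR (- (t * D g))) <= delta * 2^-1 by lra.
  rewrite ler_pM2l// in h3.
  have h4 : 2^-1 <= expR (- (t * D g)) by lra.
  have h5 : expR (t * D g) <= 2.
    by rewrite -[leRHS]invrK -[expR _]invrK lef_pV2 ?posrE ?invr_gt0 ?expR_gt0//
      -expRN.
  have h6 := expR_ge1Dx (t * D g).
  by rewrite -(ler_pM2l t0) divff ?gt_eqF//; lra.
apply: (@le_lt_trans _ _ (t^-1)%:E); last exact: ltry.
apply: ge_ereal_sup => _ [g _ <-].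
by rewrite -measure_fineK// lee_fin; exact: bound.
Qed.

End PropertyTConsequence.

(** * Almost invariant vectors *)

Section InvariantVectors.
Variables (R : realType) (G : groupType).

Lemma almost_invariant_fixed (H : hilbertSpace R) (pi : unitaryRep G H)
    (xi : H) : hnorm2 xi = 1 ->
  (forall g, 2^-1 <= complex.Re (inner H (pi g xi) xi)) ->
  exists2 x : H, x != 0 & forall g, pi g x = x.
Proof.
move=> xi1 xig.
(* C is invariant, so its unique element of minimal norm is fixed. *)
pose C := [set y | forall g, 2^-1 <= complex.Re (inner H y (pi g xi))].
have Cxi g : C (pi g xi).
  by move=> h; have := xig (h^-1 * g)%g; rewrite repM rep_inner_adj invgK.
have mC : midconvex C.
  move=> x y Cx Cy g; rewrite innerZl innerDl complex_ReM /= mul0r subr0.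
  rewrite raddfD /=.
  by have := Cx g; have := Cy g; lra.
have clC : closed C.
  apply: approx_closed => x app g; apply/ler_addgt0Pr => e e0.
  have [y Cy xy] := app (e ^+ 2) (exprn_gt0 2 e0).
  have := re_inner_CS (y - x) (pi g xi).
  rewrite {2}/hnorm2 rep_unitary -/(hnorm2 xi) xi1 mulr1 hnorm2C => cs.
  have : complex.Re (inner H (y - x) (pi g xi)) <= e.
    rewrite (le_trans (ler_norm _))// -(@ler_pXn2r _ 2)// ?nnegrE ?(ltW e0)//.
    by rewrite real_normK ?num_real// (le_trans cs).
  by rewrite innerBl raddfB /=; have := Cy g; lra.
have C0 : C !=set0 by exists (pi 1%g xi).
have [x Cx xmin] := min_norm_exists mC clC C0.
have CG g : C (pi g x).
  by move=> h; rewrite rep_inner_adj -repM; exact: Cx.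
have hpi g : hnorm2 (pi g x) = hnorm2 x by rewrite /hnorm2 rep_unitary.
exists x.
  apply: contraTneq isT => x0; have := Cx 1%g; rewrite x0 inner0l /=.
  by rewrite leNgt invr_gt0 ltr0n.
move=> g; have := midpoint_bound mC xmin (CG g) Cx.
rewrite hpi subrr mulr0 addr0 => h.
by apply/eqP; rewrite -subr_eq0 -hnorm2_eq0 eq_le h hnorm2_ge0.
Qed.

(** Irreducibility is used twice: the closed subspace of fixed vectors is everything, and then the
    orthogonal complement of [x], now invariant, is 0. So the space is the line of [x]. *)
Lemma fixed_vector_trivial (q : irrep R G) (x : irrep_space q) : x != 0 ->
  (forall g, q g x = x) -> unitarily_equivalent q (trivial_irrep R G).
Proof.
move=> x0 xfix; have [_ irr] := irrep_irreducible q.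
set H := irrep_space q in x x0 xfix irr *.
have hq g (y : H) : hnorm2 (q g y) = hnorm2 y by rewrite /hnorm2 rep_unitary.
have qB g (y z : H) : q g (y - z) = q g y - q g z by exact: linearB.
have qZ g a (y : H) : q g (a *: y) = a *: q g y by exact: linearZ.
have qD g (y z : H) : q g (y + z) = q g y + q g z by exact: linearD.
have allfix g (y : H) : q g y = y.
  pose V := [set y : H | forall g, q g y = y].
  have Vsub : closed_subspace V.
    split=> [k|a u v Vu Vv k|]; first exact: linear0.
      by rewrite qD qZ Vu Vv.
    apply: approx_closed => u app k; apply/eqP; rewrite -subr_eq0 -hnorm2_eq0.
    rewrite eq_le hnorm2_ge0 andbT; apply/ler_addgt0Pr => e e0; rewrite add0r.
    have e4 : 0 < e / 4 by rewrite divr_gt0.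
    have [v Vv uv] := app _ e4.
    have -> : q k u - u = q k (u - v) + (v - u).
      by rewrite qB Vv addrA subrK.
    rewrite (le_trans (hnorm2D_le _ _))// hq [hnorm2 (v - u)]hnorm2C; lra.
  have [|V0|VT] := irr V Vsub.
  - by move=> k u Vu k'; rewrite Vu Vu.
  - have : V x by exact: xfix.
    by rewrite V0 /= => /eqP; rewrite (negbTE x0).
  - have : V y by rewrite VT.
    exact.
have span (y : H) : y = (inner H y x / (hnorm2 x)%:C) *: x.
  pose W := [set z : H | inner H z x = 0].
  have Wsub : closed_subspace W.
    split=> [|a u v|]; first exact: inner0l.
      by rewrite /W /= innerDl innerZl => -> ->; rewrite mulr0 addr0.
    apply: approx_closed => u app; rewrite /W /=.
    suff : nsq (inner H u x) == 0 by rewrite nsq_eq0 => /eqP.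
    rewrite eq_le nsq_ge0 andbT; apply/ler_addgt0Pr => e e0; rewrite add0r.
    have n0 := hnorm2_ge0 x.
    have e1 : 0 < e / (hnorm2 x + 1) by rewrite divr_gt0// ltr_wpDl.
    have [v Wv uv] := app _ e1.
    have -> : inner H u x = inner H (u - v) x by rewrite innerBl Wv subr0.
    rewrite (le_trans (inner_CS _ _))//.
    rewrite (@le_trans _ _ (e / (hnorm2 x + 1) * (hnorm2 x + 1)))//.
      by rewrite ler_pM ?hnorm2_ge0// lerDl.
    by rewrite divfK// gt_eqF// ltr_wpDl.
  have hx : (hnorm2 x)%:C != 0 :> R[i].
    by rewrite -hnorm2E -inner_norm expf_neq0// normr_eq0.
  have [|W0|WT] := irr W Wsub.
  - by move=> k u Wu; rewrite allfix.
  - have : W (y - (inner H y x / (hnorm2 x)%:C) *: x).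
      by rewrite /W /= innerBl innerZl hnorm2E divfK// subrr.
    by rewrite W0 /= => /eqP; rewrite subr_eq0 => /eqP.
  - have : W x by rewrite WT.
    by rewrite /W /= hnorm2E => /eqP; rewrite (negbTE hx).
apply: unitarily_equivalent_sym.
pose c : R[i] := ((Num.sqrt (hnorm2 x))^-1)%:C.
have hx1 : hnorm2 (c *: x) = 1.
  rewrite hnorm2Z nsqR exprVn sqr_sqrtr ?hnorm2_ge0// mulVf//.
  by rewrite hnorm2_eq0.
pose U (a : complex_hilbert R) : H := (a : R[i]) *: (c *: x).
have Ulin : linear U by move=> a u v; rewrite /U scalerDl -scalerA.
pose UL : {linear complex_hilbert R -> H} :=
  HB.pack U (GRing.isLinear.Build R[i] (complex_hilbert R) H *:%R U Ulin).
exists UL; split.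
- exists (fun y => inner H y (c *: x) : complex_hilbert R) => y /=.
    by rewrite /U innerZl hnorm2E hx1 mulr1.
  rewrite /U innerZr scalerA [RHS](span y); congr (_ *: _).
  rewrite mulrAC [_ * c]mulrC mulCconj nsqR exprVn sqr_sqrtr ?hnorm2_ge0//.
  by rewrite mulrC fmorphV.
- move=> u v /=; rewrite /U innerZl innerZr hnorm2E hx1 mulr1.
  by [].
- by move=> g u /=; rewrite allfix.
Qed.

End InvariantVectors.

Section NotPropertyT.
Variables (R : realType) (G : groupType).

Lemma normalize_vector (H : hilbertSpace R) (y : H) : 0 < hnorm2 y ->
  exists2 x : H, hnorm2 x = 1 & forall (pi : unitaryRep G H) g,
    inner H (pi g x) x = ((hnorm2 y)^-1)%:C * inner H (pi g y) y.
Proof.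
move=> y0; pose c : R[i] := ((Num.sqrt (hnorm2 y))^-1)%:C.
have c2 : nsq c = (hnorm2 y)^-1.
  by rewrite nsqR exprVn sqr_sqrtr// ltW.
exists (c *: y); first by rewrite hnorm2Z c2 mulVf// gt_eqF.
move=> pi g; rewrite (_ : pi g (c *: y) = c *: pi g y); last exact: linearZ.
by rewrite innerZl innerZr mulrA mulCconj c2.
Qed.

(** If there were no such vector, some Fell neighbourhood of the trivial representation would
    contain only its class: a representation there has an almost [Q]-invariant unit vector, whose
    displacements would all have squared norm below 1, and [almost_invariant_fixed] would give a
    fixed vector. *)
Lemma not_property_T_vectors : ~ property_T R G ->
  forall (Q : seq G) (e : R), 0 < e ->
  exists (H : hilbertSpace R) (pi : unitaryRep G H) (x : H),
    [/\ hnorm2 x = 1,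
        forall g, g \in Q -> hnorm2 (pi g x - x) <= e &
        exists g, 1 <= hnorm2 (pi g x - x)].
Proof.
move=> nT Q e e0; apply: contrapT => none; apply: nT => p pE.
have /dual_classP[U [Ubij Uinner UG]] := pE.
have [V UK VK] := Ubij.
pose x0 : irrep_space p := V (1 : R[i]).
have x0E g : coefficient x0 g = 1.
  rewrite /coefficient -Uinner UG /x0 VK /=.
  by rewrite /complex_inner rmorph1 mulr1.
pose n : R := (size Q)%:R + 1.
have n0 : 0 < n by rewrite ltr_wpDl.
(* The bound 1/2 leaves total mass at least 1/2 in [ys]; [8 * d * n <= e] is what the normalized
   vector requires. The 1 in [n] makes the averaging below strict. *)
pose d := Num.min 2^-1 (e / (8 * n)).
have d0 : 0 < d by rewrite lt_min invr_gt0 ltr0n divr_gt0// mulr_gt0.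
exists [:: x0], [set` 1%g :: Q], d; split=> //; first exact: finite_seq.
move=> q near_q; apply/dual_classP.
have [|ys ysP] := near_q x0; first by rewrite mem_head.
have {}ysP g : g \in 1%g :: Q ->
    `|1 - \sum_(y <- ys) complex.Re (inner _ (q g y) y)| < d.
  move=> gQ; have := ysP g gQ; rewrite x0E => h.
  rewrite -ltcR (le_lt_trans _ h)//.
  rewrite (_ : \sum_(y <- ys) complex.Re _ =
    complex.Re (\sum_(y <- ys) coefficient y g)); last by rewrite raddf_sum.
  have := normc_ge_Re (1 - \sum_(y <- ys) coefficient y g).
  by rewrite raddfB.
have mass : 2^-1 <= \sum_(y <- ys) hnorm2 y.
  have := ysP 1%g (mem_head _ _).
  under eq_bigr do rewrite rep1 -/(hnorm2 _).
  rewrite ltr_norml => /andP[_].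
  have : d <= 2^-1 by rewrite /d ge_min lexx.
  lra.
have defect g : g \in Q ->
    \sum_(y <- ys) (hnorm2 y - complex.Re (inner _ (q g y) y)) <= 2 * d.
  move=> gQ; rewrite sumrB.
  have := ysP g; rewrite inE gQ orbT => /(_ isT).
  have := ysP 1%g (mem_head _ _).
  under eq_bigr do rewrite rep1 -/(hnorm2 _).
  by rewrite !ltr_norml => /andP[h1 h2] /andP[h3 h4]; lra.
have pos g (y : irrep_space q) :
    0 <= hnorm2 y - complex.Re (inner _ (q g y) y).
  have := hnorm2_ge0 (q g y - y); rewrite hnorm2B.
  by rewrite {1}/hnorm2 rep_unitary -/(hnorm2 y); lra.
pose D y := \sum_(g <- Q) (hnorm2 y - complex.Re (inner _ (q g y) y)).
have D0 y : 0 <= D y by rewrite sumr_ge0.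
have sumD : \sum_(y <- ys) D y <= 2 * d * (size Q)%:R.
  rewrite /D exchange_big /= (_ : _ * _ = \sum_(g <- Q) 2 * d); last first.
    by rewrite big_const_seq count_predT iter_addr_0 mulr_natr.
  by rewrite big_seq [leRHS]big_seq; apply: ler_sum => g; exact: defect.
(* Averaging: if every nonzero [y] had a larger relative defect, summation would contradict [sumD]
   and [mass]. *)
have [y [y0 yD]] : exists y : irrep_space q, 0 < hnorm2 y /\
    D y <= 4 * d * n * hnorm2 y.
  apply: contrapT => noy.
  have : 4 * d * n * \sum_(y <- ys) hnorm2 y <= \sum_(y <- ys) D y.
    rewrite mulr_sumr; apply: ler_sum => y _.
    have := hnorm2_ge0 y; rewrite le_eqVlt => /orP[/eqP <-|y0].
      by rewrite mulr0.
    rewrite leNgt; apply/negP => /ltW h; apply: noy; by exists y.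
  have : 4 * d * n * 2^-1 <= 4 * d * n * \sum_(y <- ys) hnorm2 y.
    by rewrite ler_pM2l// !mulr_gt0.
  have : 2 * d * (size Q)%:R < 4 * d * n * 2^-1.
    have -> : 4 * d * n * 2^-1 = 2 * d * n by field.
    by rewrite ltr_pM2l ?mulr_gt0// /n ltrDl.
  lra.
have [xi xi1 xiE] := normalize_vector y0.
have hdisp g : hnorm2 (q g xi - xi) =
    2 - 2 * complex.Re (inner _ (q g xi) xi).
  by rewrite hnorm2B {1}/hnorm2 rep_unitary -/(hnorm2 xi) xi1; ring.
have xiQ g : g \in Q -> hnorm2 (q g xi - xi) <= e.
  move=> gQ; rewrite hdisp xiE complex_ReM /= mul0r subr0.
  have Dg : hnorm2 y - complex.Re (inner _ (q g y) y) <= 4 * d * n * hnorm2 y.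
    apply: le_trans yD; apply: (@le_sum_mem _ _ _
      (fun g => hnorm2 y - complex.Re (inner _ (q g y) y))) => // k.
  have h1 : 1 - (hnorm2 y)^-1 * complex.Re (inner _ (q g y) y) <= 4 * d * n.
    have -> : 1 - (hnorm2 y)^-1 * complex.Re (inner _ (q g y) y) =
      (hnorm2 y - complex.Re (inner _ (q g y) y)) / hnorm2 y.
      by field; rewrite gt_eqF.
    by rewrite ler_pdivrMr.
  have h2 : 8 * d * n <= e.
    have : d <= e / (8 * n) by rewrite /d ge_min lexx orbT.
    rewrite ler_pdivlMr ?mulr_gt0//; lra.
  lra.
have [[g big_g]|small] := pselect (exists g, 1 <= hnorm2 (q g xi - xi)).
  exfalso; apply: none; exists (irrep_space q), q, xi; split=> //.
  by exists g.
have [g|x x_neq0 xfix] := almost_invariant_fixed (pi := irrep_rep q) xi1.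
  rewrite leNgt; apply/negP => h; apply: small; exists g.
  by rewrite hdisp; lra.
exact: fixed_vector_trivial x_neq0 xfix.
Qed.

End NotPropertyT.

(** * Invariant processes with values in Z/N *)

Section PositiveFunctions.
Variables (R : realType) (A : zmodType).
Implicit Types (psi : A -> R[i]) (u v : A).

Definition pdfun psi := posdef (fun u v => psi (u - v)).

Lemma pdfun_ge0 psi : pdfun psi -> 0 <= psi 0.
Proof.
by move=> /(_ [:: (1, 0)]); rewrite gram_seq1 rmorph1 !mul1r subrr.
Qed.

Lemma pdfun_sum I (r : seq I) (P : pred I) (F : I -> A -> R[i]) :
  (forall i, P i -> pdfun (F i)) -> pdfun (fun u => \sum_(i <- r | P i) F i u).
Proof.
move=> Fpos s; rewrite (_ : gram _ s s =
    \sum_(i <- r | P i) gram (fun u v => F i (u - v)) s s).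
  by apply: sumr_ge0 => i /Fpos; apply.
rewrite /gram [RHS]exchange_big; apply: eq_bigr => p _.
rewrite [RHS]exchange_big; apply: eq_bigr => t _; exact: mulr_sumr.
Qed.

Variable N : nat.
Implicit Types (k : 'I_N -> 'I_N -> R[i]) (z : 'I_N -> R[i]).

(* For k the rank one form of a unit vector z of C^N, this is the value at u of
   the positive definite function compressed along v by the projection on z. *)
Definition compress k v psi u : R[i] :=
  \sum_(a < N) \sum_(b < N) k a b * psi (u + v *+ a - v *+ b).

(** The form at [s] is that of [psi] at the points [p.2 + v *+ a] with weights [p.1 * z a]. *)
Lemma compress_rank1 z v psi : pdfun psi ->
  pdfun (compress (fun a b => z a * Num.conj (z b)) v psi).
Proof.
move=> psi_pos s.
rewrite (_ : gram _ s s = gram (fun u v => psi (u - v))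
    [seq (p.1 * z a, p.2 + v *+ a) | p <- s, a <- enum 'I_N]
    [seq (p.1 * z a, p.2 + v *+ a) | p <- s, a <- enum 'I_N]).
  exact: psi_pos.
rewrite /gram big_allpairs_dep; apply: eq_bigr => p _.
rewrite big_enum /=.
under [RHS]eq_bigr do rewrite big_allpairs_dep.
rewrite [RHS]exchange_big; apply: eq_bigr => r _.
rewrite /compress mulr_sumr; apply: eq_bigr => a _.
rewrite big_enum /= mulr_sumr; apply: eq_bigr => b _.
rewrite rmorphM /= (_ : p.2 - r.2 + v *+ a - v *+ b =
  p.2 + v *+ a - (r.2 + v *+ b)); first by ring.
by rewrite opprD addrA (addrAC p.2).
Qed.

Lemma compressC k1 k2 v1 v2 psi :
  compress k1 v1 (compress k2 v2 psi) = compress k2 v2 (compress k1 v1 psi).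
Proof.
apply/funext => u; rewrite /compress.
under eq_bigr => a _ do under eq_bigr => b _ do rewrite mulr_sumr.
under [RHS]eq_bigr => a _ do under eq_bigr => b _ do rewrite mulr_sumr.
under eq_bigr => a _ do rewrite exchange_big.
rewrite exchange_big /=; apply: eq_bigr => c _.
under eq_bigr => a _ do
  under eq_bigr => b _ do rewrite mulr_sumr.
under [RHS]eq_bigr => a _ do
  under eq_bigr => b _ do rewrite mulr_sumr.
under eq_bigr => a _ do rewrite exchange_big.
rewrite exchange_big /=; apply: eq_bigr => d _.
apply: eq_bigr => a _; apply: eq_bigr => b _.
rewrite mulrCA; congr (_ * (_ * psi _)).
rewrite -!addrA; congr (u + _).
by rewrite addrA [RHS]addrA addrC.
Qed.

Lemma eq_compress k1 k2 v psi : (forall a b, k1 a b = k2 a b) ->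
  compress k1 v psi = compress k2 v psi.
Proof.
move=> e; apply/funext => u; apply: eq_bigr => a _; apply: eq_bigr => b _.
by rewrite e.
Qed.

Lemma compress_sum I (r : seq I) (P : pred I) (k : I -> 'I_N -> 'I_N -> R[i])
    v psi u : compress (fun a b => \sum_(i <- r | P i) k i a b) v psi u =
  \sum_(i <- r | P i) compress (k i) v psi u.
Proof.
rewrite /compress [RHS]exchange_big; apply: eq_bigr => a _.
by rewrite [RHS]exchange_big; apply: eq_bigr => b _; rewrite mulr_suml.
Qed.

Lemma compress_diag v psi : (0 < N)%N ->
  compress (fun a b => (a == b)%:R / N%:R) v psi = psi.
Proof.
move=> N0; apply/funext => u; rewrite /compress.
under eq_bigr => a _.
  rewrite (bigD1 a)//= eqxx mul1r addrK big1 ?addr0; first over.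
  by move=> b ba; rewrite eq_sym (negbTE ba) mul0r mul0r.
rewrite sumr_const card_ord -[LHS]mulr_natl mulrA divff ?mul1r//.
by rewrite pnatr_eq0 -lt0n.
Qed.

Lemma compressDl k1 k2 v psi u :
  compress (fun a b => k1 a b + k2 a b) v psi u =
  compress k1 v psi u + compress k2 v psi u.
Proof.
rewrite /compress -big_split; apply: eq_bigr => a _ /=.
by rewrite -big_split; apply: eq_bigr => b _; exact: mulrDl.
Qed.

Lemma compress_sumr I (r : seq I) (P : pred I) k v (F : I -> A -> R[i]) u :
  compress k v (fun w => \sum_(i <- r | P i) F i w) u =
  \sum_(i <- r | P i) compress k v (F i) u.
Proof.
rewrite /compress [RHS]exchange_big; apply: eq_bigr => a _.
by rewrite [RHS]exchange_big; apply: eq_bigr => b _; rewrite mulr_sumr.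
Qed.

End PositiveFunctions.

Section RootsOfUnity.
Variable R : realType.

Lemma complex_prim_root_exists n : (0 < n)%N ->
  exists z : R[i], n.-primitive_root z.
Proof.
move=> n0; pose p : {poly R[i]} := 'X^n - 1.
have [r Dp] := closed_field_poly_normal p.
move: Dp; rewrite (monicP _) ?monicXnsubC// scale1r => Dp.
have rn1 : all n.-unity_root r.
  by apply/allP => z; rewrite -root_prod_XsubC -Dp.
have sz_r : (n < (size r).+1)%N.
  by rewrite -(size_prod_XsubC r id) -Dp size_XnsubC.
have [|z zr zn] := hasP (cyclic.has_prim_root n0 rn1 _ sz_r); last by exists z.
rewrite -separable.separable_prod_XsubC -Dp /p.
apply: cyclotomic.separable_Xn_sub_1.
by rewrite pnatr_eq0 -lt0n.
Qed.

Variables (n : nat) (z : R[i]).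
Hypothesis n0 : (0 < n)%N.
Hypothesis zn : n.-primitive_root z.

Lemma prim_root_norm k : `|z ^+ k| = 1.
Proof.
rewrite normrX; have : `|z| ^+ n = 1.
  by rewrite -normrX (prim_expr_order zn) normr1.
move=> /eqP; rewrite pexpr_eq1// => /eqP ->.
by rewrite expr1n.
Qed.

Lemma prim_root_conj k : z ^+ k * Num.conj (z ^+ k) = 1.
Proof. by rewrite -normCK prim_root_norm expr1n. Qed.

Lemma prim_root_sum k l : \sum_(x < n) z ^+ (k * x) * Num.conj (z ^+ (l * x)) =
  if k == l %[mod n] then n%:R else 0.
Proof.
pose w := z ^+ k * Num.conj (z ^+ l).
have wE (x : nat) : z ^+ (k * x) * Num.conj (z ^+ (l * x)) = w ^+ x.
  by rewrite /w exprMn -rmorphXn /= -!exprM.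
under eq_bigr do rewrite wE.
have w1 : (w == 1) = (k == l %[mod n]).
  rewrite -(eq_prim_root_expr zn) -[1](prim_root_conj l) /w.
  apply/eqP/eqP => [|->//] /(congr1 ( *%R^~ (z ^+ l))).
  by rewrite -!mulrA [_ * z ^+ l]mulrC prim_root_conj !mulr1.
rewrite -w1; have [->|w1'] := eqVneq w 1.
  by under eq_bigr do rewrite expr1n; rewrite sumr_const card_ord.
have := subrX1 w n.
have -> : w ^+ n = 1.
  by rewrite /w exprMn -rmorphXn /= -!exprM ![(_ * n)%N]mulnC !exprM
    (prim_expr_order zn) !expr1n rmorph1 mulr1.
rewrite subrr => /esym/eqP; rewrite mulf_eq0 subr_eq0 (negbTE w1') /=.
by move/eqP.
Qed.

End RootsOfUnity.

(** * Cuts of the unit circle by half-planes *)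

Section Thresholds.
Variable R : realType.

Lemma sum_threshold1 (n B : nat) : (n <= B)%N ->
  \sum_(j < B) ((j < n)%N%:R : R) = n%:R.
Proof.
move=> nB; rewrite -(big_mkord xpredT (fun j => (j < n)%N%:R)).
rewrite (big_cat_nat (leq0n n) nB) /= big_nat (eq_bigr (fun=> 1)); last first.
  by move=> j /andP[_ ->].
rewrite -big_nat sumr_const_nat subn0 big_nat big1 ?addr0// => j /andP[nj _].
by rewrite ltnNge nj.
Qed.

(** A discrete layer-cake formula: the distance of two integers counts the thresholds separating
    them. *)
Lemma sum_threshold (m n B : nat) : (m <= B)%N -> (n <= B)%N ->
  \sum_(j < B) (((j < m) != (j < n))%N%:R : R) = `|m%:R - n%:R|.
Proof.
wlog mn : m n / (m <= n)%N.
  move=> h mB nB; case/orP: (leq_total m n) => mn; first exact: h.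
  by rewrite distrC -h//; apply: eq_bigr => j _; rewrite eq_sym.
move=> mB nB; rewrite distrC ger0_norm ?subr_ge0 ?ler_nat//.
rewrite -(sum_threshold1 nB) -(sum_threshold1 mB) -sumrB.
apply: eq_bigr => j _; have [jm|jm] := ltnP j m.
  by rewrite (leq_trans jm mn) subrr.
by rewrite subr0; case: ltnP.
Qed.

Lemma truncn_dist (a b : R) : 0 <= a -> 0 <= b ->
  let d : R := `|(Num.truncn a)%:R - (Num.truncn b)%:R| in
  d <= `|a - b| + 1 /\ `|a - b| <= d + 1.
Proof.
move=> a0 b0; have := truncn_le a; have := truncn_le b; rewrite a0 b0 => h1 h2.
have := truncnS_gt a; have := truncnS_gt b; rewrite -!natr1 => h3 h4 /=.
split.
  rewrite ler_norml; apply/andP; split.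
    by have : b - a <= `|a - b| by [rewrite distrC ler_norm]; lra.
  by have : a - b <= `|a - b| by [rewrite ler_norm]; lra.
set m := (Num.truncn a)%:R in h2 h4 *; set n := (Num.truncn b)%:R in h1 h3 *.
rewrite ler_norml; apply/andP; split.
  by have : n - m <= `|m - n| by [rewrite distrC ler_norm]; lra.
by have : m - n <= `|m - n| by [rewrite ler_norm]; lra.
Qed.

Definition cut_mass N (D : pred 'I_N) (P : 'I_N -> 'I_N -> R) : R :=
  \sum_(x < N) \sum_(y < N) (D x != D y)%:R * P x y.

Definition mean_dist N (c : 'I_N -> R[i]) (P : 'I_N -> 'I_N -> R) : R :=
  \sum_(x < N) \sum_(y < N) P x y * nsq (c x - c y).

(* Half-planes {Re > t} and {Im > t} cut two points of the unit circle for a set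
   of thresholds t whose measure is comparable with their distance; averaging
   over t turns a comparison of mean distances into one of cut masses. *)
Lemma cut_exists (q : nat) (e : R) : 0 < e -> exists2 tau : R, 0 < tau &
  forall N (c : 'I_N -> R[i]) (I : eqType) (P : I -> 'I_N -> 'I_N -> R)
    (Q : seq I) (i0 : I), size Q = q ->
  (forall x, nsq (c x) = 1) ->
  (forall i x y, 0 <= P i x y) ->
  (forall i, \sum_(x < N) \sum_(y < N) P i x y = 1) ->
  (forall i, i \in Q -> mean_dist c (P i) <= tau) ->
  2^-1 <= mean_dist c (P i0) ->
  exists2 D : pred 'I_N, 0 < cut_mass D (P i0) &
    \sum_(i <- Q) cut_mass D (P i) <= e * cut_mass D (P i0).
Proof.
(* [tau] may depend only on [q] and [e], as [N] is chosen later in terms of it. [T] makes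
   [q * (M * T) < e * (M / 8)], where [M * T] and [M / 8] bound the total cut masses from above on
   [Q] and from below at [i0]. *)
move=> e0; pose T := e / (8 * (q%:R + 1)).
have q1 : 0 < q%:R + 1 :> R by rewrite ltr_wpDl.
have T0 : 0 < T by rewrite divr_gt0// mulr_gt0.
pose eta := T / 4; have eta0 : 0 < eta by rewrite divr_gt0.
exists (eta * (T / 4)); first by rewrite mulr_gt0// divr_gt0.
move=> N c I P Q i0 sQ c1 P0 P1 small large.
(* There are [m] thresholds per unit length, enough for the rounding error 2 of [wA] to be at most
   [M * (T / 4)] and at most [M / 8]. *)
pose m := (Num.truncn (16 + 8 / T)).+1; pose M : R := m%:R.
have MT : 16 + 8 / T < M by exact: truncnS_gt.
have T80 : 0 < 8 / T by rewrite divr_gt0.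
have M16 : 16 <= M by lra.
have M0 : 0 < M by lra.
have M8 : 2 <= M * (T / 4).
  have : 8 / T <= M by lra.
  by rewrite ler_pdivrMr// => h; lra.
pose part (b : bool) (a : R[i]) := if b then complex.Re a else complex.Im a.
have part1 b x : -1 <= part b (c x) /\ part b (c x) <= 1.
  have h : nsq (c x) <= 1 by rewrite c1.
  apply/andP; rewrite -ler_norml.
  by case: b; [exact: re_le_nsq|exact: im_le_nsq].
pose k b x := Num.truncn (M * (1 + part b (c x))).
pose B := (2 * m).+1.
have arg0 b x : 0 <= M * (1 + part b (c x)).
  by rewrite mulr_ge0 ?(ltW M0)//; have [] := part1 b x; lra.
have kB b x : (k b x <= B)%N.
  rewrite leqW// -(ler_nat R); have := truncn_le (M * (1 + part b (c x))).
  rewrite arg0 => h; rewrite (le_trans h)// natrM -/M mulrC ler_pM2r//.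
  by have [] := part1 b x; lra.
pose D (bj : bool * 'I_B) : pred 'I_N := fun x => (bj.2 < k bj.1 x)%N.
pose total i := \sum_(bj : bool * 'I_B) cut_mass (D bj) (P i).
pose w x y : R := `|(k true x)%:R - (k true y)%:R| +
  `|(k false x)%:R - (k false y)%:R|.
have totalE i : total i = \sum_(x < N) \sum_(y < N) w x y * P i x y.
  rewrite /total /cut_mass exchange_big; apply: eq_bigr => x _.
  rewrite exchange_big; apply: eq_bigr => y _; rewrite -mulr_suml.
  congr (_ * _).
  rewrite -(pair_bigA _ (fun b j => (D (b, j) x != D (b, j) y)%:R)) /=.
  by rewrite big_bool /D /= !sum_threshold.
pose A x y : R := `|part true (c x) - part true (c y)| +
  `|part false (c x) - part false (c y)|.
have wA x y : w x y <= M * A x y + 2 /\ M * A x y <= w x y + 2.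
  have [h1 h2] := truncn_dist (arg0 true x) (arg0 true y).
  have [h3 h4] := truncn_dist (arg0 false x) (arg0 false y).
  have e1 b : `|M * (1 + part b (c x)) - M * (1 + part b (c y))| =
      M * `|part b (c x) - part b (c y)|.
    rewrite -mulrBr normrM (ger0_norm (ltW M0)) opprD addrACA subrr add0r.
    by [].
  by rewrite !e1 in h1 h2 h3 h4; rewrite /w /A /k; split; lra.
have nsqA x y : nsq (c x - c y) = (part true (c x) - part true (c y)) ^+ 2 +
    (part false (c x) - part false (c y)) ^+ 2.
  by rewrite /nsq /part; case: (c x) => ? ?; case: (c y).
(* The inequality [am] converts a small mean square distance into a small mean distance. *)
have A_up x y : A x y <= 2 * eta + nsq (c x - c y) / eta.
  have am (a : R) : `|a| <= eta + a ^+ 2 / eta.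
    rewrite -(ler_pM2r eta0) mulrDl divfK ?gt_eqF//.
    rewrite -(real_normK (num_real a)).
    have := sqr_ge0 (`|a| - eta); have := normr_ge0 a; nra.
  by rewrite nsqA mulrDl /A;
    have := am (part true (c x) - part true (c y));
    have := am (part false (c x) - part false (c y)); lra.
have A_low x y : nsq (c x - c y) <= 2 * A x y.
  have sq (a b : R) : -1 <= a /\ a <= 1 -> -1 <= b /\ b <= 1 ->
      (a - b) ^+ 2 <= 2 * `|a - b|.
    move=> [a1 a2] [b1 b2]; rewrite -(real_normK (num_real (a - b))) expr2.
    rewrite ler_wpM2r// ler_norml; apply/andP; split; lra.
  rewrite nsqA /A mulrDr.
  by rewrite lerD// sq.
have total_up i : i \in Q -> total i <= M * T.
  move=> /small h; rewrite totalE.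
  have : \sum_(x < N) \sum_(y < N) w x y * P i x y <=
      (M * (2 * eta) + 2) + M / eta * mean_dist c (P i).
    have -> : M * (2 * eta) + 2 =
        (M * (2 * eta) + 2) * \sum_(x < N) \sum_(y < N) P i x y.
      by rewrite P1 mulr1.
    rewrite /mean_dist !mulr_sumr -big_split.
    apply: ler_sum => x _; rewrite !mulr_sumr -big_split; apply: ler_sum => y _.
    rewrite /= [leRHS](_ : _ = P i x y *
      (M * (2 * eta) + 2 + M / eta * nsq (c x - c y))); last by ring.
    rewrite mulrC ler_wpM2l//.
    have [h1 _] := wA x y.
    have : M * A x y <= M * (2 * eta + nsq (c x - c y) / eta).
      by rewrite ler_pM2l.
    have -> : M * (2 * eta + nsq (c x - c y) / eta) =
      M * (2 * eta) + M / eta * nsq (c x - c y) by ring.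
    lra.
  have : M / eta * mean_dist c (P i) <= M / eta * (eta * (T / 4)).
    by rewrite ler_pM2l// divr_gt0.
  have -> : M / eta * (eta * (T / 4)) = M * (T / 4) by field; rewrite gt_eqF.
  by rewrite /eta; lra.
have total_low : M / 8 <= total i0.
  rewrite totalE.
  have : M * 2^-1 * mean_dist c (P i0) - 2 <=
      \sum_(x < N) \sum_(y < N) w x y * P i0 x y.
    have P2 : 2 = 2 * \sum_(x < N) \sum_(y < N) P i0 x y :> R.
      by rewrite P1 mulr1.
    rewrite lerBlDr [X in _ + X]P2 /mean_dist !mulr_sumr -big_split.
    apply: ler_sum => x _; rewrite !mulr_sumr -big_split; apply: ler_sum => y _.
    rewrite /= mulrCA [leRHS](_ : _ = P i0 x y * (w x y + 2)); last by ring.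
    rewrite ler_wpM2l//.
    have [_ h1] := wA x y.
    have : M * nsq (c x - c y) <= M * (2 * A x y) by rewrite ler_pM2l.
    lra.
  have : M * 2^-1 * 2^-1 <= M * 2^-1 * mean_dist c (P i0).
    by rewrite ler_pM2l// mulr_gt0.
  lra.
have cut0 bj i : 0 <= cut_mass (D bj) (P i).
  by apply: sumr_ge0 => x _; apply: sumr_ge0 => y _; rewrite mulr_ge0.
apply: contrapT => none.
have lt_bj bj : 0 < cut_mass (D bj) (P i0) ->
    e * cut_mass (D bj) (P i0) < \sum_(i <- Q) cut_mass (D bj) (P i).
  move=> pos; rewrite ltNge; apply/negP => le; apply: none.
  by exists (D bj).
have le_bj bj :
    e * cut_mass (D bj) (P i0) <= \sum_(i <- Q) cut_mass (D bj) (P i).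
  have := cut0 bj i0; rewrite le_eqVlt => /orP[/eqP <-|/lt_bj/ltW//].
  by rewrite mulr0 sumr_ge0.
have sum_le : e * total i0 <= \sum_(i <- Q) total i.
  rewrite /total mulr_sumr exchange_big; apply: ler_sum => bj _; exact: le_bj.
have sum_up : \sum_(i <- Q) total i <= q%:R * (M * T).
  rewrite -sQ mulrC mulr_natr -iter_addr_0 -count_predT -big_const_seq.
  by rewrite big_seq [leRHS]big_seq; apply: ler_sum => i; exact: total_up.
have : e * (M / 8) <= e * total i0 by rewrite ler_pM2l.
have : q%:R * (M * T) < e * (M / 8).
  have -> : e * (M / 8) = (q%:R + 1) * (M * T).
    by rewrite /T; field; rewrite gt_eqF.
  by rewrite ltr_pM2r ?mulr_gt0// ltrDl.
lra.
Qed.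

End Thresholds.

Lemma foldr_perm (T : eqType) (S : Type) (f : T -> S -> S) (x0 : S) :
  (forall a b x, f a (f b x) = f b (f a x)) ->
  forall s t, perm_eq s t -> foldr f x0 s = foldr f x0 t.
Proof.
move=> fC; have mem a t : a \in t -> foldr f x0 t = f a (foldr f x0 (rem a t)).
  elim: t => //= b t IH; rewrite inE; case: eqVneq => [->//|ab /= at_].
  by rewrite IH// fC.
elim=> [|a s IH] t st; first by move: st; rewrite perm_sym => /perm_nilP ->.
have at_ : a \in t by rewrite -(perm_mem st) mem_head.
rewrite (mem a t)//= (IH (rem a t))//.
by rewrite -(perm_cons a) (perm_trans st)// perm_to_rem.
Qed.

Lemma sum_last (R : realType) (N : nat) : (0 < N)%N ->
  \sum_(a < N) ((a.+1 == N)%:R : R) = 1.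
Proof.
case: N => // m _; rewrite (bigD1 ord_max)//= eqxx big1 ?addr0// => a.
by rewrite -val_eqE /= eqSS => /negbTE ->.
Qed.

(** * Fejer smoothing of the Gaussian function *)

Section FejerProcess.
Variables (R : realType) (G : groupType) (H : hilbertSpace R).
Variables (pi : unitaryRep G H) (xi : H).

Definition gauss (u : H) : R[i] := (expR (- (hnorm2 u / 2)))%:C.

(** Expanding the squared norm of [u - w] gives a rank one factor times the exponential of the real
    part of the inner product. *)
Lemma gauss_pdfun : pdfun gauss.
Proof.
have Kpos : rposdef (fun u w : H => complex.Re (inner H u w)).
  split=> [u w|s]; first by rewrite inner_conj; case: (inner H w u).
  rewrite (_ : rform _ s s = hnorm2 (\sum_(p <- s) p.1%:C *: p.2)).
    exact: hnorm2_ge0.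
  rewrite /hnorm2 inner_suml raddf_sum /=; apply: eq_bigr => p _.
  rewrite inner_sumr raddf_sum /=; apply: eq_bigr => r _.
  rewrite innerZl innerZr conj_realC mulrA -rmorphM complex_ReM /=.
  by rewrite mul0r subr0.
have := rposdef_congr (fun u => expR (- (hnorm2 u / 2))) (rposdef_exp Kpos).
move=> /rposdef_complex gpos s; have := gpos s; congr (0 <= _).
rewrite /gram; apply: eq_bigr => p _; apply: eq_bigr => r _; congr (_ * _).
apply: (congr1 (real_complex R)); rewrite -!expRD; congr (expR _).
by rewrite hnorm2B; field.
Qed.

Lemma gauss_ge0 u : 0 <= complex.Re (gauss u).
Proof. exact: expR_ge0. Qed.

Lemma gauss_le1 u : complex.Re (gauss u) <= 1.
Proof. by rewrite /= -expR0 ler_expR oppr_le0 divr_ge0// hnorm2_ge0. Qed.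

Variables (N : nat) (z : R[i]).
Hypothesis N0 : (0 < N)%N.
Hypothesis zN : N.-primitive_root z.

(** On a character of [H] with value [w] at [v], compression along [v] by [rank1_form x] is
    multiplication by the squared modulus of [\sum_a (z ^+ x * w) ^+ a], divided by [N ^ 2]: a Fejer
    kernel peaking at [w = conj (z ^+ x)]. *)
Definition fourier_vector (x a : 'I_N) : R[i] := z ^+ (a * x) / N%:R.

Definition rank1_form (x a b : 'I_N) : R[i] :=
  fourier_vector x a * Num.conj (fourier_vector x b).

Definition spectral_form (D : pred 'I_N) (a b : 'I_N) : R[i] :=
  \sum_(x < N | D x) rank1_form x a b.

Let N_neq0 : N%:R != 0 :> R[i].
Proof. by rewrite pnatr_eq0 -lt0n. Qed.

Lemma rank1_formE (x a b : 'I_N) : rank1_form x a b =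
  z ^+ (a * x) * Num.conj (z ^+ (b * x)) / N%:R / N%:R.
Proof.
rewrite /rank1_form /fourier_vector rmorphM /= fmorphV /= rmorph_nat.
by field; rewrite N_neq0.
Qed.

Lemma spectral_form_full a b :
  spectral_form xpredT a b = (a == b)%:R / N%:R.
Proof.
rewrite /spectral_form; under eq_bigr do rewrite rank1_formE.
rewrite -!mulr_suml (prim_root_sum N0 zN) !modn_small//.
rewrite -val_eqE /=; case: ifP => _; first by rewrite divff// mul1r.
by rewrite !mul0r.
Qed.

Definition split_pred (D : pred 'I_N) (b : bool) : pred 'I_N :=
  fun x => D x == b.

(* These operators commute and preserve positive definiteness, and those of the
   two values of a coordinate add up to the identity: fejer_prob D below is thus
   a consistent family of finite-dimensional laws. *)
Definition fejer_op (D : pred 'I_N) (x : G * bool) (psi : H -> R[i]) :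
    H -> R[i] :=
  compress (spectral_form (split_pred D x.2)) (pi x.1 xi) psi.

Definition fejer_state (D : pred 'I_N) (s : seq (G * bool)) : H -> R[i] :=
  foldr (fejer_op D) gauss s.

(** A probability only for lists with distinct group elements: as the operators are not projections,
    a list giving both values to the same [g] may have positive weight. *)
Definition fejer_prob (D : pred 'I_N) (s : seq (G * bool)) : R :=
  complex.Re (fejer_state D s 0).

Lemma spectral_form_pdfun D v (psi : H -> R[i]) : pdfun psi ->
  pdfun (compress (spectral_form D) v psi).
Proof.
move=> psi_pos; rewrite (_ : compress _ _ _ = fun u =>
    \sum_(x < N | D x) compress (rank1_form x) v psi u); last first.
  by apply/funext => u; exact: compress_sum.
by apply: pdfun_sum => x _; exact: compress_rank1.
Qed.

Lemma fejer_state_pdfun D s : pdfun (fejer_state D s).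
Proof.
elim: s => [|x s IH]; first exact: gauss_pdfun.
exact: spectral_form_pdfun.
Qed.

Lemma fejer_prob_ge0 D s : 0 <= fejer_prob D s.
Proof.
have := pdfun_ge0 (@fejer_state_pdfun D s).
by rewrite lecE => /andP[].
Qed.

Lemma fejer_prob_perm D s t : perm_eq s t -> fejer_prob D s = fejer_prob D t.
Proof.
move=> st; rewrite /fejer_prob /fejer_state.
have -> // : foldr (fejer_op D) gauss s = foldr (fejer_op D) gauss t.
by apply: foldr_perm => // x y psi; exact: compressC.
Qed.

Lemma fejer_prob_split D g s : fejer_prob D s =
  fejer_prob D ((g, false) :: s) + fejer_prob D ((g, true) :: s).
Proof.
rewrite /fejer_prob -raddfD /= /fejer_op /= -compressDl.
congr complex.Re; rewrite -[LHS](congr1 (fun f => f 0)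
  (compress_diag (pi g xi) (fejer_state D s) N0)).
congr (_ 0); apply: eq_compress => a b; rewrite -spectral_form_full.
rewrite /spectral_form addrC (bigID D) /=; congr (_ + _); apply: eq_bigl => x.
  by rewrite /split_pred eqb_id.
by rewrite /split_pred eqbF_neg.
Qed.

(** [pi g] permutes the vectors [pi x.1 xi] and preserves [gauss]; at [u = 0], a fixed point, this
    is the invariance of the law. *)
Lemma fejer_state_shift D g s u :
  fejer_state D [seq ((g * x.1)%g, x.2) | x <- s] u =
  fejer_state D s (pi g^-1%g u).
Proof.
elim: s u => [|[h b] s IH] u.
  by rewrite /= /gauss /hnorm2 rep_unitary.
rewrite /= {1}/fejer_op /fejer_op /=; apply: eq_bigr => a _.
apply: eq_bigr => c _; rewrite IH; congr (_ * fejer_state D s _).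
have piB v w : pi g^-1%g (v - w) = pi g^-1%g v - pi g^-1%g w by exact: linearB.
have piD v w : pi g^-1%g (v + w) = pi g^-1%g v + pi g^-1%g w by exact: linearD.
have piMn v n : pi g^-1%g (v *+ n) = pi g^-1%g v *+ n by exact: linearMn.
by rewrite piB piD !piMn -repM mulKg.
Qed.

Lemma fejer_prob_inv D g s :
  fejer_prob D [seq ((g * x.1)%g, x.2) | x <- s] = fejer_prob D s.
Proof.
rewrite /fejer_prob fejer_state_shift.
by rewrite (_ : pi g^-1%g 0 = 0)//; exact: linear0.
Qed.

Definition joint_prob (g : G) (x y : 'I_N) : R :=
  complex.Re (compress (rank1_form x) (pi 1%g xi)
    (compress (rank1_form y) (pi g xi) gauss) 0).

Lemma joint_prob_ge0 g x y : 0 <= joint_prob g x y.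
Proof.
have pos : pdfun (compress (rank1_form x) (pi 1%g xi)
    (compress (rank1_form y) (pi g xi) gauss)).
  by apply: compress_rank1; apply: compress_rank1; exact: gauss_pdfun.
by have := pdfun_ge0 pos; rewrite lecE => /andP[].
Qed.

Lemma joint_prob_real g x y : (joint_prob g x y)%:C =
  compress (rank1_form x) (pi 1%g xi)
    (compress (rank1_form y) (pi g xi) gauss) 0.
Proof.
have pos : pdfun (compress (rank1_form x) (pi 1%g xi)
    (compress (rank1_form y) (pi g xi) gauss)).
  by apply: compress_rank1; apply: compress_rank1; exact: gauss_pdfun.
have := pdfun_ge0 pos; rewrite /joint_prob; case: (compress _ _ _ 0) => a b.
by rewrite lecE /= => /andP[/eqP -> _].
Qed.

Lemma joint_prob_sum (D1 D2 : pred 'I_N) g :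
  \sum_(x < N | D1 x) \sum_(y < N | D2 y) joint_prob g x y =
  complex.Re (compress (spectral_form D1) (pi 1%g xi)
    (compress (spectral_form D2) (pi g xi) gauss) 0).
Proof.
rewrite /spectral_form compress_sum raddf_sum; apply: eq_bigr => x _.
rewrite -raddf_sum -compress_sumr; congr (complex.Re (compress _ _ _ _)).
by apply/funext => u; rewrite compress_sum.
Qed.

Lemma joint_prob_total g :
  \sum_(x < N) \sum_(y < N) joint_prob g x y = 1.
Proof.
rewrite joint_prob_sum (eq_compress _ _ spectral_form_full) compress_diag//.
rewrite (eq_compress _ _ spectral_form_full) compress_diag//.
by rewrite /gauss /= hnorm2_0 mul0r oppr0 expR0.
Qed.

Lemma cut_massE D g : cut_mass D (joint_prob g) =
  fejer_prob D [:: (1%g, true); (g, false)] +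
  fejer_prob D [:: (1%g, false); (g, true)].
Proof.
have E (b1 b2 : bool) : fejer_prob D [:: (1%g, b1); (g, b2)] =
    \sum_(x < N) \sum_(y < N)
      ((D x == b1) && (D y == b2))%:R * joint_prob g x y.
  rewrite /fejer_prob /= /fejer_op /= -joint_prob_sum big_mkcond.
  apply: eq_bigr => x _; rewrite /split_pred; case: (D x == b1); last first.
    by rewrite big1// => y _; rewrite mul0r.
  rewrite big_mkcond; apply: eq_bigr => y _.
  by case: (D y == b2); rewrite ?mul1r ?mul0r.
rewrite !E /cut_mass -big_split; apply: eq_bigr => x _ /=.
rewrite -big_split; apply: eq_bigr => y _ /=.
by rewrite -mulrDl; congr (_ * _); case: (D x); case: (D y);
  rewrite /= ?addr0 ?add0r.
Qed.

Definition root_point (x : 'I_N) : R[i] := z ^+ x.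

Lemma nsq_root_point x : nsq (root_point x) = 1.
Proof.
have := prim_root_conj N0 zN x; rewrite mulCconj => /(congr1 (@complex.Re R)).
exact.
Qed.

(** The weight shifts the frequency by one: after summation, compression becomes an average of
    translations by [v], except where [ordS] wraps around. *)
Lemma rank1_form_left a b :
  \sum_(x < N) Num.conj (root_point x) * rank1_form x a b =
  (a == ordS b)%:R / N%:R.
Proof.
have e (x : 'I_N) : Num.conj (root_point x) * rank1_form x a b =
    z ^+ (a * x) * Num.conj (z ^+ (b.+1 * x)) / N%:R / N%:R.
  by rewrite rank1_formE /root_point mulSn exprD rmorphM /=; ring.
under eq_bigr do rewrite e.
rewrite -!mulr_suml (prim_root_sum N0 zN) modn_small//.
rewrite -val_eqE /=; case: ifP => _; first by rewrite divff// mul1r.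
by rewrite !mul0r.
Qed.

Lemma rank1_form_right a b :
  \sum_(y < N) root_point y * rank1_form y a b = (ordS a == b)%:R / N%:R.
Proof.
have e (y : 'I_N) : root_point y * rank1_form y a b =
    z ^+ (a.+1 * y) * Num.conj (z ^+ (b * y)) / N%:R / N%:R.
  by rewrite rank1_formE /root_point mulSn exprD; ring.
under eq_bigr do rewrite e.
rewrite -!mulr_suml (prim_root_sum N0 zN) [(b %% N)%N]modn_small//.
rewrite -val_eqE /=; case: ifP => _; first by rewrite divff// mul1r.
by rewrite !mul0r.
Qed.

Lemma compress_scale (c : R[i]) (k : 'I_N -> 'I_N -> R[i]) v psi (u : H) :
  c * compress k v psi u = compress (fun a b => c * k a b) v psi u.
Proof.
rewrite /compress mulr_sumr; apply: eq_bigr => a _.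
by rewrite mulr_sumr; apply: eq_bigr => b _; rewrite mulrA.
Qed.

Lemma joint_prob_correlation g :
  \sum_(x < N) \sum_(y < N) (joint_prob g x y)%:C *
      (Num.conj (root_point x) * root_point y) =
  N%:R^-1 * \sum_(b < N) (N%:R^-1 * \sum_(a < N)
    gauss (pi 1%g xi *+ ordS b - pi 1%g xi *+ b + pi g xi *+ a -
      pi g xi *+ ordS a)).
Proof.
have right v psi :
    (fun u => \sum_(y < N) root_point y * compress (rank1_form y) v psi u) =
    fun u : H => N%:R^-1 * \sum_(a < N) psi (u + v *+ a - v *+ ordS a).
  apply/funext => u; under eq_bigr do rewrite compress_scale.
  rewrite -compress_sum (eq_compress _ _ rank1_form_right) /compress mulr_sumr.
  apply: eq_bigr => a _; rewrite (bigD1 (ordS a))//= eqxx mul1r big1 ?addr0//.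
  by move=> b ba; rewrite eq_sym (negbTE ba) !mul0r.
have left v psi (u : H) :
    \sum_(x < N) Num.conj (root_point x) * compress (rank1_form x) v psi u =
    N%:R^-1 * \sum_(b < N) psi (u + v *+ ordS b - v *+ b).
  under eq_bigr do rewrite compress_scale.
  rewrite -compress_sum (eq_compress _ _ rank1_form_left) /compress.
  rewrite exchange_big mulr_sumr.
  apply: eq_bigr => b _; rewrite (bigD1 (ordS b))//= eqxx mul1r big1 ?addr0//.
  by move=> a ab; rewrite (negbTE ab) !mul0r.
under eq_bigr => x _.
  under eq_bigr => y _.
    rewrite joint_prob_real mulrC -mulrA compress_scale.
    rewrite (_ : compress _ _ _ 0 = compress (rank1_form x) (pi 1%g xi)
      (fun u => root_point y * compress (rank1_form y) (pi g xi) gauss u) 0);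
      last first.
      apply: eq_bigr => a _; apply: eq_bigr => b _.
      by rewrite [RHS]mulrCA mulrA.
    over.
  rewrite -mulr_sumr -compress_sumr right.
  over.
rewrite left; congr (_ * _); apply: eq_bigr => b _.
by rewrite add0r.
Qed.

(** In the double average all terms equal [gauss (xi - pi g xi)] unless [ordS a] or [ordS b] wraps
    around. The exceptions are a proportion at most 2 / N, and values of [gauss] differ by at most
    1. *)
Lemma gauss_correlation g :
  `|complex.Re (gauss (xi - pi g xi)) -
    \sum_(x < N) \sum_(y < N) joint_prob g x y *
      complex.Re (Num.conj (root_point x) * root_point y)| <= 2 / N%:R.
Proof.
set c := complex.Re (gauss (xi - pi g xi)).
set V := N%:R : R; have V0 : 0 < V by rewrite ltr0n.
have VE : (N%:R : R[i])^-1 = (V^-1)%:C by rewrite fmorphV /= rmorph_nat.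
have := congr1 (@complex.Re R) (joint_prob_correlation g).
rewrite raddf_sum VE complex_ReM /= mul0r subr0 raddf_sum /=.
under eq_bigr => x _.
  rewrite raddf_sum /=.
  under eq_bigr => y _ do rewrite complex_ReM /= mul0r subr0.
  over.
move=> ->.
pose F (b a : 'I_N) : R := complex.Re (gauss (pi 1%g xi *+ ordS b -
  pi 1%g xi *+ b + pi g xi *+ a - pi g xi *+ ordS a)).
rewrite (eq_bigr (fun b => V^-1 * \sum_(a < N) F b a)); last first.
  by move=> b _; rewrite complex_ReM /= mul0r subr0 raddf_sum.
pose l (a : 'I_N) : R := (a.+1 == N)%:R.
have ordSE (a : 'I_N) : a.+1 != N -> ordS a = a.+1 :> nat.
  by move=> aN; rewrite /= modn_small// ltn_neqAle aN ltn_ord.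
have diffS (v : H) n : v *+ n.+1 - v *+ n = v.
  by rewrite mulrSr addrAC subrr add0r.
have subS (v w : H) n : w + v *+ n - v *+ n.+1 = w - v.
  by rewrite mulrSr opprD addrA addrK.
have near1 b a : `|c - F b a| <= 1.
  rewrite ler_norml /c /F; apply/andP; split.
    have := gauss_ge0 (xi - pi g xi).
    have := gauss_le1 (pi 1%g xi *+ ordS b - pi 1%g xi *+ b + pi g xi *+ a -
      pi g xi *+ ordS a).
    lra.
  have := gauss_le1 (xi - pi g xi).
  have := gauss_ge0 (pi 1%g xi *+ ordS b - pi 1%g xi *+ b + pi g xi *+ a -
    pi g xi *+ ordS a).
  lra.
have F_near b a : `|c - F b a| <= l b + l a.
  have [bN|bN] := boolP (b.+1 == N).
    by rewrite (le_trans (near1 b a))// /l bN lerDl.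
  have [aN|aN] := boolP (a.+1 == N).
    by rewrite (le_trans (near1 b a))// /l aN lerDr.
  by rewrite /F (ordSE b)// (ordSE a)// diffS subS rep1 subrr normr0 addr_ge0.
have cE : c = V^-1 * \sum_(b < N) (V^-1 * \sum_(a < N) c).
  rewrite !sumr_const !card_ord -[c *+ N]mulr_natl mulKf ?gt_eqF//.
  by rewrite -[c *+ N]mulr_natl mulKf ?gt_eqF.
rewrite {1}cE -mulrBr -sumrB normrM ger0_norm ?invr_ge0 ?(ltW V0)//.
rewrite mulrC ler_pM2r ?invr_gt0//.
apply: (le_trans (ler_norm_sum _ _ _)).
have bound (b : 'I_N) : true ->
    `|V^-1 * \sum_(a < N) c - V^-1 * \sum_(a < N) F b a| <= l b + V^-1.
  move=> _; rewrite -mulrBr -sumrB normrM ger0_norm ?invr_ge0 ?(ltW V0)//.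
  rewrite mulrC ler_pdivrMr// mulrDl mulVf ?gt_eqF//.
  apply: (le_trans (ler_norm_sum _ _ _)).
  apply: (@le_trans _ _ (\sum_(a < N) (l b + l a))); first exact: ler_sum.
  by rewrite big_split /= sumr_const card_ord sum_last// mulr_natr.
apply: (@le_trans _ _ (\sum_(b < N) (l b + V^-1))); first exact: ler_sum.
rewrite big_split /= sum_last// sumr_const card_ord -[V^-1 *+ N]mulr_natr.
by rewrite mulVf ?gt_eqF.
Qed.

Lemma mean_dist_point g :
  `|mean_dist root_point (joint_prob g) -
    2 * (1 - complex.Re (gauss (xi - pi g xi)))| <= 4 / N%:R.
Proof.
have nsqE x y : nsq (root_point x - root_point y) =
    2 - 2 * complex.Re (Num.conj (root_point x) * root_point y).
  have := nsq_root_point x; have := nsq_root_point y.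
  rewrite /nsq; case: (root_point x) => a b.
  case: (root_point y) => a' b' /= h1 h2.
  have -> : (a - a') ^+ 2 + (b - b') ^+ 2 = (a ^+ 2 + b ^+ 2) +
    (a' ^+ 2 + b' ^+ 2) - 2 * (a * a' - - b * b') by ring.
  by rewrite h1 h2; ring.
have -> : mean_dist root_point (joint_prob g) =
    2 - 2 * \sum_(x < N) \sum_(y < N)
    joint_prob g x y * complex.Re (Num.conj (root_point x) * root_point y).
  rewrite /mean_dist -[X in X - _]mulr1 -[X in _ * X - _](joint_prob_total g).
  rewrite !mulr_sumr -sumrB; apply: eq_bigr => x _.
  rewrite !mulr_sumr -sumrB; apply: eq_bigr => y _; rewrite nsqE; ring.
have := gauss_correlation g; set c := complex.Re (gauss _).
set S := \sum_(x < N) _.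
move=> h; have -> : 2 - 2 * S - 2 * (1 - c) = 2 * (c - S) by ring.
by rewrite normrM ger0_norm//; lra.
Qed.

End FejerProcess.

Section CutProcess.
Variables (R : realType) (G : groupType).
Hypothesis nT : ~ property_T R G.

Lemma cut_process (Q : seq G) (e : R) : 0 < e ->
  exists p : seq (G * bool) -> R,
  [/\ forall s, 0 <= p s,
      forall s t, perm_eq s t -> p s = p t,
      forall g s, p s = p ((g, false) :: s) + p ((g, true) :: s),
      forall g s, p [seq ((g * x.1)%g, x.2) | x <- s] = p s &
  let cut g :=
    p [:: (1%g, true); (g, false)] + p [:: (1%g, false); (g, true)] in
  exists2 g0, 0 < cut g0 & forall g, g \in Q -> cut g <= e * cut g0].
Proof.
move=> e0; have [tau tau0 tauP] := cut_exists (size Q) e0.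
have tau2 : 0 < tau / 2 by rewrite divr_gt0.
have [H [pi [xi [xi1 xiQ [g0 xig0]]]]] := not_property_T_vectors nT Q tau2.
(* The error [4 / N] is at most 1/6, leaving mean distance at least
   [2 * (1 - 2 / 3) - 1 / 6 = 1 / 2] at [g0], and at most [tau / 2], the other half of [tau] being
   the squared displacement on [Q]. *)
pose N := (Num.truncn (24 + 8 / tau)).+1.
have N0 : (0 < N)%N by [].
have NV : 24 + 8 / tau < (N%:R : R) by exact: truncnS_gt.
have t80 : 0 < 8 / tau by rewrite divr_gt0.
have V0 : 0 < (N%:R : R) by rewrite ltr0n.
have V1 : 4 / N%:R <= 1 / 6 :> R by rewrite ler_pdivrMr//; lra.
have V2 : 4 / N%:R <= tau / 2.
  have : 8 / tau <= N%:R by lra.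
  by rewrite ler_pdivrMr// => h; rewrite ler_pdivrMr//; lra.
have [z zN] := complex_prim_root_exists R N0.
have gaussE g : complex.Re (gauss (xi - pi g xi)) =
    expR (- (hnorm2 (pi g xi - xi) / 2)) by rewrite /= hnorm2C.
have [|||g gQ||D D0 DQ] := tauP N (root_point (N := N) z) G
    (joint_prob pi xi z) Q g0 erefl.
- exact: nsq_root_point.
- exact: joint_prob_ge0.
- exact: joint_prob_total.
- have := mean_dist_point pi xi N0 zN g; rewrite gaussE ler_norml => /andP[_].
  have := expR_ge1Dx (- (hnorm2 (pi g xi - xi) / 2)).
  have := xiQ g gQ; lra.
- have := mean_dist_point pi xi N0 zN g0.
  rewrite gaussE ler_norml => /andP[+ _].
  have h : expR (- (hnorm2 (pi g0 xi - xi) / 2)) <= 2 / 3.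
    rewrite expRN -[leRHS]invrK lef_pV2 ?posrE ?expR_gt0 ?invr_gt0 ?divr_gt0//.
    apply: le_trans (expR_ge1Dx _).
    by rewrite invf_div; lra.
  lra.
exists (fejer_prob pi xi z D); split.
- exact: fejer_prob_ge0.
- exact: fejer_prob_perm.
- exact: fejer_prob_split.
- exact: fejer_prob_inv.
move=> cut; have cutE g : cut g = cut_mass D (joint_prob pi xi z g).
  by rewrite cut_massE.
exists g0; first by rewrite cutE.
move=> g gQ; rewrite !cutE; apply: le_trans DQ.
apply: (@le_sum_mem _ _ _ (fun h => cut_mass D (joint_prob pi xi z h)) _ _ gQ).
move=> h; rewrite -cutE; apply: addr_ge0; exact: fejer_prob_ge0.
Qed.

End CutProcess.

(** * Invariant measures on {0,1}^G *)

Section BinaryProcess.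
Variables (R : realType) (p : seq (nat * bool) -> R).
Hypothesis p_ge0 : forall s, 0 <= p s.
Hypothesis p_perm : forall s t, perm_eq s t -> p s = p t.
Hypothesis p_split : forall n s, p s = p ((n, false) :: s) + p ((n, true) :: s).

(* The interval [0, p nil[ is cut successively according to p; words list the
   successive choices, the most recent one first. *)
Fixpoint word_indices (w : seq bool) : seq (nat * bool) :=
  if w is b :: v then (size v, b) :: word_indices v else [::].

Fixpoint word_left (w : seq bool) : R :=
  if w is b :: v then
    word_left v + (if b then p (word_indices (false :: v)) else 0)
  else 0.

Definition next_bit (w : seq bool) (t : R) : bool :=
  word_left w + p (word_indices (false :: w)) <= t.

Fixpoint word (n : nat) (t : R) : seq bool :=
  if n is m.+1 then next_bit (word m t) t :: word m t else [::].

Definition process (t : R) (n : nat) : bool := next_bit (word n t) t.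

Lemma size_word n t : size (word n t) = n.
Proof. by elim: n => //= n ->. Qed.

(** The interval of [b :: v] is the left part, for [false], or the right part, for [true], of that
    of [v], and [p_split] makes the two lengths fit. *)
Lemma wordP w t : 0 <= t -> t < p [::] ->
  (word (size w) t == w) =
  (word_left w <= t < word_left w + p (word_indices w)).
Proof.
move=> t0 t1; elim: w => [|b v IH] /=; first by rewrite t0 add0r t1 eqxx.
rewrite eqseq_cons.
have [/eqP e|ne] := boolP (word (size v) t == v); last first.
  rewrite (negbTE ne) in IH; rewrite andbF; apply/esym/negbTE.
  apply: contraFN (esym IH) => /andP[h1 h2].
  have := p_split (size v) (word_indices v).
  have := p_ge0 ((size v, false) :: word_indices v).
  have := p_ge0 ((size v, true) :: word_indices v).
  by case: b h1 h2 => /= h1 h2 *; apply/andP; split; lra.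
move: IH; rewrite e eqxx => /esym/andP[h1 h2]; rewrite andbT /next_bit /=.
have h3 := p_split (size v) (word_indices v).
have h4 := p_ge0 ((size v, false) :: word_indices v).
case: b; last first.
  by rewrite addr0 h1 /= ltNge; case: (_ <= t).
rewrite eqb_id; case: (_ <= t) => //=.
by apply/esym; rewrite -addrA -h3.
Qed.

Let lambda := @lebesgue_measure R.

Definition word_set (w : seq bool) : set R :=
  `[0, p [::][%classic `&` [set t | word (size w) t = w].

Lemma word_left_ge0 w : 0 <= word_left w.
Proof. by elim: w => //= b v IH; rewrite addr_ge0//; case: b. Qed.

Lemma word_right_le w : word_left w + p (word_indices w) <= p [::].
Proof.
elim: w => [|b v IH] /=; first by rewrite add0r.
have h3 := p_split (size v) (word_indices v).
have h4 := p_ge0 ((size v, true) :: word_indices v).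
by case: b; lra.
Qed.

Lemma word_setE w : word_set w =
  `[word_left w, word_left w + p (word_indices w)[%classic.
Proof.
rewrite /word_set; apply/seteqP; split=> t /=; rewrite !in_itv /=.
  by move=> [/andP[t0 t1] /eqP]; rewrite wordP.
move=> /andP[h1 h2].
have t0 : 0 <= t by rewrite (le_trans (word_left_ge0 w)).
have t1 : t < p [::] by rewrite (lt_le_trans h2)// word_right_le.
by rewrite t0 t1; split=> //; apply/eqP; rewrite wordP// h1 h2.
Qed.

Lemma measurable_word_set w : measurable (word_set w).
Proof. by rewrite word_setE. Qed.

Lemma lebesgue_word_set w : lambda (word_set w) = (p (word_indices w))%:E.
Proof.
rewrite word_setE /lambda lebesgue_measure_itv /= lte_fin ltrDl.
have := p_ge0 (word_indices w); rewrite le_eqVlt => /orP[/eqP <-|->].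
  by rewrite ltxx.
by rewrite -EFinD addrAC subrr add0r.
Qed.

Definition cylinder_set (s : seq (nat * bool)) : set R :=
  `[0, p [::][%classic `&` [set t | all (fun x => process t x.1 == x.2) s].

Lemma measurable_process n : measurable
  (`[0, p [::][%classic `&` [set t | process t n]).
Proof.
rewrite (_ : _ `&` _ =
    \bigcup_(w in [set w : n.-tuple bool | true]) word_set (true :: w)).
  by apply: fin_bigcup_measurable => // w _; exact: measurable_word_set.
apply/seteqP; split=> [t [t01 tn]|t [w _ [t01 /= tw]]].
  exists (Tuple (introT eqP (size_word n t))) => //; split=> //=.
  by rewrite size_word -/(process t n) tn.
split=> //=; move: tw; rewrite size_tuple /process => -[-> _].
by [].
Qed.

Lemma measurable_cylinder_set s : measurable (cylinder_set s).
Proof.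
elim: s => [|[n b] s IH].
  rewrite (_ : cylinder_set [::] = `[0, p [::][%classic)//.
  by apply/seteqP; split=> t // -[].
pose A := `[0, p [::][%classic `&` [set t | process t n].
have -> : cylinder_set ((n, b) :: s) =
    if b then cylinder_set s `&` A else cylinder_set s `\` A.
  rewrite /A /cylinder_set; case: b; apply/seteqP; split=> t /=.
  - by move=> [t01 /andP[/eqP h1 h2]].
  - by move=> [[t01 h2] [_ h1]]; rewrite h1.
  - move=> [t01 /andP[/eqP h1 h2]]; split=> // -[_].
    by rewrite h1.
  - move=> [[t01 h2] h1]; split=> //; rewrite h2 andbT.
    by apply/eqP/negP => h3; apply: h1.
by case: b; [apply: measurableI|apply: measurableD] => //;
  exact: measurable_process.
Qed.

Lemma cylinder_split n s : lambda (cylinder_set s) =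
  (lambda (cylinder_set ((n, false) :: s)) +
   lambda (cylinder_set ((n, true) :: s)))%E.
Proof.
rewrite -measureU; try exact: measurable_cylinder_set.
  congr (lambda _); apply/seteqP; split=> t.
    by move=> [t01 /= h]; case: (boolP (process t n)) => hn;
      [right|left]; split=> //=; rewrite h andbT ?hn ?(negbTE hn).
  by move=> [|] [t01 /= /andP[_ h]].
apply/seteqP; split=> t //= [[_ /= /andP[/eqP h _]] [_ /= /andP[/eqP]]].
by rewrite h.
Qed.

(** A list prescribing exactly the coordinates below [N] is, up to order, that of a word, whose
    cylinder is a single interval. *)
Lemma lebesgue_complete_cylinder N s :
  perm_eq (map fst s) (iota 0 N) -> lambda (cylinder_set s) = (p s)%:E.
Proof.
move=> sN; pose f n := (n, true) \in s.
have us : uniq (map fst s) by rewrite (perm_uniq sN) iota_uniq.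
have fs n b : (n, b) \in s -> f n = b.
  rewrite /f; case: b => // nf; apply/negP => nt.
  have := us; rewrite (perm_uniq (perm_map fst (perm_to_rem nf))) /=.
  have : (n, true) \in rem (n, false) s.
    by have := perm_mem (perm_to_rem nf) (n, true);
      rewrite nt inE xpair_eqE andbF /= => <-.
  by move=> /(map_f fst) /= ->.
pose w := fix w k := if k is j.+1 then f j :: w j else [::].
have sw k : size (w k) = k by elim: k => //= k ->.
have sE : perm_eq s (word_indices (w N)).
  have -> : s = [seq (n, f n) | n <- map fst s].
    rewrite -map_comp -[LHS]map_id; apply/eq_in_map => -[n b] nb /=.
    by rewrite (fs n b).
  rewrite (perm_trans (perm_map _ sN))//.
  elim: N {sN} => // N IH.
  have -> : iota 0 N.+1 = iota 0 N ++ [:: N] by rewrite -addn1 iotaD.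
  rewrite map_cat perm_catC /= sw perm_cons.
  exact: IH.
rewrite (p_perm sE) -lebesgue_word_set; congr (lambda _).
rewrite /cylinder_set /word_set; congr (_ `&` _).
have allE t : all (fun x => process t x.1 == x.2) s =
    all (fun x => process t x.1 == x.2) (word_indices (w N)).
  exact: perm_all.
have aw t (v : seq bool) : all (fun x => process t x.1 == x.2) (word_indices v)
    = (word (size v) t == v).
  elim: v => //= b v ->; rewrite eqseq_cons.
  have [e|] := eqVneq (word (size v) t) v; last by rewrite !andbF.
  by rewrite /process e.
by apply/seteqP; split=> t /=; rewrite allE aw sw => /eqP.
Qed.

Lemma lebesgue_cylinder s : uniq (map fst s) ->
  lambda (cylinder_set s) = (p s)%:E.
Proof.
have main N todo : forall s, perm_eq (todo ++ map fst s) (iota 0 N) ->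
    lambda (cylinder_set s) = (p s)%:E.
  elim: todo => [|n todo IH] r rN; first exact: lebesgue_complete_cylinder rN.
  rewrite (cylinder_split n) (p_split n) EFinD; congr (_ + _)%E; apply: IH;
  by rewrite /= (perm_trans _ rN)//= perm_catC /= perm_cons perm_catC.
move=> us; pose N := (\max_(x <- s) x.1).+1.
apply: (main N [seq n <- iota 0 N | n \notin map fst s]).
apply: uniq_perm; last 2 first.
- exact: iota_uniq.
- move=> n; rewrite mem_cat mem_filter mem_iota add0n /=.
  have [/mapP[x xs ->]|] := boolP (n \in map fst s); last by rewrite orbF.
  by rewrite /= ltnS (@leq_bigmax_seq _ _ xpredT (fun x => x.1)).
rewrite cat_uniq filter_uniq ?iota_uniq// us andbT.
by apply/hasPn => n ns; rewrite mem_filter ns.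
Qed.

End BinaryProcess.

(** * Shift-invariant measures from consistent finite laws *)

Definition coordinate_sets (G : Type) : set (set (G -> bool)) :=
  [set A | exists g, A = [set w : G -> bool | w g]].

Definition coin_space (G : Type) := g_sigma_algebraType (@coordinate_sets G).

Definition cylinder (G : Type) (s : seq (G * bool)) : set (coin_space G) :=
  [set w | all (fun x => w x.1 == x.2) s].

Definition coin_shift (G : groupType) (g : G) (w : coin_space G) :
    coin_space G :=
  fun h => w (g^-1 * h)%g.

Section CylinderMeasure.
Variables (R : realType) (G : groupType).
Hypothesis countableG : countable [set: G].
Implicit Types (s t : seq (G * bool)).

Lemma cylinder_cat s t : cylinder (s ++ t) = cylinder s `&` cylinder t.
Proof.
apply/seteqP; split=> w; rewrite /cylinder /= all_cat; first by move/andP.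
by move=> [-> ->].
Qed.

(** Only lists with distinct coordinates have a prescribed measure, but the intersection-stable
    generating family contains all lists. A repeated coordinate is redundant or contradictory. *)
Lemma cylinder_normal s : cylinder s = set0 \/
  exists2 s', uniq (map fst s') & cylinder s = cylinder s'.
Proof.
elim: s => [|[g b] s [s0|[s' us' sE]]].
- by right; exists [::].
- by left; rewrite -cat1s cylinder_cat s0 setI0.
have [gs'|gs'] := boolP (g \in map fst s'); last first.
  right; exists ((g, b) :: s'); first by rewrite /= gs'.
  by rewrite -cat1s cylinder_cat sE -cylinder_cat.
have [[g' b'] gb /= gE] := mapP gs'; subst g'.
have sub w : cylinder s' w -> w g = b' by move=> /allP /(_ _ gb) /= /eqP.
have [bE|bE] := eqVneq b' b.
  right; exists s' => //; rewrite -cat1s cylinder_cat sE.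
  apply/seteqP; split=> w [] //; move=> w'; split=> //.
  by rewrite /cylinder /= (sub w w') bE eqxx.
left; rewrite -cat1s cylinder_cat sE; apply/seteqP; split=> w //.
move=> [] /=; rewrite /cylinder /= andbT => /eqP wg /sub.
by rewrite wg => /eqP; rewrite eq_sym (negbTE bE).
Qed.

Lemma measurable_cylinder s : measurable (cylinder s).
Proof.
elim: s => [|[g b] s IH].
  by rewrite (_ : cylinder _ = setT)//; apply/seteqP.
rewrite -cat1s cylinder_cat; apply: measurableI => //.
have mg : measurable ([set w : coin_space G | w g]).
  by apply: sub_sigma_algebra; exists g.
have -> : cylinder [:: (g, b)] =
    if b then [set w : coin_space G | w g] else ~` [set w : coin_space G | w g].
  rewrite /cylinder; case: b; apply/seteqP; split=> w /=; rewrite andbT.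
  - by move/eqP.
  - by move=> ->.
  - by move/eqP=> ->.
  - by move=> /negP/negbTE ->.
by case: b => //; exact: measurableC.
Qed.

Lemma measurable_coin_space :
  @measurable _ (coin_space G) = <<s [set cylinder s | s in setT] >>.
Proof.
apply/seteqP; split=> A.
  apply: smallest_sub; first exact: smallest_sigma_algebra.
  move=> _ [g ->]; apply: sub_sigma_algebra; exists [:: (g, true)] => //.
  by apply/seteqP; split=> w; rewrite /cylinder /= andbT; [move/eqP|move=> ->].
apply: smallest_sub; first exact: sigma_algebra_measurable.
by move=> _ [s _ <-]; exact: measurable_cylinder.
Qed.

Lemma cylinder_measure_unique (m1 m2 : {measure set (coin_space G) -> \bar R}) :
  (m1 setT < +oo)%E ->
  (forall s, uniq (map fst s) -> m1 (cylinder s) = m2 (cylinder s)) ->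
  forall A, measurable A -> m1 A = m2 A.
Proof.
move=> m1oo m12 A mA.
apply: (measure_unique [set cylinder s | s in setT] (fun=> setT)) => //.
- exact: measurable_coin_space.
- by move=> _ _ [s _ <-] [t _ <-]; exists (s ++ t) => //; exact: cylinder_cat.
- by move=> _; exists [::] => //; apply/seteqP.
- by apply/seteqP; split=> // w _; exists 0%N.
- move=> _ [s _ <-]; have [->|[s' us' ->]] := cylinder_normal s.
    by rewrite !measure0.
  exact: m12.
Qed.

Lemma coin_shiftK g : cancel (@coin_shift G g) (coin_shift g^-1%g).
Proof.
move=> w; apply/funext => h.
by rewrite /coin_shift /= invgK mulKg.
Qed.

Lemma coin_shift_image g (A : set (coin_space G)) :
  coin_shift g @` A = coin_shift g^-1%g @^-1` A.
Proof.
apply/seteqP; split=> [_ [w Aw <-] /=|w Aw]; first by rewrite coin_shiftK.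
by exists (coin_shift g^-1%g w) => //; rewrite -{1}[g]invgK coin_shiftK.
Qed.

Lemma measurable_coin_shift g : measurable_fun setT (@coin_shift G g).
Proof.
apply: measurability => //.
move=> _ [_ [h ->] <-]; rewrite setTI; apply: sub_sigma_algebra.
by exists (g^-1 * h)%g.
Qed.

Lemma coin_shift_cylinder g s : coin_shift g^-1%g @^-1` (cylinder s) =
  cylinder [seq ((g * x.1)%g, x.2) | x <- s].
Proof.
by apply/seteqP; split=> w; rewrite /cylinder /= all_map /coin_shift /= invgK.
Qed.

Variable p : seq (G * bool) -> R.
Hypothesis p_ge0 : forall s, 0 <= p s.
Hypothesis p_perm : forall s t, perm_eq s t -> p s = p t.
Hypothesis p_split : forall g s, p s = p ((g, false) :: s) + p ((g, true) :: s).

Lemma cylinder_measure : exists P : {measure set (coin_space G) -> \bar R},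
  forall s, uniq (map fst s) -> P (cylinder s) = (p s)%:E.
Proof.
have /countable_injP[f finj'] := countableG.
have finj : injective f by move=> g h; apply: finj'; rewrite inE.
have ex (n : nat) : exists o : option G, forall g, o = Some g <-> f g = n.
  have [[g gn]|ng] := pselect (exists g, f g = n).
    exists (Some g) => h; split=> [[<-]//|hn]; congr Some; apply: finj.
    by rewrite gn hn.
  by exists None => g; split=> // gn; exfalso; apply: ng; exists g.
have [dec decP] := choice ex.
pose lbl (x : nat * bool) := omap (fun g => (g, x.2)) (dec x.1).
(* A label outside the range of [f] has the value [false] with full weight: asking for [true] there
   gives weight 0, and asking for [false] is dropped by [pmap]. *)
pose bad (x : nat * bool) := (dec x.1 == None) && x.2.
pose q (r : seq (nat * bool)) := if has bad r then 0 else p (pmap lbl r).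
have q_ge0 r : 0 <= q r by rewrite /q; case: ifP.
have q_perm (r1 r2 : seq (nat * bool)) : perm_eq r1 r2 -> q r1 = q r2.
  move=> r12; rewrite /q (perm_has _ r12); case: ifP => // _.
  exact/p_perm/perm_pmap.
have q_split n r : q r = q ((n, false) :: r) + q ((n, true) :: r).
  rewrite /q /= /bad /lbl /=; case: (dec n) => [g|] /=.
    by case: ifP => _; rewrite ?addr0// -p_split.
  by rewrite addr0.
pose M := q [::].
(* The guard gives the preimages the form of [measurable_process]; outside the interval the
   restricted measure vanishes. *)
pose X (t : measurableTypeR R) : coin_space G :=
  fun g => (0 <= t < M) && process q t (f g).
have XE g : X @^-1` [set w | w g] =
    `[0, M[%classic `&` [set t | process q t (f g)].
  by apply/seteqP; split=> t; rewrite /X /= in_itv /= => /andP.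
have mX : measurable_fun setT X.
  apply: measurability => //.
  move=> _ [_ [g ->] <-]; rewrite setTI XE; exact: measurable_process.
have mI : measurable (`[0, M[%classic : set R) by [].
pose lam : {measure set (measurableTypeR R) -> \bar R} :=
  mrestr (@lebesgue_measure R) mI.
pose P0 : {measure set (coin_space G) -> \bar R} := pushforward lam X.
pose P := P0 mX.
exists P => s us; pose s' := [seq (f x.1, x.2) | x <- s].
have dK g : dec (f g) = Some g by apply/decP.
have <- : q s' = p s.
  rewrite /q (_ : has bad s' = false); last first.
    by apply/negbTE/hasPn => _ /mapP[x _ ->]; rewrite /bad /= dK.
  congr p; rewrite /s'; elim: (s) => //= -[g b] r IH.
  by rewrite /lbl /= dK /= IH.
rewrite -(lebesgue_cylinder q_ge0 q_perm q_split); last first.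
  by rewrite /s' -map_comp (map_comp f fst) map_inj_uniq.
congr (lebesgue_measure _); rewrite setIC; apply/seteqP; split=> t.
  move=> [t01]; rewrite /cylinder /= => h; split=> //=.
  rewrite all_map; apply: sub_all h => -[g b] /=.
  by move: t01; rewrite /X /= in_itv /= => ->.
move=> [t01 /= h]; split=> //; rewrite /cylinder /=.
move: h; rewrite all_map; apply: sub_all => -[g b] /=.
by move: t01; rewrite /X /= in_itv /= => ->.
Qed.

Hypothesis p_inv : forall g s, p [seq ((g * x.1)%g, x.2) | x <- s] = p s.

Lemma invariant_cylinder_measure :
  exists P : {measure set (coin_space G) -> \bar R},
    (forall s, uniq (map fst s) -> P (cylinder s) = (p s)%:E) /\
    (forall g A, measurable A -> P (coin_shift g @` A) = P A).
Proof.
have [P PE] := cylinder_measure; exists P; split=> // g A mA.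
have mg : measurable_fun setT (@coin_shift G g^-1%g).
  exact: measurable_coin_shift.
pose P0 : {measure set (coin_space G) -> \bar R} :=
  pushforward P (coin_shift g^-1%g).
pose P' := P0 mg.
rewrite coin_shift_image -[LHS]/(P' A); apply/esym.
apply: cylinder_measure_unique mA.
  have -> : setT = cylinder ([::] : seq (G * bool)) by apply/seteqP.
  by rewrite PE// ltry.
move=> s us; rewrite /P' /P0 /= /pushforward coin_shift_cylinder !PE ?p_inv//.
rewrite -map_comp (_ : _ \o _ = (fun h => g * h)%g \o fst)//.
by rewrite map_comp map_inj_uniq//; exact: mulgI.
Qed.

End CylinderMeasure.

(** * An action with unbounded displacement *)

Section UnboundedAction.
Variables (R : realType) (G : groupType).
Hypothesis countableG : countable [set: G].
Hypothesis nT : ~ property_T R G.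

Let S : set (coin_space G) := cylinder [:: (1%g, true)].

Let coin_shift_cylinder1 g : coin_shift g @` S = cylinder [:: (g, true)].
Proof. by rewrite coin_shift_image /S coin_shift_cylinder /= mulg1. Qed.

Let cylinderY g : S `+` (coin_shift g @` S) =
  cylinder [:: (1%g, true); (g, false)] `|`
  cylinder [:: (1%g, false); (g, true)].
Proof.
rewrite coin_shift_cylinder1 /S setY_def /cylinder; apply/seteqP; split=> w /=;
  rewrite !andbT; case: (w 1%g); case: (w g) => /=; by intuition.
Qed.

Lemma displaced_measure (Q : seq G) (e c : R) : 0 < e -> 0 < c ->
  exists P : {measure set (coin_space G) -> \bar R},
  [/\ forall g A, measurable A -> P (coin_shift g @` A) = P A,
      forall g, (P (S `+` (coin_shift g @` S)) < +oo)%E,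
      forall g, g \in Q -> (P (S `+` (coin_shift g @` S)) <= e%:E)%E &
      exists g, P (S `+` (coin_shift g @` S)) = c%:E].
Proof.
move=> e0 c0; pose e1 := Num.min 2^-1 (e / c).
(* After scaling by [c / cut g0], the factor [e / c] yields the bound [e] on [Q]; the factor 1/2
   rules out [g0 = 1], where a positive [cut g0] would be at most half of itself. *)
have e1_gt0 : 0 < e1 by rewrite lt_min invr_gt0 ltr0n divr_gt0.
(* As cut 1 may be positive, 1 is added to Q to ensure g0 <> 1. *)
have [p [p0 p_perm p_split p_inv]] := cut_process nT (1%g :: Q) e1_gt0.
set cut := fun g => _ => -[g0 cut0 cutQ].
have [||||P [PE Pinv]] :=
    @invariant_cylinder_measure _ _ countableG (fun s => c / cut g0 * p s).
- by move=> s; rewrite mulr_ge0// divr_ge0// ltW.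
- by move=> s t st; rewrite (p_perm _ _ st).
- by move=> g s; rewrite (p_split g s) mulrDr.
- by move=> g s; rewrite p_inv.
have PY g : g != 1%g -> P (S `+` (coin_shift g @` S)) = (c / cut g0 * cut g)%:E.
  move=> g1; rewrite cylinderY.
  have -> : P (cylinder [:: (1%g, true); (g, false)] `|`
      cylinder [:: (1%g, false); (g, true)]) =
      (P (cylinder [:: (1%g, true); (g, false)]) +
       P (cylinder [:: (1%g, false); (g, true)]))%E; last first.
    by rewrite !PE /= ?inE ?andbT 1?eq_sym// /cut mulrDr EFinD.
  apply: measureU; try exact: measurable_cylinder.
  apply/seteqP; split=> w //; rewrite /cylinder /= !andbT.
  by move=> [/andP[/eqP -> _] /andP[]].
have PY1 : P (S `+` (coin_shift 1%g @` S)) = 0%E.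
  by rewrite coin_shift_cylinder1 setYK measure0.
have g01 : g0 != 1%g.
  apply/eqP => g01; have := cutQ 1%g (mem_head _ _); rewrite -g01 => h.
  have : e1 <= 2^-1 by rewrite /e1 ge_min lexx.
  by have : cut g0 * e1 <= cut g0 * 2^-1 -> False; [nra|rewrite ler_pM2l].
exists P; split=> //.
- by move=> g; have [->|g1] := eqVneq g 1%g; rewrite ?PY1 ?PY// ltry.
- move=> g gQ; have [->|g1] := eqVneq g 1%g; first by rewrite PY1 lee_fin ltW.
  rewrite PY// lee_fin; have : cut g <= e1 * cut g0.
    by apply: cutQ; rewrite inE gQ orbT.
  move=> h; rewrite mulrAC ler_pdivrMr//.
  have e1c : e1 <= e / c by rewrite /e1 ge_min lexx orbT.
  rewrite ler_pdivlMr// in e1c.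
  have : c * cut g <= c * (e1 * cut g0) by rewrite ler_pM2l.
  have : (e1 * c) * cut g0 <= e * cut g0 by rewrite ler_pM2r.
  lra.
- by exists g0; rewrite PY// divfK// gt_eqF.
Qed.

(** [P n] displaces [S] by [n + 1] for some element, but by at most [1 / 2 ^ (n + 1)] for the first
    [n] elements of the enumeration. At a fixed [g] only finitely many terms escape this summable
    bound. *)
Lemma unbounded_action : exists mu : {measure set (coin_space G) -> \bar R},
  [/\ measure_preserving_action mu (@coin_shift G), measurable S,
      forall g, (mu (S `+` (coin_shift g @` S)) < +oo)%E &
      ereal_sup [set mu (S `+` (coin_shift g @` S)) | g in [set: G]] = +oo%E].
Proof.
have [en enP] := enumeration countableG.
have ex (n : nat) : exists P : {measure set (coin_space G) -> \bar R},
  [/\ forall g A, measurable A -> P (coin_shift g @` A) = P A,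
      forall g, (P (S `+` (coin_shift g @` S)) < +oo)%E,
      forall g, g \in [seq en k | k <- iota 0 n] ->
        (P (S `+` (coin_shift g @` S)) <= (1 / (2 ^ n.+1)%:R)%:E)%E &
      exists g, P (S `+` (coin_shift g @` S)) = (n.+1%:R)%:E].
  by apply: displaced_measure => //; rewrite divr_gt0// ltr0n expn_gt0.
have [P PP] := choice ex.
pose mu : {measure set (coin_space G) -> \bar R} := mseries P 0.
have muE A : mu A = (\sum_(0 <= n <oo) P n A)%E by [].
have mS : measurable S by exact: measurable_cylinder.
exists mu; split=> //.
- split=> [w|g h w|g E mE].
  + by apply/funext => h; rewrite /coin_shift invg1 mul1g.
  + by apply/funext => k; rewrite /coin_shift invgM mulgA.
  + split; last first.
      by rewrite !muE; apply: eq_eseriesr => n _; have [-> //] := PP n.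
    rewrite coin_shift_image -[X in measurable X]setTI.
    exact: measurable_coin_shift.
- move=> g; have [m gm] := enP g.
  (* [g = en m] is controlled from index [m + 1] on; [A] keeps the earlier terms. *)
  pose A n : \bar R :=
    if (n < m.+1)%N then P n (S `+` (coin_shift g @` S)) else 0%E.
  have A0 n : (0 <= A n)%E by rewrite /A; case: ifP.
  have le : (mu (S `+` (coin_shift g @` S)) <=
      \sum_(0 <= n <oo) (A n + (1 / (2 ^ n.+1)%:R)%:E))%E.
    rewrite muE; apply: lee_nneseries => // n _; rewrite /A.
    have [nm|mn] := ltnP n m.+1.
      by rewrite leeDl// lee_fin divr_ge0.
    rewrite add0e; have [_ _ + _] := PP n; apply.
    by apply/mapP; exists m => //; rewrite mem_iota add0n.
  apply: (le_lt_trans le); apply: (le_lt_trans (epsilon_trick _ A0 ler01)).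
  rewrite (nneseries_split 0 m.+1)// eseries0; last first.
    by move=> n mn _; rewrite /A ltnNge -[(m < n)%N]/(m.+1 <= n)%N mn.
  rewrite adde0 lte_add_pinfty ?ltry//.
  apply: lte_sum_pinfty => n _; rewrite /A; case: ifP => // _.
  by have [] := PP n.
- set M := ereal_sup _; have MP n : ((n.+1%:R)%:E <= M)%E.
    have [_ _ _ [g <-]] := PP n.
    apply: (@le_trans _ _ (mu (S `+` (coin_shift g @` S)))); last first.
      by apply: ereal_sup_ubound; exists g.
    rewrite muE; apply: le_trans (nneseries_lim_ge n.+1 _) => //.
    by rewrite big_nat_recr//= leeDr// sume_ge0.
  move: MP; case: M => [r| |] MP //; last by have := MP 0%N.
  have := MP (Num.truncn r); rewrite lee_fin leNgt.
  by rewrite truncnS_gt.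
Qed.

End UnboundedAction.

Local Open Scope ereal_scope.

Theorem theorem2p1 (R : realType) (G : groupType)
    (countableG : countable [set: G]) :
  property_T R G <->
  (forall (d : measure_display) (T : measurableType d)
     (mu : {measure set T -> \bar R}) (act : G -> T -> T) (S : set T),
     measure_preserving_action mu act ->
     measurable S ->
     (forall g : G, mu (S `+` (act g @` S)) < +oo) ->
     ereal_sup [set mu (S `+` (act g @` S)) | g in [set: G]] < +oo).
Proof.
split=> [TG d T mu act S|bounded].
  exact: property_T_bounded.
apply: contrapT => nT.
have [mu [muP mS muoo sup]] := unbounded_action countableG nT.
by have := bounded _ _ mu _ _ muP mS muoo; rewrite sup ltxx.
Qed.
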